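(* Let $\Gamma$ be a groupoid and $R=\bigoplus_{\gamma\in\Gamma}R_\gamma$ a $\Gamma$-graded ring. The following statements are equivalent. (1) $R$ is a pfm ring. (2) There exist a family $\{K_j:j\in J\}$ of non-empty sets, sequences $(e_j)_{j\in J},(f_j)_{j\in J}\in(\Gamma_0)^J$ and, for each $j\in J$, a $\Gamma$-graded division ring $D_j$ with $\operatorname{supp}(D_j)\subseteq e_j\Gamma e_j$ and a $d$-finite sequence $\overline{\sigma}_j=(\sigma_{jk})_{k\in K_j}\in(e_j\Gamma)^{K_j}$ such that the family $\{\mathrm{M}_{K_j}(D_j)(\overline{\sigma}_j):j\in J\}$ is summable, $R\cong_{gr}\prod^{gr}_{j\in J}\mathrm{M}_{K_j}(D_j)(\overline{\sigma}_j)$ and, writing $K_{j',f}:=\{k\in K_{j'}:d(\sigma_{j'k})=f\}$, for each $j\in J$ the set $K_{j,f_j}$ has exactly one element and $\{j'\in J:K_{j',f_j}\neq\emptyset\}=\{j\}$. (3) There exist a summable family $\{R_j:j\in J\}$ of gr-prime pfm rings and $(f_j)_{j\in J}\in(\Gamma_0)^J$ such that $R\cong_{gr}\prod^{gr}_{j\in J}R_j$ and, for each $j\in J$, $R(f_j)$ is gr-simple and $R_j(f_j)\ne0$. (4) There exist a summable family $\{R_j:j\in J\}$ of gr-simple rings and $(f_j)_{j\in J}\in(\Gamma_0)^J$ such that $R\cong_{gr}\prod^{gr}_{j\in J}R_j$ and, for each $j\in J$, $R(f_j)$ is gr-simple and $R_j(f_j)\neq0$. (5) There exists $\Delta_0\subseteq\Gamma_0'(R)$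 such that $R(\Delta_0)$ is $\Gamma_0$-simple and $R_R$ is gr-isomorphic to a direct sum of shifts of elements from $\{R(e):e\in\Delta_0\}$. (6) There exist a summable family $\{R_j:j\in J\}$ of gr-simple $\Gamma_0$-artinian rings and $(f_j)_{j\in J}\in(\Gamma_0)^J$ such that $R\cong_{gr}\prod^{gr}_{j\in J}R_j$ and, for each $j\in J$, $R_{f_j}$ is a division ring and $(R_{j'})_{f_j}=0$ whenever $j'\in J\setminus\{j\}$.
   Context: A groupoid $\Gamma$ is a small category with all morphisms invertible, identified with its set of morphisms; $\Gamma_0$ is its set of objects (identified with identity morphisms). For $\gamma:e\to f$ write $d(\gamma)=e$, $r(\gamma)=f$; $\delta\gamma$ is defined iff $d(\delta)=r(\gamma)$. $e\Gamma=\{\gamma:r(\gamma)=e\}$, $e\Gamma f=\{\gamma:r(\gamma)=e,d(\gamma)=f\}$. A $\Gamma$-graded ring is an associative ring $R=\bigoplus_{\gamma\in\Gamma}R_\gamma$ (additive subgroups) with $R_\gamma R_\delta\subseteq R_{\gamma\delta}$ if $\gamma\delta$ is defined and $R_\gamma R_\delta=0$ otherwise (generally, components indexed by undefined products are $\{0\}$), always assumed object unital: for each $e\in\Gamma_0$, $R_e$ is a unital ring with identity $1_e$ (possibly $1_e=0$) and $1_{r(\gamma)}a=a=a1_{d(\gamma)}$ for $a\in R_\gamma$. $\operatorname{supp}(R)=\{\gamma:R_\gamma\neq0\}$, $\Gamma_0'(R)=\{e\in\Gamma_0:1_e\ne0\}$. A $\Gamma$-graded $R$-module is a right $R$-module $M=\bigoplus_\gamma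 M_\gamma$ with $M_\gamma R_\delta\subseteq M_{\gamma\delta}$ (zero if undefined) and $MR=M$. $\cong_{gr}$ (of rings or modules) means there is a degree-preserving isomorphism. For $\sigma\in\Gamma$, the shift $M(\sigma)$ is the graded module with $M(\sigma)_\gamma=M_{\sigma\gamma}$ ($0$ if $\sigma\gamma$ is undefined); in particular $M(e)=\bigoplus_{r(\gamma)=e}M_\gamma$ for $e\in\Gamma_0$, and $R(e)=1_eR$. For $\Delta_0\subseteq\Gamma_0$, $R(\Delta_0):=\bigoplus_{e\in\Delta_0}R(e)$. A graded module is gr-simple if nonzero with only graded submodules $0$ and itself; $S$ is $\Gamma_0$-simple if $S(e)$ is gr-simple for every $e\in\Gamma_0$ with $S(e)\neq0$. A ring $R$ is gr-simple if $R\ne0$ and its only graded (two-sided) ideals are $0,R$; gr-prime if $IJ\neq0$ for all nonzero graded ideals $I,J$; $\Gamma_0$-artinian if for each $e\in\Gamma_0$, $R(e)$ satisfies the descending chain condition on graded right submodules (for gr-simple rings this is left-right symmetric). A graded $R$-module $M$ is pseudo-free if it has a pseudo-basis: a sequence of (nonzero) homogeneous elements $x_i\in M_{\gamma_i}$ $(i\in I)$ generating $M$ such that the only $(a_i)\in\bigoplus_i1_{d(\gamma_i)}R$ with $\sum x_ia_i=0$ is $(a_i)=0$. $R$ is a pfm (pseudo-free module) ring if every $\Gamma$-graded right $R$-module is pseudo-free. A $\Gamma$-graded division ring is a $\Gamma$-graded ring $D\neq0$ such that each nonzero $a\in D_\gamma$ has $a^{-1}\in D_{\gamma^{-1}}$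 with $aa^{-1}=1_{r(\gamma)}$, $a^{-1}a=1_{d(\gamma)}$. $\prod^{gr}_jR_j$ is the $\Gamma$-graded ring with $\gamma$-component $\prod_j(R_j)_\gamma$; the family $\{R_j\}$ is summable if $\prod^{gr}_jR_j=\bigoplus_jR_j$. A sequence $(\sigma_k)_{k\in K}\in(e\Gamma)^K$ is $d$-finite if for each $f\in\Gamma_0$ only finitely many $k$ satisfy $d(\sigma_k)=f$. For such a sequence and $D$ with $\operatorname{supp}(D)\subseteq e\Gamma e$, $\mathrm{M}_K(D)(\overline{\sigma})$ is the ring of $K\times K$ matrices over $D$ with finitely many nonzero entries, graded by letting the $\gamma$-component be the matrices with $(k,l)$ entry in $D_{\sigma_k\gamma\sigma_l^{-1}}$ ($\{0\}$ if undefined). *)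

(* Defs.v *)
From HB Require Import structures.
From mathcomp Require Import all_boot all_order all_algebra.
From mathcomp Require Import all_classical.

Set Implicit Arguments.
Unset Strict Implicit.
Unset Printing Implicit Defensive.

Import GRing.Theory.

Local Open Scope classical_set_scope.
Local Open Scope ring_scope.

(* Composition is partial: [gcomp g h] is [None] exactly when gh is undefined,
   that is, when d(g) <> r(h).  An object e is identified with the morphism
   [gid e].  The [choiceType] structures are no restriction classically (see
   [gen_choiceMixin]). *)
Record groupoid := Groupoid {
  gobj : choiceType;
  gmor :> choiceType;
  gdom : gmor -> gobj;
  grng : gmor -> gobj;
  gid : gobj -> gmor;
  ginv : gmor -> gmor;
  gcomp : gmor -> gmor -> option gmor;
  gdom_id : forall e, gdom (gid e) = e;
  grng_id : forall e, grng (gid e) = e;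
  gcomp_defined : forall g h, isSome (gcomp g h) = (gdom g == grng h);
  gdom_comp : forall g h k, gcomp g h = Some k -> gdom k = gdom h;
  grng_comp : forall g h k, gcomp g h = Some k -> grng k = grng g;
  gcompA : forall g h k,
    obind (gcomp g) (gcomp h k) = obind (fun gh => gcomp gh k) (gcomp g h);
  gcomp1g : forall g, gcomp (gid (grng g)) g = Some g;
  gcompg1 : forall g, gcomp g (gid (gdom g)) = Some g;
  gcompVg : forall g, gcomp (ginv g) g = Some (gid (gdom g));
  gcompgV : forall g, gcomp g (ginv g) = Some (gid (grng g))
}.
Arguments gid {g0} e : rename.

Definition corner (G : groupoid) (e : gobj G) : set G :=
  [set g | grng g = e /\ gdom g = e].

Section GroupoidTheory.
Variable G : groupoid.
Implicit Types g h k : G.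

Lemma gcompP g h : gdom g = grng h -> exists k, gcomp g h = Some k.
Proof.
by move/eqP; rewrite -gcomp_defined; case: (gcomp g h) => // k _; exists k.
Qed.

Lemma gcomp_dr g h k : gcomp g h = Some k -> gdom g = grng h.
Proof. by move=> E; apply/eqP; rewrite -gcomp_defined E. Qed.

Lemma gdom_inv g : gdom (ginv g) = grng g.
Proof. exact: gcomp_dr (gcompVg g). Qed.

Lemma grng_inv g : grng (ginv g) = gdom g.
Proof. exact/esym/(gcomp_dr (gcompgV g)). Qed.

Lemma gcompKl g h k : gcomp g h = Some k -> gcomp (ginv g) k = Some h.
Proof.
move=> E; have := gcompA (ginv g) g h.
by rewrite E gcompVg /= (gcomp_dr E) gcomp1g.
Qed.

Lemma gcompKr g h k : gcomp g h = Some k -> gcomp k (ginv h) = Some g.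
Proof.
move=> E; have := gcompA g h (ginv h).
by rewrite E gcompgV /= -(gcomp_dr E) gcompg1.
Qed.

Lemma gcompKVl g h k : gcomp (ginv g) h = Some k -> gcomp g k = Some h.
Proof.
move=> E; have := gcompA g (ginv g) h.
by rewrite E gcompgV /= -gdom_inv (gcomp_dr E) gcomp1g.
Qed.

Lemma gcompKVr g h k : gcomp g (ginv h) = Some k -> gcomp k h = Some g.
Proof.
move=> E; have := gcompA g (ginv h) h.
by rewrite E gcompVg /= -grng_inv -(gcomp_dr E) gcompg1.
Qed.

End GroupoidTheory.

Record subgroup (X : zmodType) := Subgroup {
  sg_set : set X;
  sg0 : sg_set 0;
  sgB : forall x y, sg_set x -> sg_set y -> sg_set (x - y)
}.

Definition sg_pred (X : zmodType) (S : subgroup X) : {pred X} :=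
  fun x => `[< sg_set S x >].

Section SubgroupType.
Variables (X : zmodType) (S : subgroup X).

Lemma sg_pred_closed : zmod_closed (sg_pred S).
Proof.
split; first by apply/asboolP; exact: sg0.
by move=> x y /asboolP Sx /asboolP Sy; apply/asboolP; exact: sgB.
Qed.

HB.instance Definition _ :=
  GRing.isZmodClosed.Build X (sg_pred S) sg_pred_closed.

Record subgrp := Subgrp { subgrp_val : X; subgrp_valP : subgrp_val \in sg_pred S }.

HB.instance Definition _ := [isSub of subgrp for subgrp_val].
HB.instance Definition _ := [Choice of subgrp by <:].
HB.instance Definition _ := [SubChoice_isSubZmodule of subgrp by <:].

Lemma subgrpP (x : subgrp) : sg_set S (subgrp_val x).
Proof. exact/asboolP/subgrp_valP. Qed.

Definition mk_subgrp (x : X) (Sx : sg_set S x) : subgrp :=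
  Subgrp (introT (asboolP (sg_set S x)) Sx).

Lemma subgrp_inj : injective subgrp_val. Proof. exact: val_inj. Qed.
Lemma subgrp_valB x y : subgrp_val (x - y) = subgrp_val x - subgrp_val y.
Proof. by []. Qed.
Lemma subgrp_valD x y : subgrp_val (x + y) = subgrp_val x + subgrp_val y.
Proof. by []. Qed.
Lemma subgrp_val0 : subgrp_val 0 = 0.
Proof. by []. Qed.
End SubgroupType.

(* An alias, so that the instances below do not compete with those on T -> M. *)
Definition dprod (I : Type) (X : I -> zmodType) := forall i, X i.

Section DProd.
Variables (I : Type) (X : I -> zmodType).
HB.instance Definition _ := gen_eqMixin (dprod X).
HB.instance Definition _ := gen_choiceMixin (dprod X).

Let add (x y : dprod X) : dprod X := fun i => x i + y i.
Let opp (x : dprod X) : dprod X := fun i => - x i.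
Let zero : dprod X := fun i => 0.

Let addA : associative add.
Proof. by move=> x y z; apply: functional_extensionality_dep => i; exact: addrA. Qed.
Let addC : commutative add.
Proof. by move=> x y; apply: functional_extensionality_dep => i; exact: addrC. Qed.
Let add0 : left_id zero add.
Proof. by move=> x; apply: functional_extensionality_dep => i; exact: add0r. Qed.
Let addN : left_inverse zero opp add.
Proof. by move=> x; apply: functional_extensionality_dep => i; exact: addNr. Qed.

HB.instance Definition _ :=
  GRing.isZmodule.Build (dprod X) addA addC add0 addN.
End DProd.

(* [c] is the family of homogeneous components of [x]. *)
Definition is_decomp (G : groupoid) (X : zmodType) (comp : G -> set X)
    (x : X) (c : G -> X) :=
  [/\ forall g, comp g (c g), finite_set [set g | c g != 0]
    & x = \sum_(g \in [set: G]) c g].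

Record gradedZmod (G : groupoid) := GradedZmod {
  gz_sort :> zmodType;
  homog : G -> set gz_sort;
  homog0 : forall g, homog g 0;
  homogB : forall g x y, homog g x -> homog g y -> homog g (x - y);
  direct_sum : forall x, exists! c : G -> gz_sort, is_decomp homog x c
}.

(* Components indexed by an undefined product are {0}. *)
Definition ohomog (G : groupoid) (M : gradedZmod G) (o : option G) : set M :=
  if o is Some g then homog g else [set 0].

Definition gproj (G : groupoid) (M : gradedZmod G) (g : G) (x : M) : M :=
  projT1 (cid (direct_sum x)) g.

Definition oproj (G : groupoid) (M : gradedZmod G) (o : option G) (x : M) : M :=
  if o is Some g then gproj g x else 0.

Lemma fsum_seq (T : choiceType) (X : zmodType) (F : T -> X) (s : seq T) :
  uniq s -> (forall i, F i != 0 -> i \in s) ->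
  \sum_(i \in [set: T]) F i = \sum_(i <- s) F i.
Proof.
move=> us Fs; rewrite fsbig_supp; apply: fsbig_fwiden => //.
  by move=> i [_ /= /eqP /Fs].
by move=> i [/= is_]; apply: contra_notP => Fi; split.
Qed.

Lemma finite_uniq (T : choiceType) (A : set T) :
  finite_set A -> exists2 s : seq T, uniq s & forall i, A i -> i \in s.
Proof.
move=> fA; exists (finmap.enum_fset (fset_set A)); first exact: finmap.fset_uniq.
by move=> i Ai; rewrite in_fset_set // inE.
Qed.

Section GradedZmodTheory.
Variables (G : groupoid) (M : gradedZmod G).
Implicit Types (x y : M) (g h : G).

Lemma homogN g x : homog g x -> homog g (- x).
Proof. by move=> hx; rewrite -sub0r; apply: homogB => //; exact: homog0. Qed.

Lemma homogD g x y : homog g x -> homog g y -> homog g (x + y).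
Proof. by move=> hx hy; rewrite -[y]opprK; apply: homogB => //; exact: homogN. Qed.

Lemma ohomog0 (o : option G) : ohomog o (0 : M).
Proof. by case: o => [g|] //=; exact: homog0. Qed.

Lemma ohomogB (o : option G) x y : ohomog o x -> ohomog o y -> ohomog o (x - y).
Proof. by case: o => [g|] /=; [exact: homogB|move=> -> ->; rewrite subrr]. Qed.

Lemma ohomogD (o : option G) x y : ohomog o x -> ohomog o y -> ohomog o (x + y).
Proof. by case: o => [g|] /=; [exact: homogD|move=> -> ->; rewrite addr0]. Qed.

Lemma ohomog_sum (o : option G) (T : Type) (s : seq T) (F : T -> M) :
  (forall i, ohomog o (F i)) -> ohomog o (\sum_(i <- s) F i).
Proof.
move=> hF; elim: s => [|i s ih]; first by rewrite big_nil; exact: ohomog0.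
by rewrite big_cons; exact: ohomogD.
Qed.

Lemma gproj_decomp x : is_decomp (@homog G M) x (fun g => gproj g x).
Proof. by rewrite /gproj; case: cid => c [] /=. Qed.

Lemma gproj_unique x c : is_decomp (@homog G M) x c -> forall g, gproj g x = c g.
Proof. by rewrite /gproj; case: cid => c' [_ u] /= /u ->. Qed.

Lemma gproj_homog g x : homog g (gproj g x).
Proof. by have [] := gproj_decomp x. Qed.

Lemma gproj_finite x : finite_set [set g | gproj g x != 0].
Proof. by have [] := gproj_decomp x. Qed.

Lemma gproj_sum x : x = \sum_(g \in [set: G]) gproj g x.
Proof. by have [] := gproj_decomp x. Qed.

Lemma gproj_seq x : exists2 s : seq G,
  uniq s /\ (forall g, gproj g x != 0 -> g \in s) & x = \sum_(g <- s) gproj g x.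
Proof.
have [s us ss] := finite_uniq (gproj_finite x).
by exists s => //; rewrite {1}(gproj_sum x); exact: fsum_seq.
Qed.

Lemma gproj_ext x y : (forall g, gproj g x = gproj g y) -> x = y.
Proof.
move=> E; rewrite (gproj_sum x) (gproj_sum y).
by apply: eq_fsbigr => g _; exact: E.
Qed.

Lemma gproj_B g x y : gproj g (x - y) = gproj g x - gproj g y.
Proof.
have F : finite_set [set h | gproj h x - gproj h y != 0].
  apply: (@sub_finite_set _ _
      ([set h | gproj h x != 0] `|` [set h | gproj h y != 0])).
    move=> h /=; case: (eqVneq (gproj h x) 0) => [->|]; last by left.
    by case: (eqVneq (gproj h y) 0) => [->|]; [rewrite subrr eqxx|right].
  by rewrite finite_setU; split; exact: gproj_finite.
apply: (@gproj_unique _ (fun g => gproj g x - gproj g y)); split => //.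
  by move=> h; apply: homogB; exact: gproj_homog.
have Fx := gproj_finite x; have Fy := gproj_finite y.
have [s us ss] := finite_uniq (A := [set h | gproj h x != 0] `|`
   [set h | gproj h y != 0]) ltac:(by rewrite finite_setU).
rewrite (@fsum_seq _ _ _ s) //; last first.
  move=> h; case: (eqVneq (gproj h x) 0) => [->|nx]; last by move=> _; apply: ss; left.
  case: (eqVneq (gproj h y) 0) => [->|ny]; first by rewrite subrr eqxx.
  by move=> _; apply: ss; right.
rewrite big_split /= sumrN.
by congr (_ - _); [rewrite {1}(gproj_sum x)|rewrite {1}(gproj_sum y)];
  apply: fsum_seq => // h nh; apply: ss; [left|right].
Qed.

Lemma gproj0 g : gproj g (0 : M) = 0.
Proof. by rewrite -{1}(subrr 0) gproj_B subrr. Qed.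

Lemma gprojD g x y : gproj g (x + y) = gproj g x + gproj g y.
Proof. by rewrite -{1}[y]opprK -(sub0r y) !gproj_B gproj0 sub0r opprK. Qed.

Lemma gproj_big (T : Type) g (s : seq T) (F : T -> M) :
  gproj g (\sum_(i <- s) F i) = \sum_(i <- s) gproj g (F i).
Proof.
elim: s => [|i s ih]; first by rewrite !big_nil gproj0.
by rewrite !big_cons gprojD ih.
Qed.

Lemma gproj_id g h x : homog h x -> gproj g x = if g == h then x else 0.
Proof.
move=> hx; apply: (@gproj_unique x (fun g => if g == h then x else 0)); split.
- by move=> k; case: eqP => [->|_] //; exact: homog0.
- apply: (@sub_finite_set _ _ [set h]); last exact: finite_set1.
  by move=> k /=; case: (eqVneq k h) => // _; rewrite eqxx.
- rewrite (@fsum_seq _ _ _ [:: h]) //; first by rewrite big_seq1 eqxx.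
  by move=> k; rewrite inE; case: (k == h) => //; rewrite eqxx.
Qed.

Lemma ohomog_oproj (o : option G) x : ohomog o (oproj o x).
Proof. by case: o => [g|] //=; exact: gproj_homog. Qed.

Lemma oproj_neq0 (o : option G) x : oproj o x != 0 ->
  exists2 h, o = Some h & gproj h x != 0.
Proof. by case: o => [h|] /=; [exists h|rewrite eqxx]. Qed.

End GradedZmodTheory.

(* A reusable criterion for a direct sum decomposition: X embeds into a product
   of graded groups Y i, and its component of degree g consists of the x whose
   image in Y i lies in the component of degree rho i g ({0} if undefined). *)
Section BuildGraded.
Variables (G : groupoid) (X : zmodType) (I : Type) (Y : I -> gradedZmod G).
Variables (phi : forall i, X -> Y i) (rho : I -> G -> option G).
Hypothesis phiB : forall i x y, phi i (x - y) = phi i x - phi i y.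
Hypothesis phi_inj : forall x y, (forall i, phi i x = phi i y) -> x = y.
Hypothesis rho_inj : forall i g g' h,
  rho i g = Some h -> rho i g' = Some h -> g = g'.
Hypothesis rho_surj : forall i x h,
  gproj h (phi i x) != 0 -> exists g, rho i g = Some h.
Hypothesis pr_ex : forall g x,
  exists y, forall i, phi i y = oproj (rho i g) (phi i x).
Hypothesis pr_fin : forall x,
  finite_set [set g | exists i, oproj (rho i g) (phi i x) != 0].

Definition build_homog (g : G) : set X :=
  [set x | forall i, ohomog (rho i g) (phi i x)].

Lemma build_phi0 i : phi i 0 = 0.
Proof. by rewrite -{1}(subrr 0) phiB subrr. Qed.

Lemma build_phiD i x y : phi i (x + y) = phi i x + phi i y.
Proof.
have N z : phi i (- z) = - phi i z by rewrite -sub0r phiB build_phi0 sub0r.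
by rewrite -{1}[y]opprK phiB N opprK.
Qed.

Lemma build_phi_big i (T : Type) (s : seq T) (F : T -> X) :
  phi i (\sum_(k <- s) F k) = \sum_(k <- s) phi i (F k).
Proof.
elim: s => [|k s ih]; first by rewrite !big_nil build_phi0.
by rewrite !big_cons build_phiD ih.
Qed.

Lemma build_homog0 g : build_homog g 0.
Proof. by move=> i; rewrite build_phi0; exact: ohomog0. Qed.

Lemma build_homogB g x y :
  build_homog g x -> build_homog g y -> build_homog g (x - y).
Proof. by move=> hx hy i; rewrite phiB; exact: ohomogB. Qed.

Lemma build_direct_sum x : exists! c : G -> X, is_decomp build_homog x c.
Proof.
pose c g := projT1 (cid (pr_ex g x)).
have cE g i : phi i (c g) = oproj (rho i g) (phi i x).
  by rewrite /c; case: cid => y /=.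
have cn g : c g != 0 -> exists i, oproj (rho i g) (phi i x) != 0.
  move=> n; apply: contrapT => H; case/eqP: n; apply: phi_inj => i.
  rewrite cE build_phi0; apply/eqP/negPn/negP => ne; apply: H.
  by exists i.
have uq (c' : G -> X) : is_decomp build_homog x c' -> forall g, c' g = c g.
  case=> h' f' e' g; apply: phi_inj => i; rewrite cE.
  case E : (rho i g) => [h|] /=; last first.
    by have := h' g i; rewrite E.
  have [s us ss] := finite_uniq f'.
  have hE k : gproj h (phi i (c' k)) = if k == g then phi i (c' g) else 0.
    have := h' k i; case: (eqVneq k g) => [->|nkg].
      by rewrite E /= => /gproj_id ->; rewrite eqxx.
    case Ek : (rho i k) => [l|] /=; last by move=> ->; rewrite gproj0.
    move=> /gproj_id ->; case: eqP => // hl.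
    by case/eqP: nkg; apply: (rho_inj Ek); rewrite E hl.
  rewrite e' (@fsum_seq _ _ _ s) // build_phi_big gproj_big.
  under eq_bigr => k _ do rewrite hE.
  case gs : (g \in s); last first.
    have c0 : c' g = 0 by apply/eqP/negPn/negP => /ss; rewrite gs.
    by rewrite c0 build_phi0 big1 // => k _; case: ifP.
  rewrite (bigD1_seq g) //= eqxx big1 ?addr0 // => k /negPf ->.
  by [].
exists c; split; last by move=> c' /uq H; apply: funext => g; rewrite H.
have fc : finite_set [set g | c g != 0].
  by apply: (sub_finite_set _ (pr_fin x)) => g /= /cn.
split => //.
  by move=> g i; rewrite cE; exact: ohomog_oproj.
have [s us ss] := finite_uniq fc.
rewrite (@fsum_seq _ _ _ s) //; apply: phi_inj => i.
rewrite build_phi_big; apply: gproj_ext => h; rewrite gproj_big.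
case: (eqVneq (gproj h (phi i x)) 0) => [z|n].
  rewrite z big1 // => g _; rewrite cE.
  case E : (rho i g) => [k|] /=; last by rewrite gproj0.
  rewrite (gproj_id _ (gproj_homog k (phi i x))).
  by case: eqP => // <-.
have [g Eg] := rho_surj n.
have gs : g \in s.
  apply: ss => /=; apply/eqP => cg0; case/eqP: n.
  by have := cE g i; rewrite cg0 build_phi0 Eg /= => <-.
rewrite (bigD1_seq g) //= cE Eg /= (gproj_id _ (gproj_homog h _)) eqxx.
rewrite big1 ?addr0 // => k nkg; rewrite cE.
case E : (rho i k) => [l|] /=; last by rewrite gproj0.
rewrite (gproj_id _ (gproj_homog l _)); case: eqP => // hl.
by case/eqP: nkg; apply: (rho_inj E); rewrite Eg hl.
Qed.

Definition build_gz : gradedZmod G :=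
  GradedZmod build_homog0 build_homogB build_direct_sum.
End BuildGraded.

(* An associative ring, not assumed unital, with its local units [gone e]. *)
Record gradedRing (G : groupoid) := GradedRing {
  gr_zmod :> gradedZmod G;
  rmul : gr_zmod -> gr_zmod -> gr_zmod;
  gone : gobj G -> gr_zmod;
  rmulA : associative rmul;
  rmulDl : left_distributive rmul +%R;
  rmulDr : right_distributive rmul +%R;
  homog_mul : forall g h a b,
    homog g a -> homog h b -> ohomog (gcomp g h) (rmul a b);
  gone_homog : forall e, homog (gid e) (gone e);
  gone_mul : forall g a, homog g a -> rmul (gone (grng g)) a = a;
  mul_gone : forall g a, homog g a -> rmul a (gone (gdom g)) = a
}.

Section RingTheory.
Variables (G : groupoid) (R : gradedRing G).
Implicit Types a b : R.

Lemma rmul0 a : rmul a 0 = 0.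
Proof. by apply: (addrI (rmul a 0)); rewrite -rmulDr !addr0. Qed.
Lemma mul0 a : rmul 0 a = 0.
Proof. by apply: (addrI (rmul 0 a)); rewrite -rmulDl !addr0. Qed.
Lemma rmul_bigl (T : Type) (s : seq T) (F : T -> R) b :
  rmul (\sum_(i <- s) F i) b = \sum_(i <- s) rmul (F i) b.
Proof.
by elim: s => [|i s ih]; rewrite ?big_nil ?mul0 // !big_cons rmulDl ih.
Qed.
Lemma rmul_bigr (T : Type) (s : seq T) (F : T -> R) b :
  rmul b (\sum_(i <- s) F i) = \sum_(i <- s) rmul b (F i).
Proof.
by elim: s => [|i s ih]; rewrite ?big_nil ?rmul0 // !big_cons rmulDr ih.
Qed.

End RingTheory.

(* [mact_full] says M R = M. *)
Record gradedModule (G : groupoid) (R : gradedRing G) := GradedModule {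
  gm_zmod :> gradedZmod G;
  mact : gm_zmod -> R -> gm_zmod;
  mactDl : forall m n a, mact (m + n) a = mact m a + mact n a;
  mactDr : forall m a b, mact m (a + b) = mact m a + mact m b;
  mactA : forall m a b, mact m (rmul a b) = mact (mact m a) b;
  homog_mact : forall g h m a,
    homog g m -> homog h a -> ohomog (gcomp g h) (mact m a);
  mact_full : forall m, exists s : seq (gm_zmod * R),
    m = \sum_(p <- s) mact p.1 p.2
}.

Section ModuleTheory.
Variables (G : groupoid) (R : gradedRing G).

Section Full.
(* Given the other axioms, M R = M amounts to m 1_{d(g)} = m on M_g. *)
Variables (M : gradedZmod G) (ac : M -> R -> M).
Hypothesis acDl : forall m n a, ac (m + n) a = ac m a + ac n a.
Hypothesis ac1 : forall g m, homog g m -> ac m (gone R (gdom g)) = m.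

Lemma full_of_unit m : exists s : seq (M * R), m = \sum_(p <- s) ac p.1 p.2.
Proof.
have [s _ e] := gproj_seq m.
exists [seq (gproj g m, gone R (gdom g)) | g <- s].
rewrite big_map {1}e; apply: eq_bigr => g _ /=.
by rewrite (ac1 (gproj_homog g m)).
Qed.
End Full.

Variable M : gradedModule R.
Implicit Types (m : M) (a b : R).

Lemma mact0 m : mact m 0 = 0.
Proof. by apply: (addrI (mact m 0)); rewrite -mactDr !addr0. Qed.
Lemma mact0l a : mact (0 : M) a = 0.
Proof. by apply: (addrI (mact 0 a)); rewrite -mactDl !addr0. Qed.
Lemma mact_bigl (T : Type) (s : seq T) (F : T -> M) b :
  mact (\sum_(i <- s) F i) b = \sum_(i <- s) mact (F i) b.
Proof.
by elim: s => [|i s ih]; rewrite ?big_nil ?mact0l // !big_cons mactDl ih.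
Qed.
Lemma mact_bigr (T : Type) (s : seq T) (F : T -> R) m :
  mact m (\sum_(i <- s) F i) = \sum_(i <- s) mact m (F i).
Proof.
by elim: s => [|i s ih]; rewrite ?big_nil ?mact0 // !big_cons mactDr ih.
Qed.

Lemma gone_gone e f : rmul (gone R e) (gone R f) = if e == f then gone R e else 0.
Proof.
case: eqVneq => [<-|nef].
  by have := gone_mul (gone_homog R e); rewrite grng_id.
have := homog_mul (gone_homog R e) (gone_homog R f).
case E : gcomp => [k|] //=.
by move/gcomp_dr: E; rewrite gdom_id grng_id => ef; rewrite ef eqxx in nef.
Qed.

Lemma mact_gone g m : homog g m -> mact m (gone R (gdom g)) = m.
Proof.
move=> hm; have off f : f != gdom g -> mact m (gone R f) = 0.
  move=> nf; have := homog_mact hm (gone_homog R f); case E : gcomp => [k|] //=.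
  by move/gcomp_dr: E nf; rewrite grng_id => ->; rewrite eqxx.
suff [s us es] : exists2 s : seq (gobj G), uniq s &
    m = \sum_(f <- s) mact m (gone R f).
  rewrite {2}es; case gs : (gdom g \in s).
    rewrite (bigD1_seq _ gs us) /= [X in _ + X]big1 ?addr0 // => f; exact: off.
  suff -> : mact m (gone R (gdom g)) = 0.
    rewrite big_seq big1 // => f fs; apply: off.
    by apply/eqP => ef; rewrite -ef fs in gs.
  rewrite {1}es mact_bigl big_seq big1 // => f fs.
  rewrite -mactA gone_gone; case: eqP => [ef|_]; last exact: mact0.
  by rewrite -ef fs in gs.
suff H : exists s : seq (gobj G), forall t, uniq t -> {subset s <= t} ->
    m = \sum_(f <- t) mact m (gone R f).
  have [s hs] := H; exists (undup s); first exact: undup_uniq.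
  by apply: hs; [exact: undup_uniq|move=> f; rewrite mem_undup].
have [s ->] := mact_full m; elim: s => [|[n a] s [t ih]].
  exists [::] => t _ _; rewrite big_nil big1 // => f _; exact: mact0l.
have [u [uu us] eu] := gproj_seq a.
exists ([seq gdom h | h <- u] ++ t) => w uw sw; rewrite !big_cons /=.
set S := \sum_(p <- s) _ in ih *.
under eq_bigr => f _ do rewrite mactDl.
rewrite big_split /= -ih //; last by move=> f ft; apply: sw; rewrite mem_cat ft orbT.
congr (_ + _); under eq_bigr => f _ do rewrite -mactA.
rewrite -mact_bigr -rmul_bigr; congr mact.
rewrite [LHS]eu [in RHS]eu rmul_bigl big_seq [RHS]big_seq; apply: eq_bigr => h hu.
have hw : gdom h \in w.
  by apply: sw; rewrite mem_cat map_f.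
rewrite rmul_bigr (bigD1_seq _ hw uw) /= (mul_gone (gproj_homog h a)).
rewrite big1 ?addr0 // => f nf.
have := homog_mul (gproj_homog h a) (gone_homog R f); case E : gcomp => [k|] //=.
by move/gcomp_dr: E nf; rewrite grng_id => ->; rewrite eqxx.
Qed.

Lemma gproj_act_neq0 k m a : gproj k (mact m a) != 0 ->
  exists g h, [/\ gcomp g h = Some k, gproj g m != 0 & gproj h a != 0].
Proof.
have [s _ es] := gproj_seq m; have [t _ et] := gproj_seq a.
move=> n; apply: contrapT => H; case/eqP: n.
rewrite {1}es {1}et mact_bigl gproj_big big1 // => g _.
rewrite mact_bigr gproj_big big1 // => h _.
have := homog_mact (gproj_homog g m) (gproj_homog h a).
case E : (gcomp g h) => [l|] /=; last by move=> ->; rewrite gproj0.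
move=> hl; rewrite (gproj_id _ hl); case: eqP => // kl.
case: (eqVneq (gproj g m) 0) => [->|ng]; first by rewrite mact0l.
case: (eqVneq (gproj h a) 0) => [->|nh]; first by rewrite mact0.
by case: H; exists g, h; rewrite kl.
Qed.

End ModuleTheory.

Section RegularModule.
Variables (G : groupoid) (R : gradedRing G).

Definition regular_module : gradedModule R :=
  GradedModule (@rmulDl _ R) (@rmulDr _ R)
    (@rmulA _ R) (@homog_mul _ R)
    (full_of_unit (ac := @rmul _ R) (@mul_gone _ R)).
End RegularModule.

(* M(s): its component of degree g is M_{sg}, and its underlying group is the
   sum of these, i.e. the sum of the M_h with r(h) = r(s). *)
Section Shift.
Variables (G : groupoid) (R : gradedRing G) (M : gradedModule R) (s : G).

Definition gshift_set : set M :=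
  [set x | forall h, gproj h x != 0 -> grng h = grng s].

Lemma gshift_set0 : gshift_set 0.
Proof. by move=> h; rewrite gproj0 eqxx. Qed.

Lemma gshift_setB x y : gshift_set x -> gshift_set y -> gshift_set (x - y).
Proof.
move=> hx hy h; rewrite gproj_B.
case: (eqVneq (gproj h x) 0) => [->|/hx //].
by case: (eqVneq (gproj h y) 0) => [->|/hy //]; rewrite subrr eqxx.
Qed.

Definition gshift_subgroup := Subgroup gshift_set0 gshift_setB.

Let phi (i : unit) (x : subgrp gshift_subgroup) : M := subgrp_val x.
Let rho (i : unit) (g : G) := gcomp s g.

Let phiB i x y : phi i (x - y) = phi i x - phi i y.
Proof. by []. Qed.
Let phi_inj x y : (forall i, phi i x = phi i y) -> x = y.
Proof. by move=> /(_ tt) /subgrp_inj. Qed.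
Let rho_inj (i : unit) g g' h : rho i g = Some h -> rho i g' = Some h -> g = g'.
Proof. by move=> /gcompKl E /gcompKl; rewrite E => -[]. Qed.
Let rho_surj i x h : gproj h (phi i x) != 0 -> exists g, rho i g = Some h.
Proof.
move=> /(subgrpP x) rh; have [g E] := @gcompP _ (ginv s) h ltac:(by rewrite gdom_inv).
by exists g; exact: gcompKVl.
Qed.
Let pr_ex g x : exists y, forall i, phi i y = oproj (rho i g) (phi i x).
Proof.
suff H : gshift_set (oproj (gcomp s g) (subgrp_val x)) by exists (mk_subgrp (S := gshift_subgroup) H).
move=> h; case E : gcomp => [k|] /=; last by rewrite gproj0 eqxx.
rewrite (gproj_id _ (gproj_homog k _)); case: (eqVneq h k) => [->|]; last by rewrite eqxx.
by rewrite (grng_comp E).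
Qed.
Let pr_fin x : finite_set [set g | exists i, oproj (rho i g) (phi i x) != 0].
Proof.
apply: (@sub_finite_set _ _
  ((fun k => odflt k (gcomp (ginv s) k)) @` [set h | gproj h (subgrp_val x) != 0])).
  move=> g [i]; rewrite /rho /phi; case E : gcomp => [k|] /=; last by rewrite eqxx.
  by move=> n; exists k => //; rewrite (gcompKl E).
by apply: finite_image; exact: gproj_finite.
Qed.

Definition gshift_gz : gradedZmod G :=
  build_gz phiB phi_inj rho_inj rho_surj pr_ex pr_fin.

Lemma gshift_act_closed (x : gshift_gz) (a : R) :
  sg_set gshift_subgroup (mact (subgrp_val x) a).
Proof.
move=> k /gproj_act_neq0 [g [h [E ng _]]].
by rewrite (grng_comp E); exact: (subgrpP x).
Qed.

Definition gshift_act (x : gshift_gz) (a : R) : gshift_gz :=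
  mk_subgrp (@gshift_act_closed x a).

Lemma gshift_actDl x y a : gshift_act (x + y) a = gshift_act x a + gshift_act y a.
Proof. by apply: subgrp_inj; rewrite /= mactDl. Qed.
Lemma gshift_actDr x a b : gshift_act x (a + b) = gshift_act x a + gshift_act x b.
Proof. by apply: subgrp_inj; rewrite /= mactDr. Qed.
Lemma gshift_actA x a b : gshift_act x (rmul a b) = gshift_act (gshift_act x a) b.
Proof. by apply: subgrp_inj; rewrite /= mactA. Qed.
Lemma gshift_homog_mact g h (x : gshift_gz) a :
  homog g x -> homog h a -> ohomog (gcomp g h) (gshift_act x a).
Proof.
move=> /(_ tt) hx ha; rewrite /phi /rho in hx.
suff H : ohomog (obind (gcomp s) (gcomp g h)) (mact (subgrp_val x) a).
  case E : (gcomp g h) H => [k|] /= H; first by move=> i.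
  by apply: subgrp_inj.
rewrite gcompA; case E : (gcomp s g) hx => [l|] /= hx; first exact: homog_mact.
by rewrite hx mact0l.
Qed.
Lemma gshift_act_unit g (x : gshift_gz) :
  homog g x -> gshift_act x (gone R (gdom g)) = x.
Proof.
move=> /(_ tt); rewrite /phi /rho; case E : (gcomp s g) => [l|] /= hx.
  by apply: subgrp_inj => /=; rewrite -(gdom_comp E) mact_gone.
by apply: subgrp_inj => /=; rewrite hx mact0l.
Qed.

Definition gshift : gradedModule R :=
  GradedModule gshift_actDl gshift_actDr gshift_actA gshift_homog_mact
    (full_of_unit gshift_act_unit).
End Shift.

(* M(e), and R(e) = 1_e R as a right R-module. *)
Definition at_obj (G : groupoid) (R : gradedRing G) (M : gradedModule R)
    (e : gobj G) : gradedModule R := gshift M (gid e).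

Definition ring_at (G : groupoid) (R : gradedRing G) (e : gobj G) :
  gradedModule R := at_obj (regular_module R) e.

Section DirectSum.
Variables (G : groupoid) (R : gradedRing G) (I : Type).
Variable M : I -> gradedModule R.

Definition dsum_set : set (dprod M) := [set x | finite_set [set i | x i != 0]].

Lemma dsum_set0 : dsum_set 0.
Proof.
apply: (@sub_finite_set _ _ set0); last exact: finite_set0.
by move=> i /=; rewrite eqxx.
Qed.

Lemma dsum_setB x y : dsum_set x -> dsum_set y -> dsum_set (x - y).
Proof.
move=> fx fy; apply: (@sub_finite_set _ _ ([set i | x i != 0] `|` [set i | y i != 0])).
  move=> i /=; rewrite -[(x - y) i]/(x i - y i).
  case: (eqVneq (x i) 0) => [->|]; last by left.
  by case: (eqVneq (y i) 0) => [->|]; [rewrite subrr eqxx|right].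
by rewrite finite_setU.
Qed.

Definition dsum_subgroup := Subgroup dsum_set0 dsum_setB.

Let phi (i : I) (x : subgrp dsum_subgroup) : M i := subgrp_val x i.
Let rho (i : I) (g : G) := Some g.
Let phiB i x y : phi i (x - y) = phi i x - phi i y.
Proof. by []. Qed.
Let phi_inj x y : (forall i, phi i x = phi i y) -> x = y.
Proof. by move=> H; apply: subgrp_inj; apply: functional_extensionality_dep. Qed.
Let rho_inj (i : I) g g' h : rho i g = Some h -> rho i g' = Some h -> g = g'.
Proof. by move=> [->] [->]. Qed.
Let rho_surj i x h : gproj h (phi i x) != 0 -> exists g, rho i g = Some h.
Proof. by exists h. Qed.
Let pr_ex g x : exists y, forall i, phi i y = oproj (rho i g) (phi i x).
Proof.
suff H : sg_set dsum_subgroup (fun i => gproj g (subgrp_val x i)) by exists (mk_subgrp H).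
apply: (sub_finite_set _ (subgrpP x)) => i /=; apply: contraNneq => ->.
by rewrite gproj0.
Qed.
Let pr_fin x : finite_set [set g | exists i, oproj (rho i g) (phi i x) != 0].
Proof.
apply: (@sub_finite_set _ _ (\bigcup_(i in [set i | subgrp_val x i != 0])
   [set g | gproj g (subgrp_val x i) != 0])).
  move=> g [i] /= n; exists i => //=; apply: contraNneq n => e.
  by rewrite /phi e gproj0.
by apply: bigcup_finite; [exact: (subgrpP x)|move=> i _; exact: gproj_finite].
Qed.

Definition dsum_gz : gradedZmod G :=
  build_gz phiB phi_inj rho_inj rho_surj pr_ex pr_fin.

Lemma dsum_act_closed (x : dsum_gz) (a : R) :
  sg_set dsum_subgroup (fun i => mact (subgrp_val x i) a).
Proof.
apply: (sub_finite_set _ (subgrpP x)) => i /=; apply: contraNneq => ->.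
by rewrite mact0l.
Qed.

Definition dsum_act (x : dsum_gz) (a : R) : dsum_gz :=
  mk_subgrp (dsum_act_closed x a).

Lemma dsum_actDl x y a : dsum_act (x + y) a = dsum_act x a + dsum_act y a.
Proof. by apply: phi_inj => i; exact: mactDl. Qed.
Lemma dsum_actDr x a b : dsum_act x (a + b) = dsum_act x a + dsum_act x b.
Proof. by apply: phi_inj => i; exact: mactDr. Qed.
Lemma dsum_actA x a b : dsum_act x (rmul a b) = dsum_act (dsum_act x a) b.
Proof. by apply: phi_inj => i; exact: mactA. Qed.
Lemma dsum_homog_mact g h (x : dsum_gz) a :
  homog g x -> homog h a -> ohomog (gcomp g h) (dsum_act x a).
Proof.
move=> hx ha; have H i := homog_mact (hx i) ha.
by case: gcomp H => [k|] /= H; [move=> i; exact: H|apply: phi_inj => i; exact: H].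
Qed.
Lemma dsum_act_unit g (x : dsum_gz) :
  homog g x -> dsum_act x (gone R (gdom g)) = x.
Proof. by move=> hx; apply: phi_inj => i; exact: mact_gone (hx i). Qed.

Definition dsum : gradedModule R :=
  GradedModule dsum_actDl dsum_actDr dsum_actA dsum_homog_mact
    (full_of_unit dsum_act_unit).
End DirectSum.

Definition ring_at_set (G : groupoid) (R : gradedRing G)
    (Delta : set (gobj G)) : gradedModule R :=
  dsum (fun e : Delta => ring_at R (val e)).

(* The sum of the groups prod_j (R_j)_g inside the full product: the families
   whose members have their homogeneous components in a common finite set of
   degrees. *)
Section GradedProduct.
Variables (G : groupoid) (J : Type) (R : J -> gradedRing G).

Definition gprod_set : set (dprod R) :=
  [set x | finite_set [set g | exists j, gproj g (x j) != 0]].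

Lemma gprod_set0 : gprod_set 0.
Proof.
apply: (@sub_finite_set _ _ set0); last exact: finite_set0.
by move=> g [j]; rewrite -[(0 : dprod R) j]/(0 : R j) gproj0 eqxx.
Qed.

Lemma gprod_setB x y : gprod_set x -> gprod_set y -> gprod_set (x - y).
Proof.
move=> fx fy; apply: (sub_finite_set (B := [set g | exists j, gproj g (x j) != 0]
   `|` [set g | exists j, gproj g (y j) != 0])).
  move=> g [j]; rewrite -[(x - y) j]/(x j - y j) gproj_B.
  case: (eqVneq (gproj g (x j)) 0) => [->|n _]; last by left; exists j.
  case: (eqVneq (gproj g (y j)) 0) => [->|n _]; last by right; exists j.
  by rewrite subrr eqxx.
by rewrite finite_setU.
Qed.

Definition gprod_subgroup := Subgroup gprod_set0 gprod_setB.

Let phi (j : J) (x : subgrp gprod_subgroup) : R j := subgrp_val x j.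
Let rho (j : J) (g : G) := Some g.
Let phiB j x y : phi j (x - y) = phi j x - phi j y.
Proof. by []. Qed.
Let phi_inj x y : (forall j, phi j x = phi j y) -> x = y.
Proof. by move=> H; apply: subgrp_inj; apply: functional_extensionality_dep. Qed.
Let rho_inj (j : J) g g' h : rho j g = Some h -> rho j g' = Some h -> g = g'.
Proof. by move=> [->] [->]. Qed.
Let rho_surj j x h : gproj h (phi j x) != 0 -> exists g, rho j g = Some h.
Proof. by exists h. Qed.

Lemma gprod_homog_closed g (x : dprod R) :
  (forall j, homog g (x j)) -> sg_set gprod_subgroup x.
Proof.
move=> hx; apply: (sub_finite_set (B := [set g])); last exact: finite_set1.
by move=> h [j]; rewrite (gproj_id _ (hx j)); case: (eqVneq h g) => // _; rewrite eqxx.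
Qed.

Let pr_ex g x : exists y, forall j, phi j y = oproj (rho j g) (phi j x).
Proof.
have H : sg_set gprod_subgroup (fun j => gproj g (subgrp_val x j)).
  by apply: (@gprod_homog_closed g) => j; exact: gproj_homog.
by exists (mk_subgrp H).
Qed.
Let pr_fin x : finite_set [set g | exists j, oproj (rho j g) (phi j x) != 0].
Proof. exact: (subgrpP x). Qed.

Definition gprod_gz : gradedZmod G :=
  build_gz phiB phi_inj rho_inj rho_surj pr_ex pr_fin.

Lemma gprod_mul_closed (x y : gprod_gz) :
  sg_set gprod_subgroup (fun j => rmul (subgrp_val x j) (subgrp_val y j)).
Proof.
apply: (sub_finite_set (B := (fun p => odflt p.1 (gcomp p.1 p.2)) @`
  ([set g | exists j, gproj g (subgrp_val x j) != 0] `*`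
   [set g | exists j, gproj g (subgrp_val y j) != 0]))).
  move=> k [j] n.
  have [g [h [E ng nh]]] := @gproj_act_neq0 _ _ (regular_module (R j)) _ _ _ n.
  by exists (g, h); [split; exists j|rewrite /= E].
by apply: finite_image; apply: finite_setX; [exact: (subgrpP x)|exact: (subgrpP y)].
Qed.

Definition gprod_mul (x y : gprod_gz) : gprod_gz :=
  mk_subgrp (gprod_mul_closed x y).

Definition gprod_one (e : gobj G) : gprod_gz :=
  mk_subgrp (gprod_homog_closed (fun j => gone_homog (R j) e)).

Lemma gprod_mulA : associative gprod_mul.
Proof. by move=> x y z; apply: phi_inj => j; exact: rmulA. Qed.
Lemma gprod_mulDl : left_distributive gprod_mul +%R.
Proof. by move=> x y z; apply: phi_inj => j; exact: rmulDl. Qed.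
Lemma gprod_mulDr : right_distributive gprod_mul +%R.
Proof. by move=> x y z; apply: phi_inj => j; exact: rmulDr. Qed.
Lemma gprod_homog_mul g h (x y : gprod_gz) :
  homog g x -> homog h y -> ohomog (gcomp g h) (gprod_mul x y).
Proof.
move=> hx hy; have H j := homog_mul (hx j) (hy j).
by case: gcomp H => [k|] /= H; [move=> j; exact: H|apply: phi_inj => j; exact: H].
Qed.
Lemma gprod_one_homog e : homog (gid e) (gprod_one e).
Proof. by move=> j; exact: gone_homog. Qed.
Lemma gprod_one_mul g (x : gprod_gz) :
  homog g x -> gprod_mul (gprod_one (grng g)) x = x.
Proof. by move=> hx; apply: phi_inj => j; exact: gone_mul (hx j). Qed.
Lemma gprod_mul_one g (x : gprod_gz) :
  homog g x -> gprod_mul x (gprod_one (gdom g)) = x.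
Proof. by move=> hx; apply: phi_inj => j; exact: mul_gone (hx j). Qed.

Definition gprod : gradedRing G :=
  GradedRing gprod_mulA gprod_mulDl gprod_mulDr gprod_homog_mul
    gprod_one_homog gprod_one_mul gprod_mul_one.

(* prod^gr_j R_j = (+)_j R_j; the direct sum is the set of families with
   finitely many nonzero members. *)
Definition gr_summable :=
  forall x : gprod, finite_set [set j | subgrp_val x j != 0].
End GradedProduct.

Definition gsupp (G : groupoid) (R : gradedRing G) : set G :=
  [set g | homog g <> [set (0 : R)]].

Lemma gproj_gsupp (G : groupoid) (R : gradedRing G) g (x : R) :
  gproj g x != 0 -> gsupp R g.
Proof.
move=> n E; have := gproj_homog g x.
by rewrite E /= => e; rewrite e eqxx in n.
Qed.

Definition d_finite (G : groupoid) (K : Type) (s : K -> G) :=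
  forall f, finite_set [set k | gdom (s k) = f].

(* Finitely supported K x K matrices over D; the (k, l) entry of a matrix of
   degree g has degree s_k g s_l^-1. *)
Section MatrixRing.
Variables (G : groupoid) (D : gradedRing G) (e : gobj G).
Hypothesis De : gsupp D `<=` corner e.
Variables (K : choiceType) (s : K -> G).
Hypothesis se : forall k, grng (s k) = e.
Hypothesis sfin : d_finite s.

Definition conj_deg (k l : K) (g : G) : option G :=
  obind (gcomp (s k)) (gcomp g (ginv (s l))).

Lemma conj_degP k l g h : conj_deg k l g = Some h ->
  exists2 m, gcomp g (ginv (s l)) = Some m & gcomp (s k) m = Some h.
Proof.
rewrite /conj_deg; case: (gcomp g _) => [m|] //= E; first by exists m.
Qed.

Lemma conj_deg_rng k l g h : conj_deg k l g = Some h -> gdom (s k) = grng g.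
Proof.
by case/conj_degP => m E1 E2; rewrite -(grng_comp E1); exact: (gcomp_dr E2).
Qed.

Lemma conj_deg_dom k l g h : conj_deg k l g = Some h -> gdom (s l) = gdom g.
Proof.
by case/conj_degP => m /gcomp_dr E1 _; rewrite E1 grng_inv.
Qed.

Lemma conj_deg_inv k l g h : conj_deg k l g = Some h ->
  obind (fun m => gcomp m (s l)) (gcomp (ginv (s k)) h) = Some g.
Proof.
by case/conj_degP => m E1 E2; rewrite (gcompKl E2) /= (gcompKVr E1).
Qed.

Lemma conj_deg_surj k l h : corner e h -> exists g, conj_deg k l g = Some h.
Proof.
move=> [rh dh].
have [m Em] := @gcompP _ (ginv (s k)) h ltac:(by rewrite gdom_inv se).
have [g Eg] := @gcompP _ m (s l) ltac:(by rewrite (gdom_comp Em) se).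
by exists g; rewrite /conj_deg (gcompKr Eg) /= (gcompKVl Em).
Qed.

Lemma conj_deg_comp k m l g h a b :
  conj_deg k m g = Some a -> conj_deg m l h = Some b ->
  exists2 gh, gcomp g h = Some gh & conj_deg k l gh = gcomp a b.
Proof.
move=> Ea Eb.
have [gh Egh] := @gcompP _ g h
  ltac:(by rewrite -(conj_deg_dom Ea) (conj_deg_rng Eb)).
exists gh => //; rewrite /conj_deg.
case/conj_degP: Ea => a' E1 E2; case/conj_degP: Eb => b' E3 E4.
have H1 := gcompA g h (ginv (s l)); rewrite Egh E3 /= in H1.
have H2 := gcompA g (ginv (s m)) b; rewrite E1 (gcompKl E4) /= in H2.
have H3 := gcompA (s k) a' b; rewrite E2 /= in H3.
by rewrite -H1 H2.
Qed.

Definition gmx_set : set (K -> K -> D) :=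
  [set A | finite_set [set p : K * K | A p.1 p.2 != 0]].

Lemma gmx_set0 : gmx_set 0.
Proof.
apply: (@sub_finite_set _ _ set0); last exact: finite_set0.
by move=> p /=; rewrite eqxx.
Qed.

Lemma gmx_setB A B : gmx_set A -> gmx_set B -> gmx_set (A - B).
Proof.
move=> fA fB; apply: (sub_finite_set (B := [set p | A p.1 p.2 != 0] `|`
    [set p | B p.1 p.2 != 0])).
  move=> [k l] /=; rewrite -[(A - B) k l]/(A k l - B k l).
  case: (eqVneq (A k l) 0) => [->|]; last by left.
  by case: (eqVneq (B k l) 0) => [->|]; [rewrite subrr eqxx|right].
by rewrite finite_setU.
Qed.

Definition gmx_subgroup := Subgroup gmx_set0 gmx_setB.

Let phi (p : K * K) (A : subgrp gmx_subgroup) : D := subgrp_val A p.1 p.2.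
Let rho (p : K * K) (g : G) := conj_deg p.1 p.2 g.
Let phiB p x y : phi p (x - y) = phi p x - phi p y.
Proof. by []. Qed.
Let phi_inj x y : (forall p, phi p x = phi p y) -> x = y.
Proof.
move=> H; apply: subgrp_inj; apply: funext => k; apply: funext => l.
exact: (H (k, l)).
Qed.
Let rho_inj p g g' h : rho p g = Some h -> rho p g' = Some h -> g = g'.
Proof. by move=> /conj_deg_inv + /conj_deg_inv; move=> -> []. Qed.
Let rho_surj p x h : gproj h (phi p x) != 0 -> exists g, rho p g = Some h.
Proof. by move=> /gproj_gsupp /De; exact: conj_deg_surj. Qed.
Let pr_ex g x : exists y, forall p, phi p y = oproj (rho p g) (phi p x).
Proof.
suff H : sg_set gmx_subgroup (fun k l => oproj (conj_deg k l g) (subgrp_val x k l)).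
  by exists (mk_subgrp H).
apply: (sub_finite_set _ (subgrpP x)) => -[k l] /=; apply: contraNneq => ->.
by case: conj_deg => //= h; rewrite gproj0.
Qed.
Let pr_fin x : finite_set [set g | exists p, oproj (rho p g) (phi p x) != 0].
Proof.
apply: (sub_finite_set (B := \bigcup_(p in [set p : K * K | subgrp_val x p.1 p.2 != 0])
   ((fun h => odflt h (obind (fun m => gcomp m (s p.2)) (gcomp (ginv (s p.1)) h)))
     @` [set h | gproj h (subgrp_val x p.1 p.2) != 0]))).
  move=> g [p] /oproj_neq0[h E n]; exists p => /=.
    by apply: contraNneq n => z; rewrite /phi z gproj0.
  by exists h => //; rewrite (conj_deg_inv E).
apply: bigcup_finite; first exact: (subgrpP x).
by move=> p _; apply: finite_image; exact: gproj_finite.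
Qed.

Definition gmx_gz : gradedZmod G :=
  build_gz phiB phi_inj rho_inj rho_surj pr_ex pr_fin.

Lemma gmx_seq (A : gmx_gz) : exists t : seq K, forall k l,
  subgrp_val A k l != 0 -> k \in t /\ l \in t.
Proof.
have [u _ hu] := finite_uniq (subgrpP A).
exists ([seq p.1 | p <- u] ++ [seq p.2 | p <- u]) => k l n.
have klu := hu (k, l) n; rewrite !mem_cat; split; apply/orP; [left|right].
  by apply/mapP; exists (k, l).
by apply/mapP; exists (k, l).
Qed.

Definition gmx_mul_fun (A B : K -> K -> D) (k l : K) : D :=
  \sum_(m \in [set: K]) rmul (A k m) (B m l).

Lemma gmx_mul_funE (A : gmx_gz) (B : K -> K -> D) (t : seq K) k l : uniq t ->
  (forall k m, subgrp_val A k m != 0 -> m \in t) ->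
  gmx_mul_fun (subgrp_val A) B k l = \sum_(m <- t) rmul (subgrp_val A k m) (B m l).
Proof.
move=> ut ht; apply: fsum_seq => // m n; apply: (ht k).
by apply: contraNneq n => ->; rewrite mul0.
Qed.

Lemma gmx_mul_closed (A B : gmx_gz) :
  sg_set gmx_subgroup (gmx_mul_fun (subgrp_val A) (subgrp_val B)).
Proof.
have [t ht] := gmx_seq A; have [u hu] := gmx_seq B.
apply: (sub_finite_set (B := [set` t] `*` [set` u])); last first.
  by apply: finite_setX; exact: finite_seq.
move=> [k l] /= n; rewrite /gmx_mul_fun in n; split => /=; apply: contraNT n => nin.
  apply/eqP/fsbig1 => m _.
  case: (eqVneq (subgrp_val A k m) 0) => [->|/ht[kt]]; first by rewrite mul0.
  by rewrite kt in nin.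
apply/eqP/fsbig1 => m _.
case: (eqVneq (subgrp_val B m l) 0) => [->|/hu[_ lt]]; first by rewrite rmul0.
by rewrite lt in nin.
Qed.

Definition gmx_mul (A B : gmx_gz) : gmx_gz := mk_subgrp (gmx_mul_closed A B).

Definition gmx_one_fun (f : gobj G) (k l : K) : D :=
  if (k == l) && (gdom (s k) == f) then gone D e else 0.

Lemma gmx_one_closed f : sg_set gmx_subgroup (gmx_one_fun f).
Proof.
apply: (sub_finite_set (B := (fun k => (k, k)) @` [set k | gdom (s k) = f])).
  move=> [k l] /=; rewrite /gmx_one_fun; case: (eqVneq k l) => [<-|] /=; last by rewrite eqxx.
  by case: (eqVneq (gdom (s k)) f) => [h _|]; [exists k|rewrite eqxx].
by apply: finite_image; exact: sfin.
Qed.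

Definition gmx_one f : gmx_gz := mk_subgrp (gmx_one_closed f).

Lemma gmx_seqs (A B C : gmx_gz) : exists2 t : seq K, uniq t &
  [/\ forall k l, subgrp_val A k l != 0 -> l \in t,
      forall k l, subgrp_val B k l != 0 -> l \in t &
      forall k l, subgrp_val C k l != 0 -> l \in t].
Proof.
have [t ht] := gmx_seq A; have [u hu] := gmx_seq B; have [v hv] := gmx_seq C.
exists (undup (t ++ u ++ v)); first exact: undup_uniq.
by split=> k l n; rewrite mem_undup !mem_cat;
  [rewrite (ht _ _ n).2|rewrite (hu _ _ n).2 orbT|rewrite (hv _ _ n).2 !orbT].
Qed.

Lemma gmx_mulA : associative gmx_mul.
Proof.
move=> A B C; apply: phi_inj => -[k l]; rewrite /phi /=.
have [t ut [hA hB hAB]] := gmx_seqs A B (gmx_mul A B).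
rewrite (gmx_mul_funE _ _ _ ut hA) (@gmx_mul_funE (gmx_mul A B) _ t) //=.
transitivity (\sum_(m <- t) \sum_(n <- t)
    rmul (subgrp_val A k m) (rmul (subgrp_val B m n) (subgrp_val C n l))).
  by apply: eq_bigr => m _; rewrite (gmx_mul_funE _ _ _ ut hB) rmul_bigr.
rewrite exchange_big /=; apply: eq_bigr => n _.
rewrite (gmx_mul_funE _ _ _ ut hA) rmul_bigl.
by apply: eq_bigr => m _; rewrite rmulA.
Qed.

Lemma gmx_mulDl : left_distributive gmx_mul +%R.
Proof.
move=> A B C; apply: phi_inj => -[k l]; rewrite /phi /=.
have [t ut [hA hB hAB]] := gmx_seqs A B (A + B).
rewrite (@gmx_mul_funE (A + B) _ t) // -[RHS]/(gmx_mul_fun (subgrp_val A) _ k l +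
  gmx_mul_fun (subgrp_val B) (subgrp_val C) k l).
rewrite !(@gmx_mul_funE _ _ t) // -big_split /=.
by apply: eq_bigr => m _; rewrite -rmulDl.
Qed.

Lemma gmx_mulDr : right_distributive gmx_mul +%R.
Proof.
move=> A B C; apply: phi_inj => -[k l]; rewrite /phi /=.
have [t ut [hA hB hAB]] := gmx_seqs A A A.
rewrite (@gmx_mul_funE A _ t) // -[RHS]/(gmx_mul_fun (subgrp_val A) (subgrp_val B) k l +
  gmx_mul_fun (subgrp_val A) (subgrp_val C) k l).
rewrite !(@gmx_mul_funE A _ t) // -big_split /=.
by apply: eq_bigr => m _; rewrite -rmulDr.
Qed.

Lemma gmx_homog_mul g h (A B : gmx_gz) :
  homog g A -> homog h B -> ohomog (gcomp g h) (gmx_mul A B).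
Proof.
move=> hA hB; have [t ut [tA _ _]] := gmx_seqs A A A.
have H k l m : ohomog (obind (conj_deg k l) (gcomp g h))
    (rmul (subgrp_val A k m) (subgrp_val B m l)).
  have := hA (k, m); have := hB (m, l); rewrite /phi /rho /=.
  case Eb : (conj_deg m l h) => [b|] /=; last first.
    by move=> -> _; rewrite rmul0; exact: ohomog0.
  case Ea : (conj_deg k m g) => [a|] /=; last first.
    by move=> _ ->; rewrite mul0; exact: ohomog0.
  have [gh -> /= ->] := conj_deg_comp Ea Eb.
  by move=> hb ha; exact: homog_mul.
have H' k l : ohomog (obind (conj_deg k l) (gcomp g h))
    (gmx_mul_fun (subgrp_val A) (subgrp_val B) k l).
  by rewrite (gmx_mul_funE _ _ _ ut tA); apply: ohomog_sum => m; exact: H.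
case: gcomp H' => [gh|] /= H'; first by move=> [k l]; exact: H'.
by apply: phi_inj => -[k l]; exact: H'.
Qed.

Lemma gmx_one_homog f : homog (gid f) (gmx_one f).
Proof.
move=> [k l]; rewrite /phi /rho /= /gmx_one_fun.
case: (eqVneq k l) => [<-|_] /=; last exact: ohomog0.
case: (eqVneq (gdom (s k)) f) => [<-|_]; last exact: ohomog0.
rewrite /conj_deg -[gdom _]grng_inv gcomp1g /= gcompgV /= se.
exact: gone_homog.
Qed.

Lemma gmx_one_mul g (A : gmx_gz) : homog g A -> gmx_mul (gmx_one (grng g)) A = A.
Proof.
move=> hA; apply: phi_inj => -[k l]; rewrite /phi /= /gmx_mul_fun.
rewrite (@fsum_seq _ _ _ [:: k]) //; last first.
  move=> m; rewrite /gmx_one_fun inE eq_sym; case: (eqVneq m k) => //= _.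
  by rewrite mul0 eqxx.
rewrite big_seq1 /gmx_one_fun eqxx /=; have := hA (k, l); rewrite /phi /rho /=.
case E : conj_deg => [h|] /=; last by move=> ->; case: ifP => _; rewrite rmul0.
rewrite (conj_deg_rng E) eqxx => ha.
by case/conj_degP: E => m _ /grng_comp Er; rewrite -(se k) -Er gone_mul.
Qed.

Lemma gmx_mul_one g (A : gmx_gz) : homog g A -> gmx_mul A (gmx_one (gdom g)) = A.
Proof.
move=> hA; apply: phi_inj => -[k l]; rewrite /phi /= /gmx_mul_fun.
rewrite (@fsum_seq _ _ _ [:: l]) //; last first.
  move=> m; rewrite /gmx_one_fun inE; case: (eqVneq m l) => //= _.
  by rewrite rmul0 eqxx.
rewrite big_seq1 /gmx_one_fun eqxx /=; have := hA (k, l); rewrite /phi /rho /=.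
case E : conj_deg => [h|] /=; last by move=> ->; case: ifP => _; rewrite mul0.
rewrite (conj_deg_dom E) eqxx => ha.
case/conj_degP: E => m /gdom_comp; rewrite gdom_inv => Em /gdom_comp Ed.
by rewrite -(se l) -Em -Ed mul_gone.
Qed.

Definition gmatrix : gradedRing G :=
  GradedRing gmx_mulA gmx_mulDl gmx_mulDr gmx_homog_mul
    gmx_one_homog gmx_one_mul gmx_mul_one.
End MatrixRing.

Section Properties.
Variable G : groupoid.

Definition nonzero_gz (M : gradedZmod G) := exists x : M, x != 0.

Definition gr_ring_iso (R S : gradedRing G) := exists f : R -> S,
  [/\ bijective f, {morph f : x y / x + y},
      {morph f : x y / rmul x y}
    & forall g x, homog g x -> homog g (f x)].

Definition gr_mod_iso (R : gradedRing G) (M N : gradedModule R) :=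
  exists f : M -> N,
  [/\ bijective f, {morph f : x y / x + y},
      forall x a, f (mact x a) = mact (f x) a
    & forall g x, homog g x -> homog g (f x)].

Definition submodule (R : gradedRing G) (M : gradedModule R) (N : set M) :=
  [/\ N 0, forall x y, N x -> N y -> N (x - y)
    & forall x a, N x -> N (mact x a)].

Definition gr_submodule (R : gradedRing G) (M : gradedModule R) (N : set M) :=
  submodule N /\ forall g x, N x -> N (gproj g x).

Definition gr_simple_mod (R : gradedRing G) (M : gradedModule R) :=
  nonzero_gz M /\
  forall N : set M, gr_submodule N -> N = [set 0] \/ N = setT.

Definition obj_simple (R : gradedRing G) (S : gradedModule R) :=
  forall e : gobj G, nonzero_gz (at_obj S e) -> gr_simple_mod (at_obj S e).

Definition gr_ideal (R : gradedRing G) (I : set R) :=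
  [/\ I 0, forall x y, I x -> I y -> I (x - y),
      forall x a, I x -> I (rmul x a) /\ I (rmul a x)
    & forall g x, I x -> I (gproj g x)].

Definition gr_simple_ring (R : gradedRing G) :=
  nonzero_gz R /\ forall I : set R, gr_ideal I -> I = [set 0] \/ I = setT.

Definition ideal_mul (R : gradedRing G) (I J : set R) : set R :=
  [set x | exists2 s : seq (R * R), (forall p, p \in s -> I p.1 /\ J p.2)
     & x = \sum_(p <- s) rmul p.1 p.2].

Definition gr_prime (R : gradedRing G) :=
  forall I J : set R, gr_ideal I -> gr_ideal J ->
    I <> [set 0] -> J <> [set 0] -> ideal_mul I J <> [set 0].

Definition obj_artinian (R : gradedRing G) :=
  forall (e : gobj G) (N : nat -> set (ring_at R e)),
    (forall n, gr_submodule (N n)) -> (forall n, N n.+1 `<=` N n) ->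
    exists n0, forall n, (n0 <= n)%N -> N n = N n0.

Definition pseudo_basis (R : gradedRing G) (M : gradedModule R)
    (I : choiceType) (c : I -> G) (x : I -> M) :=
  [/\ forall i, homog (c i) (x i) /\ x i <> 0,
      forall N : set M, submodule N -> (forall i, N (x i)) -> N = setT
    & forall a : I -> R,
        (forall i, exists b, a i = rmul (gone R (gdom (c i))) b) ->
        finite_set [set i | a i != 0] ->
        \sum_(i \in [set: I]) mact (x i) (a i) = 0 -> forall i, a i = 0].

Definition pseudo_free (R : gradedRing G) (M : gradedModule R) :=
  exists (I : choiceType) (c : I -> G) (x : I -> M), pseudo_basis c x.

Definition pfm_ring (R : gradedRing G) :=
  forall M : gradedModule R, pseudo_free M.

Definition gr_division (D : gradedRing G) :=
  nonzero_gz D /\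
  forall g (a : D), homog g a -> a <> 0 ->
    exists b : D, [/\ homog (ginv g) b, rmul a b = gone D (grng g)
                    & rmul b a = gone D (gdom g)].

Definition division_at (R : gradedRing G) (e : gobj G) :=
  gone R e <> 0 /\
  forall a : R, homog (gid e) a -> a <> 0 ->
    exists b : R, [/\ homog (gid e) b, rmul a b = gone R e
                    & rmul b a = gone R e].

Definition nonzero_objects (R : gradedRing G) : set (gobj G) :=
  [set e | gone R e != 0].

End Properties.

(* Main.v *)
Require Import Defs.
From mathcomp Require Import all_boot all_order all_algebra.
From mathcomp Require Import all_classical.
From mathcomp Require Import generic_quotient ring_quotient.

Set Implicit Arguments.
Unset Strict Implicit.
Unset Printing Implicit Defensive.

Import GRing.Theory.

Local Open Scope classical_set_scope.
Local Open Scope ring_scope.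

(** Call an object [f] a pivot if [1_f <> 0] and every nonzero homogeneous element
    of [1_f R] has a right inverse; this says that [R(f)] is gr-simple
    ([pivotP]). Call a set of objects pivotal if its members are pivots and their
    local units generate [R] as an ideal. Each of the six statements is
    equivalent to the existence of a pivotal set.

    Pivots make graded modules behave like vector spaces. A nonzero homogeneous
    [x] in a module with [d(x) = f] a pivot has zero annihilator in [1_f R] and
    lies in [x a R] for each homogeneous [a] with [x a <> 0]. If the set of pivots
    is pivotal, such elements generate every module, so the usual exchange
    argument turns a maximal independent family of them into a pseudo-basis
    ([pivotal_basis]). Thus [R] is a pfm ring, and a pseudo-basis of [R] itself is
    a decomposition into shifts of the [R(e)], [e] a pivot ([basis_iso]). Such a
    decomposition in turn puts all local units into the ideal generated by the
    units of the [e] ([shift_sum_generates]). Conversely let [R] be a pfm ring. A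
    proper ideal containing the units of all pivots would be contained in a
    maximal right ideal [N]. A basis element of [R / N] starts at some object [f]
    and gives an isomorphism, up to a shift, of [R(f)] with the gr-simple module
    [R / N]; so [f] is a pivot, its unit kills [R / N] and in particular that
    basis element, which is absurd ([pfm_pivotal]).

    For the structure theorem, nonzero homogeneous elements starting at a pivot
    of a pivotal set have left inverses ([pivotal_left_inverse]). A Gram-Schmidt
    process then writes each local unit as a finite sum [1_e = sum x_k y_k] with
    [y_k x_l] equal to a local unit or to zero according as [k = l] or not
    ([frame_exists]). Discard pivots until no two of them are linked by a nonzero
    homogeneous element. The map from [r] to the matrices [y_k r x_l] is then an
    isomorphism of [R] with a product of matrix rings over the graded division
    rings [1_f R 1_f] ([wedderburn]), and the frame of a pivot in the remaining
    set has a single member.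

    Each matrix ring so obtained is generated by the unit of one pivot
    ([gmatrix_pivotal]). A ring generated by the unit of one pivot is gr-simple,
    gr-prime, pfm and artinian at every object, which gives all the product
    decompositions. In the other direction, a nonzero gr-prime ring with a
    pivotal set is gr-simple ([pivotal_prime_simple]). In a gr-simple artinian
    ring an object whose component is a division ring is a pivot, because a
    minimal right ideal maps onto its right ideal ([artinian_pivot]). Finally, a
    summable product of gr-simple rings is generated by units that are nonzero in
    each factor ([product_generates]). *)

(** * Groupoid and grading calculus *)

Section Groupoid.
Variable G : groupoid.
Implicit Types g h k : G.

Lemma ginvK g : ginv (ginv g) = g.
Proof.
have := gcompgV (ginv g); rewrite grng_inv => /gcompKVl.
by rewrite gcompg1 => -[].
Qed.

Lemma ginv_id (e : gobj G) : ginv (gid e) = gid e.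
Proof.
by have := gcomp1g (ginv (gid e)); rewrite grng_inv gdom_id gcompgV grng_id => -[].
Qed.

Lemma gcomp_inj g h h' k : gcomp g h = Some k -> gcomp g h' = Some k -> h = h'.
Proof. by move=> /gcompKl E /gcompKl; rewrite E => -[]. Qed.

Lemma gcomp_injr g g' h k : gcomp g h = Some k -> gcomp g' h = Some k -> g = g'.
Proof. by move=> /gcompKr E /gcompKr; rewrite E => -[]. Qed.

Lemma gcomp_None g h : gdom g <> grng h -> gcomp g h = None.
Proof. by case E: gcomp => [k|] // /(_ (gcomp_dr E)). Qed.

End Groupoid.

Section Additive.
Variables (X Y : zmodType) (f : X -> Y).
Hypothesis fD : {morph f : x y / x + y}.

Lemma morph0 : f 0 = 0.
Proof. by apply: (addrI (f 0)); rewrite -fD !addr0. Qed.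

Lemma morphN x : f (- x) = - f x.
Proof. by apply: (addrI (f x)); rewrite -fD !subrr morph0. Qed.

Lemma morphB x y : f (x - y) = f x - f y.
Proof. by rewrite fD morphN. Qed.

Lemma morph_sum (T : Type) (s : seq T) (F : T -> X) :
  f (\sum_(i <- s) F i) = \sum_(i <- s) f (F i).
Proof. by elim: s => [|i s ih]; rewrite ?big_nil ?morph0 // !big_cons fD ih. Qed.

End Additive.

Section Morph.
Variables (G : groupoid) (M N : gradedZmod G) (f : M -> N) (rho : G -> option G).
Hypothesis fD : {morph f : x y / x + y}.
Hypothesis fH : forall g x, homog g x -> ohomog (rho g) (f x).
Hypothesis rho_inj : forall g g' h,
  rho g = Some h -> rho g' = Some h -> g = g'.

(** Components are unique, so an additive map that relabels degrees
    injectively carries one decomposition to the other. Multiplications by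
    homogeneous elements, coordinates and shifts are instances; the relabelling
    is partial because products of degrees are. *)
Lemma gproj_morph g h x : rho g = Some h -> gproj h (f x) = f (gproj g x).
Proof.
move=> E; have [s [us ss] ex] := gproj_seq x.
have H k : gproj h (f (gproj k x)) = if k == g then f (gproj g x) else 0.
  have := fH (gproj_homog k x); case: eqP => [->|nk].
    by rewrite E => /= /gproj_id ->; rewrite eqxx.
  case Ek: (rho k) => [l|] /=; last by move=> ->; rewrite gproj0.
  by move/gproj_id->; case: eqP => // hl; case: nk; apply: rho_inj E; rewrite hl.
rewrite {1}ex (morph_sum fD) gproj_big (eq_bigr _ (fun k _ => H k)).
case gs: (g \in s).
  by rewrite (bigD1_seq g) //= eqxx big1 ?addr0 // => k /negPf ->.
have -> : gproj g x = 0 by apply/eqP/negPn/negP => /ss; rewrite gs.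
by rewrite (morph0 fD) big1 // => k _; case: ifP.
Qed.

End Morph.

Lemma homog_gproj (G : groupoid) (M : gradedZmod G) g (x : M) :
  homog g x -> gproj g x = x.
Proof. by move/gproj_id->; rewrite eqxx. Qed.

Lemma gproj_neq0 (G : groupoid) (M : gradedZmod G) (x : M) :
  x <> 0 -> exists g, gproj g x != 0.
Proof.
move=> nx; apply: contrapT => H; apply: nx; apply: gproj_ext => g.
by rewrite gproj0; apply/eqP/negPn/negP => n; apply: H; exists g.
Qed.

(** * Homogeneous elements acting on graded modules *)

Section Act.
Variables (G : groupoid) (R : gradedRing G) (M : gradedModule R).
Implicit Types (m : M) (a : R).

Lemma homog_act g h k m a :
  homog g m -> homog h a -> gcomp g h = Some k -> homog k (mact m a).
Proof. by move=> hm ha E; have := homog_mact hm ha; rewrite E. Qed.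

Lemma act_undef g h m a :
  homog g m -> homog h a -> gdom g <> grng h -> mact m a = 0.
Proof. by move=> hm ha /gcomp_None E; have := homog_mact hm ha; rewrite E. Qed.

Lemma gproj_actl g h k m a : homog g m -> gcomp g h = Some k ->
  gproj k (mact m a) = mact m (gproj h a).
Proof.
move=> hm E; apply: (gproj_morph (f := mact m) (rho := gcomp g)) E.
- exact: mactDr.
- by move=> h' x; exact: homog_mact.
- exact: gcomp_inj.
Qed.

Lemma gproj_actr g h k m a : homog h a -> gcomp g h = Some k ->
  gproj k (mact m a) = mact (gproj g m) a.
Proof.
move=> ha E.
apply: (gproj_morph (f := fun x => mact x a) (rho := fun g => gcomp g h)) E.
- by move=> x y; exact: mactDl.
- by move=> h' x hx; exact: homog_mact.
- by move=> g1 g2 l /gcomp_injr; apply.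
Qed.

Lemma gproj_act_rng g k m a : homog g m -> grng k <> grng g ->
  gproj k (mact m a) = 0.
Proof.
move=> hm n; apply/eqP/negPn/negP => /gproj_act_neq0[g' [h [E + _]]].
rewrite (gproj_id _ hm); case: (eqVneq g' g) => [gg _|_]; last by rewrite eqxx.
by apply: n; rewrite (grng_comp E) gg.
Qed.

Lemma act_gone_dom g m f : homog g m ->
  mact m (gone R f) = if gdom g == f then m else 0.
Proof.
move=> hm; case: eqP => [<-|n]; first exact: mact_gone.
by apply: (act_undef hm (gone_homog R f)); rewrite grng_id.
Qed.

Lemma gproj_act_gone k m f :
  gproj k (mact m (gone R f)) = if gdom k == f then gproj k m else 0.
Proof.
case: eqP => [<-|n].
  rewrite (gproj_actr _ (gone_homog _ _) (gcompg1 k)).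
  exact: mact_gone (gproj_homog _ _).
apply/eqP/negPn/negP => /gproj_act_neq0[g' [h [E _]]].
rewrite (gproj_id _ (gone_homog _ _)); case: (eqVneq h (gid f)) => [hf _|_]; last by rewrite eqxx.
by apply: n; rewrite (gdom_comp E) hf gdom_id.
Qed.

Lemma submodule_N (N : set M) x : submodule N -> N x -> N (- x).
Proof. by case=> N0 NB _ Nx; rewrite -sub0r; exact: NB. Qed.

Lemma submodule_D (N : set M) x y : submodule N -> N x -> N y -> N (x + y).
Proof.
by move=> sN Nx Ny; rewrite -[y]opprK; case: (sN) => _ + _; apply => //;
  exact: submodule_N.
Qed.

Lemma submodule_sum (N : set M) (T : eqType) (s : seq T) (F : T -> M) :
  submodule N -> (forall i, i \in s -> N (F i)) -> N (\sum_(i <- s) F i).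
Proof.
move=> sN; elim: s => [|i s ih] H; first by rewrite big_nil; case: sN.
rewrite big_cons; apply: submodule_D => //; first by apply: H; rewrite inE eqxx.
by apply: ih => j js; apply: H; rewrite inE js orbT.
Qed.

Lemma submodule_gproj (N : set M) x :
  submodule N -> (forall g, N (gproj g x)) -> N x.
Proof.
by move=> sN H; have [s _ ->] := gproj_seq x; apply: submodule_sum.
Qed.

End Act.

Section Mul.
Variables (G : groupoid) (R : gradedRing G).
Implicit Types (a b : R).

Lemma homogM g h k a b :
  homog g a -> homog h b -> gcomp g h = Some k -> homog k (rmul a b).
Proof. exact: (@homog_act _ _ (regular_module R)). Qed.

Lemma homogMV g a b : homog g a -> homog (ginv g) b -> homog (gid (grng g)) (rmul a b).
Proof. by move=> ha hb; apply: homogM ha hb (gcompgV g). Qed.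

Lemma homogVM g a b : homog (ginv g) a -> homog g b -> homog (gid (gdom g)) (rmul a b).
Proof. by move=> ha hb; apply: homogM ha hb (gcompVg g). Qed.

Lemma mul_undef g h a b :
  homog g a -> homog h b -> gdom g <> grng h -> rmul a b = 0.
Proof. exact: (@act_undef _ _ (regular_module R)). Qed.

Lemma gproj_mull g h k a b : homog g a -> gcomp g h = Some k ->
  gproj k (rmul a b) = rmul a (gproj h b).
Proof. exact: (@gproj_actl _ _ (regular_module R)). Qed.

Lemma gproj_mul_gone k a f :
  gproj k (rmul a (gone R f)) = if gdom k == f then gproj k a else 0.
Proof. exact: (@gproj_act_gone _ _ (regular_module R)). Qed.

Lemma gproj_gone_mul k a f :
  gproj k (rmul (gone R f) a) = if grng k == f then gproj k a else 0.
Proof.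
case: eqP => [<-|n].
  rewrite (gproj_mull _ (gone_homog _ _) (gcomp1g k)).
  exact: gone_mul (gproj_homog _ _).
by apply: (@gproj_act_rng _ _ (regular_module R) (gid f)); rewrite ?grng_id //;
  exact: gone_homog.
Qed.

Lemma gone_mulE g a f : homog g a ->
  rmul (gone R f) a = if grng g == f then a else 0.
Proof.
move=> ha; case: eqP => [<-|n]; first exact: gone_mul.
by apply: (mul_undef (gone_homog R f) ha); rewrite gdom_id => /esym.
Qed.

Lemma mul_goneE g a f : homog g a ->
  rmul a (gone R f) = if gdom g == f then a else 0.
Proof. exact: (@act_gone_dom _ _ (regular_module R)). Qed.

Lemma gone_idem e : rmul (gone R e) (gone R e) = gone R e.
Proof. by rewrite gone_gone ?eqxx //; exact: (regular_module R). Qed.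

Lemma gone_mul_id e a : homog (gid e) a -> rmul (gone R e) a = a.
Proof. by move=> ha; rewrite (gone_mulE _ ha) grng_id eqxx. Qed.

Lemma mul_gone_id e a : homog (gid e) a -> rmul a (gone R e) = a.
Proof. by move=> ha; rewrite (mul_goneE _ ha) gdom_id eqxx. Qed.

Lemma rmulN a b : rmul a (- b) = - rmul a b.
Proof. exact: (morphN (f := rmul a) (@rmulDr _ R a)). Qed.

Lemma rmulNl a b : rmul (- a) b = - rmul a b.
Proof. exact: (morphN (f := fun x => rmul x b) (fun x y => rmulDl x y b)). Qed.

Lemma rmulBr a b c : rmul a (b - c) = rmul a b - rmul a c.
Proof. by rewrite rmulDr rmulN. Qed.

Lemma rmulBl a b c : rmul (a - b) c = rmul a c - rmul b c.
Proof. by rewrite rmulDl rmulNl. Qed.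

Lemma ideal_submodule (I : set R) :
  gr_ideal I -> gr_submodule (M := regular_module R) I.
Proof. by case=> I0 IB IM Ip; split => //; split => // x a /(IM x a) []. Qed.

Lemma ideal_full (I : set R) :
  gr_ideal I -> (forall e, I (gone R e)) -> I = setT.
Proof.
move=> gI H; have [sI Ip] := ideal_submodule gI.
apply/seteqP; split => // x _; apply: (submodule_gproj sI) => g.
rewrite -(gone_mul (gproj_homog g x)); case: gI => _ _ IM _.
by have [] := IM _ (gproj g x) (H (grng g)).
Qed.

End Mul.

(** * Components of the module constructions *)

Section Components.
Variables (G : groupoid) (R : gradedRing G).

Lemma shift_gproj (M : gradedModule R) (s g h : G) (x : gshift M s) :
  gcomp s g = Some h -> subgrp_val (gproj g x) = gproj h (subgrp_val x).
Proof.
move=> E; symmetry.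
apply: (gproj_morph (M := gshift M s) (f := @subgrp_val _ _) (rho := gcomp s)) E.
- by [].
- by move=> k y /(_ tt).
- exact: gcomp_inj.
Qed.

Lemma shift_homog (M : gradedModule R) (s g : G) (x : gshift M s) :
  homog g x -> ohomog (gcomp s g) (subgrp_val x).
Proof. by move=> /(_ tt). Qed.

Section AtObj.
Variables (M : gradedModule R) (e : gobj G).

Lemma at_rng (x : at_obj M e) g : gproj g (subgrp_val x) != 0 -> grng g = e.
Proof. by move/(subgrpP x); rewrite grng_id. Qed.

Lemma at_gproj g (x : at_obj M e) :
  subgrp_val (gproj g x) = gproj g (subgrp_val x).
Proof.
case: (eqVneq (grng g) e) => [rg|n].
  by apply: shift_gproj; rewrite -rg gcomp1g.
have -> : gproj g (subgrp_val x) = 0.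
  by apply/eqP/negPn/negP => /at_rng E; rewrite E eqxx in n.
have := shift_homog (gproj_homog g x).
by rewrite gcomp_None // gdom_id => /esym E; rewrite E eqxx in n.
Qed.

Lemma at_homog g (x : at_obj M e) : homog g x -> homog g (subgrp_val x).
Proof. by move/homog_gproj <-; rewrite at_gproj; exact: gproj_homog. Qed.

End AtObj.

Lemma ring_at_gone e (x : ring_at R e) :
  rmul (gone R e) (subgrp_val x) = subgrp_val x.
Proof.
apply: gproj_ext => g; rewrite gproj_gone_mul; case: eqP => // n.
by apply/esym/eqP/negPn/negP => /(@at_rng (regular_module R)).
Qed.

Lemma in_ring_at e (a : R) : sg_set (gshift_subgroup (regular_module R) (gid e))
  (rmul (gone R e) a).
Proof.
move=> h; rewrite gproj_gone_mul grng_id; case: (eqVneq (grng h) e) => // _.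
by rewrite eqxx.
Qed.

Definition to_at e (a : R) : ring_at R e := mk_subgrp (@in_ring_at e a).

Lemma dsum_gproj (I : Type) (M : I -> gradedModule R) g (x : dsum M) i :
  subgrp_val (gproj g x) i = gproj g (subgrp_val x i).
Proof.
symmetry; apply: (gproj_morph (M := dsum M) (f := fun x => subgrp_val x i)
  (rho := Some)) => //.
by move=> ? ? ? [->] [->].
Qed.

Lemma dsum_homog (I : Type) (M : I -> gradedModule R) g (x : dsum M) :
  homog g x <-> forall i, homog g (subgrp_val x i).
Proof. by split. Qed.

End Components.

Section ProductComponents.
Variables (G : groupoid) (J : Type) (R : J -> gradedRing G).

Lemma gprod_gproj g (x : gprod R) j :
  subgrp_val (gproj g x) j = gproj g (subgrp_val x j).
Proof.
symmetry; apply: (gproj_morph (M := gprod R) (f := fun x => subgrp_val x j)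
  (rho := Some)) => //.
by move=> ? ? ? [->] [->].
Qed.

Lemma gprod_ext (x y : gprod R) :
  (forall j, subgrp_val x j = subgrp_val y j) -> x = y.
Proof. by move=> H; apply: subgrp_inj; apply: functional_extensionality_dep. Qed.

End ProductComponents.

(** * Pivot objects *)

Section Principal.
Variables (G : groupoid) (R : gradedRing G).

Lemma gproj_principal g k (a : R) c : homog g a ->
  exists c', gproj k (rmul a c) = rmul a c'.
Proof.
move=> ha; case: (eqVneq (grng k) (grng g)) => [rk|/eqP nk].
  have [h Eh] := @gcompP _ (ginv g) k ltac:(by rewrite gdom_inv).
  by exists (gproj h c); apply: gproj_mull ha (gcompKVl Eh).
by exists 0; rewrite rmul0; apply: (@gproj_act_rng _ _ (regular_module R) g).
Qed.

Lemma principal_submodule e g (a : R) : homog g a ->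
  gr_submodule [set x : ring_at R e | exists c, subgrp_val x = rmul a c].
Proof.
move=> ha; split; first split.
- by exists 0; rewrite rmul0.
- by move=> x y [c E] [d F]; exists (c - d); rewrite subgrp_valB E F rmulBr.
- by move=> x b [c E]; exists (rmul c b); rewrite rmulA -E.
- move=> k x [c E]; have [c' E'] := gproj_principal k c ha.
  by exists c'; rewrite at_gproj E.
Qed.

End Principal.

Section Pivot.
Variables (G : groupoid) (R : gradedRing G).
Implicit Types (a b : R) (e f : gobj G) (Delta : set (gobj G)).

(** Gr-simplicity of [1_f R] in terms of elements: a nonzero homogeneous element
    generates it as soon as it is right invertible. *)
Definition pivot f := gone R f <> 0 /\
  forall g a, homog g a -> grng g = f -> a <> 0 ->
    exists2 b, homog (ginv g) b & rmul a b = gone R f.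

(** The ideal generated by the units of [Delta] is the whole ring. Quantifying
    over ideals avoids writing elements as sums: each application exhibits one
    well-chosen ideal. *)
Definition generates Delta := forall I : set R,
  gr_ideal I -> (forall f, Delta f -> I (gone R f)) -> I = setT.

Definition pivotal Delta := Delta `<=` pivot /\ generates Delta.

(** The component of degree [g^-1] of any right inverse of an element of degree
    [g] is again a right inverse, so degrees of inverses need not be tracked. *)
Lemma homog_right_inverse g a c : homog g a -> rmul a c = gone R (grng g) ->
  exists2 b, homog (ginv g) b & rmul a b = gone R (grng g).
Proof.
move=> ha E; exists (gproj (ginv g) c); first exact: gproj_homog.
by rewrite -(gproj_mull _ ha (gcompgV g)) E homog_gproj //; exact: gone_homog.
Qed.

Lemma pivotP f : pivot f <-> gr_simple_mod (ring_at R f).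
Proof.
split=> [[n1 pf]|[[x0 nx] simp]].
  pose u := to_at f (gone R f).
  have uE : subgrp_val u = gone R f by exact: gone_idem.
  split; first by exists u; apply/eqP => E; apply: n1; rewrite -uE E.
  move=> N [sN Np]; case: (pselect (N = [set 0])) => [|nN]; [by left|right].
  have [x Nx nx] : exists2 x, N x & x <> 0.
    apply: contrapT => H; apply: nN; apply/seteqP; split => [x Nx|x ->].
      by apply: contrapT => nx; apply: H; exists x.
    by case: sN.
  have [g ng] := gproj_neq0 nx.
  have ngv : gproj g (subgrp_val x) != 0.
    by rewrite -at_gproj; apply: contraNneq ng => E; apply/eqP/subgrp_inj.
  have [b hb ab] := pf g _ (gproj_homog g (subgrp_val x))
    (@at_rng _ _ (regular_module R) _ _ _ ngv) (elimN eqP ngv).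
  have Nu : N u.
    suff -> : u = mact (gproj g x) b by case: sN => _ _; apply; exact: Np.
    by apply: subgrp_inj; rewrite uE -ab -at_gproj.
  apply/seteqP; split => // y _.
  suff -> : y = mact u (subgrp_val y) by case: sN => _ _; apply.
  by apply: subgrp_inj; rewrite /= gone_idem ring_at_gone.
split.
  move=> E; case/eqP: nx; apply: subgrp_inj; rewrite -ring_at_gone E.
  exact: mul0.
move=> g a ha rg na.
pose N : set (ring_at R f) := [set x | exists c, subgrp_val x = rmul a c].
have gN : gr_submodule N := principal_submodule f ha.
case: (simp N gN) => NE.
  have : N (to_at f a) by exists (gone R (gdom g)); rewrite mul_gone //= -rg gone_mul.
  by rewrite NE => /(congr1 (@subgrp_val _ _)) /=; rewrite -rg gone_mul.
have [c] : N (to_at f (gone R f)) by rewrite NE.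
by rewrite /= gone_idem -rg => /esym; exact: homog_right_inverse.
Qed.

End Pivot.

(** * Consequences of the pivotal condition *)

Section Core.
Variables (G : groupoid) (R : gradedRing G).

(** The largest graded part. Ideals below are cut out by equations in arbitrary
    elements, so they are visibly submodules but not visibly graded; passing to
    the core repairs this, and loses nothing on homogeneous elements. *)
Definition core (M : gradedZmod G) (N : set M) : set M :=
  [set x | forall g, N (gproj g x)].

Lemma core_homog (M : gradedZmod G) (N : set M) g (x : M) :
  N 0 -> homog g x -> N x -> core N x.
Proof. by move=> N0 hx Nx k; rewrite (gproj_id _ hx); case: ifP. Qed.

Lemma core_sub (M : gradedModule R) (N : set M) : submodule N -> core N `<=` N.
Proof. by move=> sN x Nx; exact: submodule_gproj. Qed.

Lemma core_submodule (M : gradedModule R) (N : set M) :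
  submodule N -> gr_submodule (core N).
Proof.
move=> sN; have [N0 NB NM] := sN; split; first split.
- by move=> g; rewrite gproj0.
- by move=> x y Nx Ny g; rewrite gproj_B; exact: NB.
- move=> x a Nx k; have [s _ ->] := gproj_seq x; have [t _ ->] := gproj_seq a.
  rewrite mact_bigl gproj_big; apply: submodule_sum => // g _.
  rewrite mact_bigr gproj_big; apply: submodule_sum => // h _.
  have := homog_mact (gproj_homog g x) (gproj_homog h a).
  case: gcomp => [l|] /= H; last by rewrite H gproj0.
  by rewrite (gproj_id _ H); case: ifP => // _; exact: NM.
- by move=> g x Nx; apply: core_homog (gproj_homog g x) (Nx g).
Qed.

Lemma core_ideal (I : set R) :
  submodule (M := regular_module R) I -> (forall x a, I x -> I (rmul a x)) ->
  gr_ideal (core I).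
Proof.
move=> sI IL; have [[C0 CB CM] Cp] := core_submodule sI.
split => // x a Cx; split; first exact: CM.
move=> k; have [s _ ->] := gproj_seq x; have [t _ ->] := gproj_seq a.
rewrite rmul_bigl gproj_big; apply: (submodule_sum sI) => h _.
rewrite rmul_bigr gproj_big; apply: (submodule_sum sI) => g _.
have := homog_mul (gproj_homog h a) (gproj_homog g x).
case: sI => I0 _ _; case: gcomp => [l|] /= H; last by rewrite H gproj0.
by rewrite (gproj_id _ H); case: ifP => // _; exact: IL.
Qed.

End Core.

Section PivotTheory.
Variables (G : groupoid) (R : gradedRing G).
Implicit Types (a b : R) (e f : gobj G) (Delta : set (gobj G)).

(** The elements annihilating [R a] form an ideal. If it contained the units of
    [Delta] it would be the whole ring, and [a] would be killed by the local
    units that fix its components. *)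
Lemma generates_detects Delta a : generates R Delta -> a <> 0 ->
  exists f s, Delta f /\ rmul (gone R f) (rmul s a) <> 0.
Proof.
move=> gen na; apply: contrapT => H; apply: na.
pose I : set R := [set r | forall s, rmul r (rmul s a) = 0].
have sI : submodule (M := regular_module R) I.
  split=> [s|x y Ix Iy s|x b Ix s] /=; first exact: mul0.
    by rewrite rmulBl Ix Iy subrr.
  by rewrite -rmulA (rmulA b); exact: Ix.
have gI : gr_ideal (core I).
  by apply: core_ideal => // x b Ix s; rewrite -rmulA Ix rmul0.
have I0 : I 0 by case: sI.
have CE : core I = setT.
  apply: gen => // f Df; apply: core_homog (gone_homog R f) _ => // s.
  by apply: contrapT => n; apply: H; exists f, s.
apply: gproj_ext => k; rewrite gproj0.
have : core I (gone R (grng k)) by rewrite CE.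
move/(core_sub sI)/(_ (gone R (grng k))).
move/(congr1 (gproj k)); rewrite !gproj_gone_mul eqxx => ->; exact: gproj0.
Qed.

(** Some [t] makes [t a] nonzero and ending at a pivot, hence right invertible,
    say [t a c = 1]. Then [c t a] is a nonzero idempotent in the component of
    the identity of a pivot, where nonzero elements are invertible, so it is the
    local unit and [c t] is the left inverse. *)
Lemma pivotal_left_inverse Delta g a :
  pivotal R Delta -> homog g a -> Delta (gdom g) -> a <> 0 ->
  exists2 b, homog (ginv g) b & rmul b a = gone R (gdom g).
Proof.
move=> [piv gen] ha Dg na.
have [f [s [Df ns]]] := generates_detects gen na.
have [h nh] : exists h, rmul (gone R f) (rmul (gproj h s) a) <> 0.
  apply: contrapT => H; apply: ns; have [t _ ->] := gproj_seq s.
  rewrite rmul_bigl rmul_bigr big1 // => h _; apply: contrapT => n.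
  by apply: H; exists h.
pose t := gproj h s; have ht : homog h t := gproj_homog h s.
have dh : gdom h = grng g.
  by apply: contrapT => n; apply: nh; rewrite (mul_undef ht ha n) rmul0.
have [k Ek] := gcompP dh; have hta := homogM ht ha Ek.
have rk : grng k = f.
  by apply: contrapT => /eqP/negPf n; apply: nh; rewrite (gone_mulE _ hta) n.
rewrite (gone_mulE _ hta) rk eqxx in nh.
have [c hc tac] := (piv f Df).2 k _ hta rk nh.
have hct : homog (ginv g) (rmul c t) := homogM hc ht (gcompKl (gcompKr Ek)).
have hcta := homogVM hct ha.
have nz : rmul (rmul c t) a <> 0.
  move=> E; apply: nh; rewrite -[rmul t a](gone_mul hta) rk -tac -!rmulA.
  by rewrite (rmulA c) E !rmul0.
have [u _ Eu] := (piv _ Dg).2 _ _ hcta (grng_id _) nz.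
exists (rmul c t) => //.
have idem : rmul (rmul (rmul c t) a) (rmul (rmul c t) a) = rmul (rmul c t) a.
  rewrite -(rmulA c t a) -(rmulA c (rmul t a)) (rmulA (rmul t a)) tac -rk.
  by rewrite (gone_mul hta).
by rewrite -(mul_gone_id hcta) -Eu rmulA idem.
Qed.

Lemma pivot_ideal (I : set R) f g a : pivot R f -> gr_ideal I ->
  I a -> homog g a -> grng g = f -> a <> 0 -> I (gone R f).
Proof.
move=> [_ pf] [_ _ IM _] Ia ha rg na; have [b _ <-] := pf g a ha rg na.
by have [] := IM a b Ia.
Qed.

(** A nonzero ideal reaches [1_f R] by [generates_detects], and there its
    elements are right invertible. *)
Lemma pivotal_simple f : pivotal R [set f] -> gr_simple_ring R.
Proof.
move=> [piv gen]; have pf : pivot R f by exact: piv.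
split; first by exists (gone R f); apply/eqP; case: pf.
move=> I gI; case: (pselect (I = [set 0])) => [|nI]; [by left|right].
have [x Ix nx] : exists2 x, I x & x <> 0.
  apply: contrapT => H; apply: nI; apply/seteqP; split => [x Ix|x ->].
    by apply: contrapT => nx; apply: H; exists x.
  by case: gI.
apply: (gen) => // f' ->.
have [f1 [s [/= -> ns]]] := generates_detects gen nx.
have [g ng] := gproj_neq0 ns.
have [_ _ IM Ip] := gI.
apply: (pivot_ideal pf gI (Ip g _ (IM _ (gone R f) (IM _ s Ix).2).2)
  (gproj_homog _ _) _ (elimN eqP ng)).
by apply/eqP; move: ng; rewrite gproj_gone_mul; case: ifP => // _; rewrite eqxx.
Qed.

Lemma simple_gone_neq0 : gr_simple_ring R -> exists e, gone R e <> 0.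
Proof.
move=> [[x /eqP nx] _]; have [g ng] := gproj_neq0 nx.
exists (grng g) => E; case/eqP: ng.
by rewrite -(gone_mul (gproj_homog g x)) E mul0.
Qed.

Lemma simple_prime : gr_simple_ring R -> gr_prime R.
Proof.
move=> sR; have [e ne] := simple_gone_neq0 sR.
move=> I J gI gJ nI nJ E; apply: ne.
have full (K : set R) : gr_ideal K -> K <> [set 0] -> K = setT.
  by move=> gK nK; case: (sR.2 K gK).
suff : ideal_mul I J (gone R e) by rewrite E.
exists [:: (gone R e, gone R e)]; last by rewrite big_seq1 gone_idem.
by move=> p; rewrite (full I) // (full J).
Qed.

(** By gr-primeness a nonzero ideal [I] has [I R 1_f <> 0] for every pivot [f]
    of [Delta]; a nonzero homogeneous element of [I] starting at [f] has a left
    inverse, so [I] contains all the units of [Delta]. *)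
Lemma pivotal_prime_simple Delta :
  pivotal R Delta -> gr_prime R -> nonzero_gz R -> gr_simple_ring R.
Proof.
move=> pD prime nR; have [piv gen] := pD.
split=> // I gI; case: (pselect (I = [set 0])) => [|nI]; [by left|right].
apply: gen => // f Df.
have [I0 IB IM Ip] := gI.
(* The core of [J] is an ideal with zero product with [I], so it must be zero. *)
pose J : set R := [set r | forall x, I x -> forall s, rmul x (rmul s r) = 0].
have [x [Ix [s ns]]] : exists x, I x /\ exists s, rmul x (rmul s (gone R f)) <> 0.
  apply: contrapT => H.
  have sJ : submodule (M := regular_module R) J.
    split=> [x _ s|y z Jy Jz x Ix s|y b Jy x Ix s] /=; first by rewrite !rmul0.
      by rewrite !rmulBr Jy // Jz // subrr.
    by rewrite !rmulA -(rmulA x) Jy // mul0.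
  have gJ : gr_ideal (core J).
    by apply: core_ideal => // y b Jy x Ix s; rewrite (rmulA s); exact: Jy.
  have Jf : core J (gone R f).
    apply: core_homog (gone_homog R f) _; first by case: sJ.
    by move=> x Ix s; apply: contrapT => n; apply: H; exists x; split => //; exists s.
  apply: (prime I (core J)) => //.
    by move=> E; move: Jf; rewrite E => /(piv f Df).1.
  apply/seteqP; split => [z [t tIJ ->]|z ->]; last first.
    by exists [::]; rewrite ?big_nil.
  rewrite big_seq big1 // => p /tIJ[Ip1 Jp2].
  have [w _ ew] := gproj_seq p.2; rewrite ew rmul_bigr big1 // => g _.
  have /(core_sub sJ)/(_ _ Ip1 (gone R (grng g))) : core J (gproj g p.2).
    by case: gJ => _ _ _; apply.
  by rewrite (gone_mul (gproj_homog _ _)).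
have [g ng] := gproj_neq0 ns.
have := ng; rewrite (rmulA x) gproj_mul_gone.
case: (eqVneq (gdom g) f) => [dg|_]; last by rewrite eqxx.
move=> /eqP ng'; rewrite -dg.
have [|b _ <-] := pivotal_left_inverse pD (gproj_homog g _) _ ng'.
  by rewrite dg.
by have [] := IM _ b (Ip g _ (IM _ s Ix).1).
Qed.

End PivotTheory.

(** * Modules over a ring generated by pivot objects have bases *)

Lemma chain_seq (T : eqType) (F : set (set T)) (s : seq T) :
  total_on F subset -> s != [::] ->
  (forall t, t \in s -> (\bigcup_(A in F) A) t) ->
  exists2 A, F A & forall t, t \in s -> A t.
Proof.
move=> tot; elim: s => [|t s ih] // _ H.
have [A FA At] := H t (mem_head _ _).
case: (eqVneq s [::]) => [->|ns].
  by exists A => // u; rewrite inE => /eqP ->.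
have [B FB Bs] := ih ns (fun u us => H u (@mem_behead _ (t :: s) u us)).
case: (tot A B FA FB) => sub.
  by exists B => // u; rewrite inE => /orP[/eqP ->|/Bs]; [exact: sub|].
by exists A => // u; rewrite inE => /orP[/eqP ->|/Bs /sub].
Qed.

Section Basis.
Variables (G : groupoid) (R : gradedRing G) (Delta : set (gobj G)).
Hypothesis pD : pivotal R Delta.
Variable M : gradedModule R.

(** Vectors are kept together with their degrees. A linear combination is a list
    of pairs of a vector and a coefficient, so that independence of a set only
    involves finitely many of its members, as Zorn's lemma requires. *)
Definition independent (B : set (G * M)) :=
  (forall p, B p -> [/\ homog p.1 p.2, p.2 <> 0 & Delta (gdom p.1)]) /\
  forall s : seq ((G * M) * R), uniq (unzip1 s) ->
    (forall t, t \in s -> B t.1 /\ rmul (gone R (gdom t.1.1)) t.2 = t.2) ->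
    \sum_(t <- s) mact t.1.2 t.2 = 0 -> forall t, t \in s -> t.2 = 0.

Definition span_of (B : set (G * M)) : set M :=
  [set z | forall N : set M, submodule N -> (forall p, B p -> N p.2) -> N z].

Lemma span_submodule B : submodule (span_of B).
Proof.
split.
- by move=> N [].
- by move=> x y Sx Sy N sN BN; case: (sN) => _ + _; apply; [exact: Sx|exact: Sy].
- by move=> x a Sx N sN BN; case: (sN) => _ _; apply; exact: Sx.
Qed.

Lemma span_gproj B g x : independent B -> span_of B x -> span_of B (gproj g x).
Proof.
move=> [hB _] Sx N sN BN; apply: (Sx (core N) (core_submodule sN).1) => p Bp.
by case: (hB p Bp) => hp _ _; apply: core_homog hp (BN p Bp); case: sN.
Qed.

(** If [x] occurred with a nonzero coefficient [a] in a relation, then [x a]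
    would lie in the span; its component [x a_h] too, and [a_h] is right
    invertible because [x] starts at a pivot, so [x] would lie in the span. *)
Lemma independent_add B g (x : M) : independent B -> homog g x ->
  Delta (gdom g) -> ~ span_of B x -> independent (B `|` [set (g, x)]).
Proof.
move=> iB hx Dg nS; have sS := span_submodule B; have [hB liB] := iB.
have [S0 _ SM] := sS; split.
  move=> p [/hB //|->] /=; split => // x0; apply: nS; rewrite x0; exact: S0.
move=> s us hs s0.
case: (pselect (exists2 t, t \in s & t.1 = (g, x))) => [[t ts tE]|nt]; last first.
  apply: liB => // t ts; have [[//|/= tE] ?] := hs t ts.
  by case: nt; exists t.
have ps := perm_to_rem ts.
have /= /andP[nrem urem] : uniq (unzip1 (t :: rem t s)).
  by rewrite -(perm_uniq (perm_map fst ps)).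
have hrem u : u \in rem t s -> B u.1 /\ rmul (gone R (gdom u.1.1)) u.2 = u.2.
  move=> ur; have [[//|/= uE] ?] := hs u (mem_rem ur).
  by case/negP: nrem; rewrite tE -uE; exact: map_f.
move: s0; rewrite (perm_big _ ps) big_cons /= => s0.
have [_] := hs t ts; rewrite tE /= => ta.
have Sxa : span_of B (mact x t.2).
  move: s0; rewrite tE /= => /eqP; rewrite addr_eq0 => /eqP ->.
  apply: (submodule_N sS); apply: (submodule_sum sS) => u /hrem[Bu _].
  by apply: SM => N _; exact.
have t0 : t.2 = 0.
  apply: contrapT => /gproj_neq0[h nh]; apply: nS.
  have rh : grng h = gdom g.
    move: nh; rewrite -ta gproj_gone_mul.
    by case: (eqVneq (grng h) (gdom g)) => // _; rewrite eqxx.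
  have [k Ek] := gcompP (esym rh).
  have [b _ hb] := (pD.1 _ Dg).2 h _ (gproj_homog h t.2) rh (elimN eqP nh).
  rewrite -(mact_gone hx) -hb mactA; apply: SM.
  by rewrite -(gproj_actl _ hx Ek); exact: span_gproj.
move: s0; rewrite t0 mact0 add0r => s0 u us'.
case: (eqVneq u t) => [->//|nu]; apply: (liB _ urem hrem s0).
by move: us'; rewrite (perm_mem ps) inE (negPf nu).
Qed.

(** By maximality the span contains every homogeneous element starting at an
    object of [Delta]. Hence the ideal of those [r] with [M r] inside the span
    contains the units of [Delta], and so it contains all local units. *)
Lemma maximal_independent : exists2 B, independent B & span_of B = setT.
Proof.
have [F FP tot|B [iB mB]] := @Zorn_bigcup _ independent.
  split=> [p [A /FP[hA _]]|s us hs s0 t ts]; first exact: hA.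
  have ns : unzip1 s != [::] by case: (s) ts.
  have inF u : u \in unzip1 s -> (\bigcup_(A in F) A) u.
    by case/mapP=> v vs ->; case: (hs v vs).
  have [A FA As] := chain_seq tot ns inF.
  have [_ liA] := FP _ FA; apply: (liA s us _ s0 t ts) => u us'.
  by split; [apply: As; exact: map_f|case: (hs u us')].
have sS := span_submodule B; have [S0 _ SM] := sS; exists B => //.
have step g x : homog g x -> Delta (gdom g) -> span_of B x.
  move=> hx Dg; apply: contrapT => nS.
  apply: (mB (B `|` [set (g, x)])); last exact: independent_add.
  split; first by left.
  move=> sub; apply: nS => N _ BN; apply: (BN (g, x)); apply: sub; by right.
pose I : set R := [set r | forall m : M, span_of B (mact m r)].
have sI : submodule (M := regular_module R) I.
  split=> [m|a b Ia Ib m|a b Ia m] /=.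
  - by rewrite mact0.
  - rewrite (morphB (f := mact m) (@mactDr _ _ M m)).
    by case: sS => _ + _; apply; [exact: Ia|exact: Ib].
  - by rewrite mactA; apply: SM.
have /seteqP[_ full] : core I = setT.
  apply: pD.2; first by apply: core_ideal => // a b Ia m; rewrite mactA; exact: Ia.
  move=> f Df; apply: core_homog (gone_homog R f) _; first by case: sI.
  move=> m; apply: (submodule_gproj sS) => k; rewrite gproj_act_gone.
  case: eqP => [dk|//]; apply: step (gproj_homog k m) _; by rewrite dk.
apply/seteqP; split => // m _; apply: (submodule_gproj sS) => k.
rewrite -(mact_gone (gproj_homog k m)); exact: (core_sub sI (full _ Logic.I)).
Qed.

Lemma pivotal_basis : exists (I : choiceType) (c : I -> G) (x : I -> M),
  pseudo_basis c x /\ forall i, Delta (gdom (c i)).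
Proof.
have [B iB BE] := maximal_independent; have [hB liB] := iB.
have BI (i : B) : B (val i) := set_mem (valP i).
exists B, (fun i => (val i).1), (fun i => (val i).2); split; last first.
  by move=> i; case: (hB _ (BI i)).
split.
- by move=> i; case: (hB _ (BI i)).
- move=> N sN NB; apply/seteqP; split => // m _.
  have : span_of B m by rewrite BE.
  apply=> // p Bp; exact: (NB (exist _ p (mem_set Bp))).
move=> a ha fa sa i; have [s us ss] := finite_uniq fa.
rewrite (@fsum_seq _ _ _ s) // in sa; last first.
  by move=> j nj; apply: ss; apply: contraNneq nj => ->; rewrite mact0.
case: (eqVneq (a i) 0) => // /ss si.
apply: (liB [seq (val j, a j) | j <- s] _ _ _ (val i, a i)).
- rewrite /unzip1 -map_comp map_inj_uniq //; exact: val_inj.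
- move=> t /mapP[j js ->] /=; split; first exact: BI.
  by have [b ->] := ha j; rewrite rmulA gone_idem.
- by rewrite big_map.
- exact: map_f.
Qed.

End Basis.

Lemma pivotal_pfm (G : groupoid) (R : gradedRing G) Delta :
  pivotal R Delta -> pfm_ring R.
Proof.
by move=> pD M; have [I [c [x [b _]]]] := pivotal_basis pD M; exists I, c, x.
Qed.

(** * Quotients by graded submodules *)

Section Quotient.
Variables (G : groupoid) (R : gradedRing G) (M : gradedModule R) (N : set M).
Hypothesis gN : gr_submodule N.

Lemma quot_sg0 : N 0. Proof. by case: gN => -[]. Qed.
Lemma quot_sgB x y : N x -> N y -> N (x - y).
Proof. by case: gN => -[_ + _ _]; apply. Qed.

Definition quot_subgroup : subgroup M := Subgroup quot_sg0 quot_sgB.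

Definition gquot_zmod : zmodType := Quotient.quot (sg_pred quot_subgroup).

Definition to_quot (x : M) : gquot_zmod :=
  (\pi_(Quotient.quot (sg_pred quot_subgroup)) x)%qT.

Lemma to_quotD : {morph to_quot : x y / x + y}.
Proof. exact: Quotient.pi_add. Qed.

Lemma to_quot_eq x y : to_quot x = to_quot y <-> N (x - y).
Proof.
have E := Quotient.idealrBE (sg_pred quot_subgroup) x y.
split=> [H|Nxy].
  by apply/asboolP; rewrite -[asbool _]/(x - y \in sg_pred quot_subgroup) E; apply/eqP.
by apply/eqP; rewrite -E; apply/asboolP.
Qed.

Lemma to_quot_eq0 x : to_quot x = 0 <-> N x.
Proof. by rewrite -(morph0 to_quotD) to_quot_eq subr0. Qed.

Lemma to_quot_surj q : exists x, to_quot x = q.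
Proof. by exists (repr q); exact: reprK. Qed.

Definition gquot_homog (g : G) : set gquot_zmod :=
  [set q | exists2 x, homog g x & to_quot x = q].

Lemma gquot_homog0 g : gquot_homog g 0.
Proof. by exists 0; [exact: homog0|exact: morph0 to_quotD]. Qed.

Lemma gquot_homogB g p q :
  gquot_homog g p -> gquot_homog g q -> gquot_homog g (p - q).
Proof.
move=> [x hx <-] [y hy <-]; exists (x - y); first exact: homogB.
exact: morphB to_quotD _ _.
Qed.

Lemma gquot_direct_sum q : exists! c : G -> gquot_zmod, is_decomp gquot_homog q c.
Proof.
have [y <-] := to_quot_surj q.
have [_ Np] := gN.
exists (fun g => to_quot (gproj g y)); split.
  have nz g : to_quot (gproj g y) != 0 -> gproj g y != 0.
    by apply: contraNneq => ->; apply/eqP; exact: morph0 to_quotD.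
  split=> [g||].
  - by exists (gproj g y) => //; exact: gproj_homog.
  - by apply: (sub_finite_set _ (gproj_finite y)) => g /= /nz.
  have [s [us ss] ey] := gproj_seq y.
  rewrite (@fsum_seq _ _ _ s) //; last by move=> g /nz /ss.
  by rewrite -(morph_sum to_quotD) -ey.
move=> c [hc fc ec]; apply: funext => g.
(* The given components lift to homogeneous elements whose sum differs from
   [y] by an element of [N]; comparing components in [M] gives uniqueness. *)
have [l hl] := boolp.choice (fun k => let: ex_intro2 z hz ez := hc k in
  ex_intro (fun z => homog k z /\ to_quot z = c k) z (conj hz ez)).
have [s us ss] := finite_uniq fc.
have E : to_quot y = to_quot (\sum_(k <- s) l k).
  rewrite ec (@fsum_seq _ _ _ s) // (morph_sum to_quotD).
  by apply: eq_bigr => k _; rewrite (hl k).2.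
move/to_quot_eq: E => /(Np g); rewrite gproj_B => /to_quot_eq ->.
rewrite gproj_big.
rewrite (eq_bigr (fun k => if k == g then l g else 0)); last first.
  by move=> k _; rewrite (gproj_id _ (hl k).1) eq_sym; case: eqP => [->|].
case gs: (g \in s).
  rewrite (bigD1_seq g) //= eqxx big1 ?addr0; first exact: (hl g).2.
  by move=> k /negPf ->.
have -> : c g = 0 by apply/eqP/negPn/negP => /ss; rewrite gs.
rewrite big_seq big1 ?(morph0 to_quotD) // => k ks.
by case: eqP => // kg; rewrite -kg ks in gs.
Qed.

Definition gquot_gz : gradedZmod G :=
  GradedZmod gquot_homog0 gquot_homogB gquot_direct_sum.

Definition gquot_act (q : gquot_gz) (a : R) : gquot_gz := to_quot (mact (repr q) a).

Lemma gquot_actE x a : gquot_act (to_quot x) a = to_quot (mact x a).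
Proof.
apply/to_quot_eq.
rewrite -(morphB (f := fun z => mact z a) (fun z t => mactDl z t a)).
case: gN => -[_ _ NM] _; apply: NM; apply/to_quot_eq; exact: reprK.
Qed.

Lemma gquot_actDl p q a : gquot_act (p + q) a = gquot_act p a + gquot_act q a.
Proof.
have [x <-] := to_quot_surj p; have [y <-] := to_quot_surj q.
by rewrite -[_ + _]to_quotD !gquot_actE mactDl to_quotD.
Qed.
Lemma gquot_actDr q a b : gquot_act q (a + b) = gquot_act q a + gquot_act q b.
Proof. by rewrite /gquot_act mactDr to_quotD. Qed.
Lemma gquot_actA q a b : gquot_act q (rmul a b) = gquot_act (gquot_act q a) b.
Proof. by have [x <-] := to_quot_surj q; rewrite !gquot_actE mactA. Qed.
Lemma gquot_homog_mact g h (q : gquot_gz) a :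
  homog g q -> homog h a -> ohomog (gcomp g h) (gquot_act q a).
Proof.
move=> [x hx <-] ha; rewrite gquot_actE; have := homog_mact hx ha.
case: gcomp => [k|] /= H; first by exists (mact x a).
by rewrite H; exact: morph0 to_quotD.
Qed.
Lemma gquot_act_unit g (q : gquot_gz) :
  homog g q -> gquot_act q (gone R (gdom g)) = q.
Proof. by move=> [x hx <-]; rewrite gquot_actE mact_gone. Qed.

Definition gquot : gradedModule R :=
  GradedModule gquot_actDl gquot_actDr gquot_actA gquot_homog_mact
    (full_of_unit gquot_act_unit).

End Quotient.

(** * A ring whose modules have bases is generated by its pivot objects *)

Section Pfm.
Variables (G : groupoid) (R : gradedRing G).
Let RR := regular_module R.

(** As [K] contains the annihilator of [1_e], a right ideal above [K] is the
    whole ring once it contains [1_e]; so a right ideal maximal among those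
    avoiding [1_e] is a maximal right ideal. *)
Lemma maximal_right_ideal (K : set R) e :
  gr_submodule (M := RR) K -> (forall a, rmul (gone R e) a = 0 -> K a) ->
  ~ K (gone R e) ->
  exists N : set R, [/\ gr_submodule (M := RR) N, K `<=` N, ~ N (gone R e) &
    forall N' : set R, gr_submodule (M := RR) N' -> N `<=` N' -> ~ N' `<=` N ->
      N' = setT].
Proof.
move=> gK Ke Ke1.
pose Q (A : set R) := [/\ gr_submodule (M := RR) A, K `<=` A & ~ A (gone R e)].
have QK : Q K by split.
(* The empty set is allowed only to make the empty chain bounded. *)
have [F FP tot|N [PN mN]] := @Zorn_bigcup _ (fun A => A = set0 \/ Q A).
  have QF A a : F A -> A a -> Q A.
    by move=> FA Aa; case: (FP A FA) => // A0; rewrite A0 in Aa.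
  case: (pselect (exists A a, F A /\ A a)) => [[A [a [FA Aa]]]|H]; [right|left].
    have [[[A0 _ _] _] KA _] := QF A a FA Aa.
    split; first split; first split.
    - by exists A.
    - move=> x y [B FB Bx] [C FC Cy]; case: (tot B C FB FC) => sub.
        exists C => //; have [[[_ CB _] _] _ _] := QF C y FC Cy.
        by apply: CB => //; exact: sub.
      exists B => //; have [[[_ BB _] _] _ _] := QF B x FB Bx.
      by apply: BB => //; exact: sub.
    - move=> x b [B FB Bx]; exists B => //.
      by have [[[_ _ BM] _] _ _] := QF B x FB Bx; exact: BM.
    - move=> g x [B FB Bx]; exists B => //.
      by have [[_ Bp] _ _] := QF B x FB Bx; exact: Bp.
    - by move=> x Kx; exists A => //; exact: KA.
    - by move=> [B FB B1]; case: (QF B _ FB B1).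
  by apply/seteqP; split => // x [A FA Ax]; case: H; exists A, x.
have QN : Q N.
  case: PN => // N0; case: (mN K); last by right.
  rewrite N0; split=> // /(_ 0); apply; by case: gK => -[].
have [gN KN N1] := QN.
exists N; split => // N' gN' NN' nN'.
have N'1 : N' (gone R e).
  apply: contrapT => H; apply: (mN N'); first by split.
  by right; split => // x /KN /NN'.
apply/seteqP; split => // a _; have [[_ _ N'M] _] := gN'.
rewrite -[a](subrK (rmul (gone R e) a)); apply: (submodule_D gN'.1); last exact: N'M.
by apply/NN'/KN/Ke; rewrite rmulBr rmulA gone_idem subrr.
Qed.

(** Suppose an ideal [I] contains the units of all pivots but not [1_e], and let
    [N] be a maximal right ideal containing [I] and avoiding [1_e]. A member [x]
    of a pseudo-basis of the gr-simple module [R / N], with [d(x) = f], has zero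
    annihilator in [1_f R], so [1_f R] is gr-simple and [f] is a pivot. Then
    [1_f] is in [I], which kills [x = x 1_f]: a contradiction. *)
Lemma pfm_pivotal : pfm_ring R -> pivotal R (pivot R).
Proof.
move=> pfm; split => // I gI pI; apply: ideal_full => // e; apply: contrapT => nIe.
have [sI Ip] := ideal_submodule gI; have [I0 IB IM _] := gI.
pose K : set R := [set a | I (rmul (gone R e) a)].
have gK : gr_submodule (M := RR) K.
  split; first split.
  - by rewrite /K /= rmul0.
  - by move=> x y Kx Ky; rewrite /K /= rmulBr; exact: IB.
  - by move=> x a Kx; rewrite /K /= rmulA; have [] := IM _ a Kx.
  - move=> g x Kx; have E : gproj g (rmul (gone R e) x) = rmul (gone R e) (gproj g x).
      rewrite gproj_gone_mul; case: eqP => [<-|n].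
        by rewrite (gone_mul (gproj_homog g x)).
      by rewrite (gone_mulE _ (gproj_homog g x)); case: eqP.
    by rewrite /K /= -E; exact: Ip.
have [||N [gN KN N1 mN]] := @maximal_right_ideal K e gK.
- by move=> a a0; rewrite /K /= a0.
- by rewrite /K /= gone_idem.
have [J [c [x [hx gen ind]]]] := pfm (gquot gN).
have [i _] : exists i : J, True.
  apply: contrapT => H; apply: N1; apply/(to_quot_eq0 gN).
  have : [set (0 : gquot gN)] = setT.
    apply: gen => [|i]; last by case: H; exists i.
    split=> [//|y z -> ->|y a ->]; first exact: subrr.
    exact: (@mact0l _ _ (gquot gN)).
  by move/seteqP => [_ /(_ (to_quot gN (gone R e)))]; apply.
have [[y hy yx] nx] := hx i.
pose f := gdom (c i).
have nNy : ~ N y by move/(to_quot_eq0 gN); rewrite yx.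
have xa0 a : rmul (gone R f) a = a -> mact (x i) a = 0 -> a = 0.
  move=> fa xa; pose a' j := if j == i then a else 0.
  suff : a' i = 0 by rewrite /a' eqxx.
  apply: ind.
  - move=> j; rewrite /a'; case: eqP => [->|_]; first by exists a.
    by exists 0; rewrite rmul0.
  - apply: (sub_finite_set (B := [set i])); last exact: finite_set1.
    by move=> j /=; rewrite /a'; case: (eqVneq j i) => // _; rewrite eqxx.
  rewrite (@fsum_seq _ _ _ [:: i]) //; first by rewrite big_seq1 /a' eqxx.
  by move=> j; rewrite /a' inE; case: (eqVneq j i) => // _; rewrite mact0 eqxx.
(* As [x a] generates the gr-simple quotient, [x = x a b] for some [b], and the
   zero annihilator of [x] turns this into [1_f = a b]. *)
have pf : pivot R f.
  split=> [f0|h a ha rh na].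
    by apply: nNy; rewrite -(mul_gone hy) -/f f0 rmul0; exact: quot_sg0 gN.
  have fa : rmul (gone R f) a = a by rewrite -rh gone_mul.
  have nya : ~ N (rmul y a).
    by move/(to_quot_eq0 gN); rewrite -gquot_actE yx => /(xa0 a fa).
  have [[N0 NB NM] Np] := gN.
  pose N' : set R := [set z | exists2 b, N (z - rmul (rmul y a) b) & True].
  have [k Ek] := gcompP (esym rh).
  have hya : homog k (rmul y a) := homogM hy ha Ek.
  have gN' : gr_submodule (M := RR) N'.
    split; first split.
    - by exists 0; rewrite ?rmul0 ?subr0.
    - move=> z t [b Nz _] [d Nt _]; exists (b - d) => //.
      rewrite rmulBr (_ : _ - _ = (z - rmul (rmul y a) b) - (t - rmul (rmul y a) d)).
        exact: NB.
      by rewrite !opprD !opprK addrACA.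
    - move=> z d [b Nz _]; exists (rmul b d) => //.
      by rewrite rmulA -rmulBl; exact: NM.
    - move=> l z [b /(Np l) Nz _]; rewrite gproj_B in Nz.
      case: (eqVneq (grng l) (grng k)) => [rl|/eqP nl].
        have [m Em] := @gcompP _ (ginv k) l ltac:(by rewrite gdom_inv).
        by exists (gproj m b) => //; rewrite -(gproj_mull _ hya (gcompKVl Em)).
      exists 0 => //; move: Nz.
      by rewrite (@gproj_act_rng _ _ RR k) // rmul0.
  have N'T : N' = setT.
    apply: mN => //; first by move=> z Nz; exists 0; rewrite ?rmul0 ?subr0.
    move=> sub; apply: nya; apply: sub; exists (gone R (gdom k)) => //.
    by rewrite (mul_gone hya) subrr.
  have [b + _] : N' y by rewrite N'T.
  move=> /(Np (c i)); rewrite gproj_B (homog_gproj hy) -rmulA.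
  rewrite (gproj_mull _ hy (gcompg1 _)) -/f.
  have E : gproj (gid f) (rmul a b) = rmul a (gproj (ginv h) b).
    by rewrite -rh (gproj_mull _ ha (gcompgV h)).
  rewrite E => H; exists (gproj (ginv h) b); first exact: gproj_homog.
  have hab : homog (gid f) (rmul a (gproj (ginv h) b)).
    by rewrite -E; exact: gproj_homog.
  apply/esym/eqP; rewrite -subr_eq0; apply/eqP; apply: xa0.
    by rewrite rmulBr gone_idem (gone_mul_id hab).
  rewrite -yx [LHS]gquot_actE; apply/(to_quot_eq0 gN).
  by rewrite [mact _ _]rmulBr (mul_gone hy).
apply: nNy; apply: KN; rewrite /K /= -(mul_gone hy).
by have [_] := IM _ (rmul (gone R e) y) (pI f pf); rewrite -rmulA.
Qed.

End Pfm.

(** * Graded isomorphisms *)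

Lemma inj_surj_bij (X Y : Type) (f : X -> Y) :
  injective f -> (forall y, exists x, f x = y) -> bijective f.
Proof.
move=> fi fs; have [g gK] := boolp.choice fs.
by exists g => // x; apply: fi.
Qed.

Section Iso.
Variable G : groupoid.

Lemma gproj_hom (M N : gradedZmod G) (f : M -> N) g x :
  {morph f : x y / x + y} -> (forall h x, homog h x -> homog h (f x)) ->
  gproj g (f x) = f (gproj g x).
Proof.
move=> fD fH; apply: (gproj_morph (rho := Some)) => //.
by move=> ? ? ? [->] [->].
Qed.

Lemma inv_homog (M N : gradedZmod G) (f : M -> N) (f' : N -> M) g y :
  {morph f : x y / x + y} -> (forall h x, homog h x -> homog h (f x)) ->
  cancel f f' -> cancel f' f -> homog g y -> homog g (f' y).
Proof.
move=> fD fH fK f'K hy; suff -> : f' y = gproj g (f' y) by exact: gproj_homog.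
by rewrite -[RHS]fK -gproj_hom // f'K homog_gproj.
Qed.

Lemma gr_mod_iso_sym (R : gradedRing G) (M N : gradedModule R) :
  gr_mod_iso M N -> gr_mod_iso N M.
Proof.
move=> [f [[f' fK f'K] fD fa fH]]; exists f'; split; first by exists f.
- by move=> x y; apply: (can_inj fK); rewrite fD !f'K.
- by move=> x a; apply: (can_inj fK); rewrite fa !f'K.
- by move=> g x; exact: inv_homog fK f'K.
Qed.

Lemma gr_ring_iso_sym (R S : gradedRing G) : gr_ring_iso R S -> gr_ring_iso S R.
Proof.
move=> [f [[f' fK f'K] fD fM fH]]; exists f'; split; first by exists f.
- by move=> x y; apply: (can_inj fK); rewrite fD !f'K.
- by move=> x y; apply: (can_inj fK); rewrite fM !f'K.
- by move=> g x; exact: inv_homog fK f'K.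
Qed.

Lemma gr_simple_iso (R : gradedRing G) (M N : gradedModule R) :
  gr_mod_iso M N -> gr_simple_mod M -> gr_simple_mod N.
Proof.
move=> [f [[f' fK f'K] fD fa fH]] [[x nx] sM]; split.
  exists (f x); apply: contraNneq nx => fx0.
  by apply/eqP/(can_inj fK); rewrite fx0 (morph0 fD).
move=> K [[K0 KB KM] Kp]; pose K' : set M := [set x | K (f x)].
have [] := sM K'.
- split; first split.
  + by rewrite /K' /= (morph0 fD).
  + by move=> y z Ky Kz; rewrite /K' /= (morphB fD); exact: KB.
  + by move=> y a Ky; rewrite /K' /= fa; exact: KM.
  + by move=> g y Ky; rewrite /K' /= -gproj_hom //; exact: Kp.
- move=> E; left; apply/seteqP; split => [y Ky|y ->//].
  have : K' (f' y) by rewrite /K' /= f'K.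
  by rewrite E => /= e0; rewrite /= -[y]f'K e0 (morph0 fD).
- move=> E; right; apply/seteqP; split => // y _.
  have : K' (f' y) by rewrite E.
  by rewrite /K' /= f'K.
Qed.

Lemma ring_iso_one (R S : gradedRing G) (f : R -> S) e :
  bijective f -> {morph f : x y / x + y} -> {morph f : x y / rmul x y} ->
  (forall g x, homog g x -> homog g (f x)) -> f (gone R e) = gone S e.
Proof.
move=> [f' fK f'K] fD fM fH.
have h := fH _ _ (gone_homog R e).
rewrite -[LHS](gone_mul_id h) -{1}[gone S e]f'K -fM mul_gone_id ?f'K //.
exact: inv_homog fK f'K (gone_homog S e).
Qed.

Lemma pivot_iso (R S : gradedRing G) e : gr_ring_iso R S -> pivot R e -> pivot S e.
Proof.
move=> [f [fb fD fM fH]] [n1 pe]; have f1 := ring_iso_one e fb fD fM fH.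
have [f' fK f'K] := fb; split.
  by rewrite -f1 => E; apply: n1; apply: (can_inj fK); rewrite E (morph0 fD).
move=> g a ha rg na.
have [|b hb ab] := pe g (f' a) (inv_homog fD fH fK f'K ha) rg.
  by move=> E; apply: na; rewrite -[a]f'K E (morph0 fD).
by exists (f b); [exact: fH|rewrite -f1 -ab fM f'K].
Qed.

Lemma generates_iso (R S : gradedRing G) Delta :
  gr_ring_iso R S -> generates R Delta -> generates S Delta.
Proof.
move=> [f [fb fD fM fH]] gen I [I0 IB IM Ip] ID.
pose K : set R := [set x | I (f x)].
have /seteqP[_ KT] : K = setT.
  apply: gen => [|e De]; last by rewrite /K /= ring_iso_one //; exact: ID.
  split.
  - by rewrite /K /= (morph0 fD).
  - by move=> y z Ky Kz; rewrite /K /= (morphB fD); exact: IB.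
  - by move=> y a Ky; rewrite /K /= !fM; exact: IM.
  - by move=> g y Ky; rewrite /K /= -gproj_hom //; exact: Ip.
apply/seteqP; split => // y _; have [f' fK f'K] := fb.
by rewrite -[y]f'K; exact: KT.
Qed.

End Iso.

(** * Direct sums of shifts of the right ideals of objects *)

Section ShiftSum.
Variables (G : groupoid) (R : gradedRing G) (I : Type).
Variables (e : I -> gobj G) (s : I -> G).
Let L i := gshift (ring_at R (e i)) (s i).

(** Three nested subtypes are stripped: direct sum, shift, and [1_e R]. *)
Definition coef (y : dsum L) (i : I) : R :=
  subgrp_val (subgrp_val (subgrp_val y i)).

Lemma coef_ext (y z : dsum L) : (forall i, coef y i = coef z i) -> y = z.
Proof.
move=> H; apply: subgrp_inj; apply: functional_extensionality_dep => i.
by apply: subgrp_inj; apply: subgrp_inj; exact: H.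
Qed.

Lemma coefD i : {morph coef^~ i : y z / y + z}. Proof. by []. Qed.

Lemma coef_act (y : dsum L) a i : coef (mact y a) i = rmul (coef y i) a.
Proof. by []. Qed.

Lemma coef_supp (y : dsum L) i : coef y i != 0 -> subgrp_val y i != 0.
Proof. by move=> n; apply: contraNneq n => E; rewrite /coef E. Qed.

Lemma gone_coef (y : dsum L) i : rmul (gone R (e i)) (coef y i) = coef y i.
Proof. exact: ring_at_gone. Qed.

Lemma coef_rng (y : dsum L) i : coef y i != 0 -> grng (s i) = e i.
Proof.
move/eqP/gproj_neq0 => [g ng].
have <- : grng g = e i.
  by apply: (@at_rng _ _ (regular_module R) _ (subgrp_val (subgrp_val y i))).
symmetry; apply: (subgrpP (subgrp_val y i)).
apply: contraNneq ng; rewrite -[coef y i]/(subgrp_val _).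
by rewrite -(@at_gproj _ _ (regular_module R)) => ->.
Qed.

Lemma coef_homog g (y : dsum L) i :
  homog g y -> ohomog (gcomp (s i) g) (coef y i).
Proof.
move=> /dsum_homog/(_ i)/shift_homog; case: gcomp => [k|] /=.
  exact: (@at_homog _ _ (regular_module R)).
by rewrite /coef => ->.
Qed.

Lemma shift_one_in i : sg_set (gshift_subgroup (ring_at R (e i)) (s i))
  (to_at (e i) (if grng (s i) == e i then gone R (e i) else 0)).
Proof.
move=> h; rewrite -(inj_eq (@subgrp_inj _ _)) (@at_gproj _ _ (regular_module R)) /=.
case: (eqVneq (grng (s i)) (e i)) => [<-|_]; last by rewrite rmul0 gproj0 eqxx.
rewrite gproj_gone_mul; case: (eqVneq (grng h) (grng (s i))) => // _.
by rewrite eqxx.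
Qed.

(** The unit is placed only in summands with [r(s j) = e j]: the others are
    zero, as no product [s j g] is then a degree of [R(e j)]. *)
Definition sum_one_fun (i : I) : dprod L :=
  fun j => if `[< j = i >] then mk_subgrp (@shift_one_in j) else 0.

Lemma sum_one_in i : sg_set (dsum_subgroup L) (sum_one_fun i).
Proof.
apply: (sub_finite_set (B := [set i])); last exact: finite_set1.
by move=> j /=; rewrite /sum_one_fun; case: asboolP => // _; rewrite eqxx.
Qed.

Definition sum_one i : dsum L := mk_subgrp (sum_one_in i).

Lemma coef_one i j : coef (sum_one i) j =
  if `[< j = i >] && (grng (s j) == e j) then gone R (e j) else 0.
Proof.
rewrite /coef /= /sum_one_fun; case: asboolP => //= _.
by case: eqP => _; [exact: gone_idem|exact: rmul0].
Qed.

Lemma sum_one_expand (t : seq {classic I}) (y : dsum L) : uniq t ->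
  (forall i, coef y i != 0 -> (i : {classic I}) \in t) ->
  y = \sum_(i <- t) mact (sum_one i) (coef y i).
Proof.
move=> ut ht; apply: coef_ext => j; rewrite (morph_sum (coefD j)).
have H (i : {classic I}) : coef (mact (sum_one i) (coef y i)) j =
    if i == (j : {classic I}) then coef y j else 0.
  rewrite coef_act coef_one; case: asboolP => [<-|n] /=.
    rewrite eqxx; case: eqP => [_|n]; first exact: gone_coef.
    rewrite mul0; apply/esym/eqP/negPn/negP => /coef_rng; exact: n.
  by rewrite mul0; case: eqP => // ij; case: n.
rewrite (eq_bigr _ (fun i _ => H i)); case jt: ((j : {classic I}) \in t).
  by rewrite (bigD1_seq (j : {classic I})) //= eqxx big1 ?addr0 // => i /negPf ->.
have -> : coef y j = 0 by apply/eqP/negPn/negP => /ht; rewrite jt.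
by rewrite big1 // => i _; case: ifP.
Qed.

Lemma coef_seq (y : dsum L) : exists2 t : seq {classic I}, uniq t &
  forall i, coef y i != 0 -> (i : {classic I}) \in t.
Proof.
have [t ut ht] := @finite_uniq {classic I} _ (subgrpP y).
by exists t => // i /coef_supp; exact: ht.
Qed.

(** The preimage [u] of the generator of a summand satisfies [u = u 1_{e i}], so
    it lies in any ideal containing the units of the [e i]; and each local unit
    is a finite combination of such preimages with coefficients on the right. *)
Lemma shift_sum_generates :
  gr_mod_iso (regular_module R) (dsum L) -> generates R (range e).
Proof.
move=> [f [[f' fK f'K] fD fa fH]] K gK Ke; apply: (ideal_full gK) => o.
have f'a y a : f' (mact y a) = rmul (f' y) a.
  by apply: (can_inj fK); rewrite [RHS]fa !f'K.
have f'D : {morph f' : y z / y + z}.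
  by move=> y z; apply: (can_inj fK); rewrite fD !f'K.
have [t ut ht] := coef_seq (f (gone R o)).
have [sK _] := ideal_submodule gK; have [_ _ KM _] := gK.
rewrite -[gone R o]fK (sum_one_expand ut ht) (morph_sum f'D).
apply: (submodule_sum sK) => i _; rewrite f'a.
suff : K (f' (sum_one i)) by move/KM=> H; have [] := H (coef (f (gone R o)) i).
suff -> : sum_one i = mact (sum_one i) (gone R (e i)).
  by rewrite f'a; have [] := KM _ (f' (sum_one i)) (Ke (e i) (imageT e i)).
apply: coef_ext => j; rewrite coef_act coef_one.
case: asboolP => [->|_] /=; last by rewrite mul0.
by case: ifP => _; rewrite ?gone_idem ?mul0.
Qed.

End ShiftSum.

Section BasisIso.
Variables (G : groupoid) (R : gradedRing G) (M : gradedModule R).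
Variables (I : choiceType) (c : I -> G) (x : I -> M).
Hypothesis bx : pseudo_basis c x.
Let L i := gshift (ring_at R (gdom (c i))) (ginv (c i)).

Let comb (y : dsum L) : M := \sum_(i \in [set: I]) mact (x i) (coef y i).

Let combE (y : dsum L) (t : seq I) : uniq t ->
  (forall i, subgrp_val y i != 0 -> i \in t) ->
  comb y = \sum_(i <- t) mact (x i) (coef y i).
Proof.
move=> ut ht; apply: fsum_seq => // i ni.
apply/ht/(@coef_supp _ _ _ (fun i => gdom (c i)) (fun i => ginv (c i))).
by apply: contraNneq ni => ->; rewrite mact0.
Qed.

Let seq2 (y z : dsum L) : exists2 t : seq I, uniq t &
  (forall i, subgrp_val y i != 0 -> i \in t) /\
  (forall i, subgrp_val z i != 0 -> i \in t).
Proof.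
have [t ut ht] := finite_uniq (subgrpP y); have [u _ hu] := finite_uniq (subgrpP z).
exists (undup (t ++ u)); first exact: undup_uniq.
by split=> i ni; rewrite mem_undup mem_cat; [rewrite ht|rewrite hu ?orbT].
Qed.

Let combD : {morph comb : y z / y + z}.
Proof.
move=> y z; have [t ut [ty tz]] := seq2 y z.
rewrite !(@combE _ t) // => [|i].
  by rewrite -big_split /=; apply: eq_bigr => i _; rewrite -mactDr.
rewrite -[subgrp_val (y + z) i]/(subgrp_val y i + subgrp_val z i).
case: (eqVneq (subgrp_val y i) 0) => [->|/ty//]; rewrite add0r; exact: tz.
Qed.

Let comb_act y a : comb (mact y a) = mact (comb y) a.
Proof.
have [t ut [ty _]] := seq2 y y.
rewrite !(@combE _ t) //; last first.
  move=> i ni; apply: ty; apply: contraNneq ni.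
  by rewrite -[subgrp_val (mact y a) i]/(mact (subgrp_val y i) a) => ->; rewrite mact0l.
by rewrite mact_bigl; apply: eq_bigr => i _; rewrite coef_act mactA.
Qed.

Let comb_homog g y : homog g y -> homog g (comb y).
Proof.
move=> hy; have [t ut [ty _]] := seq2 y y; rewrite (combE ut ty).
apply: (ohomog_sum (o := Some g)) => i.
have [hx _ _] := bx; have := coef_homog i hy.
case E: gcomp => [h|] /= H; last by rewrite H mact0; exact: homog0.
exact: homog_act (hx i).1 H (gcompKVl E).
Qed.

(** The map sends a family of coefficients to the combination of the [x i]; the
    shift by the inverse of [c i] is what makes it preserve degrees. *)
Lemma basis_iso : gr_mod_iso M (dsum L).
Proof.
apply: gr_mod_iso_sym; exists comb; split=> //; have [hx gen ind] := bx.
have c0 := morph0 combD.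
apply: inj_surj_bij => [y z yz|m].
  apply/eqP; rewrite -subr_eq0; apply/eqP; apply: coef_ext.
  apply: ind => [i||].
  - exists (coef (y - z) i); apply/esym.
    exact: (@gone_coef _ _ _ (fun i => gdom (c i)) (fun i => ginv (c i))).
  - apply: (sub_finite_set _ (subgrpP (y - z))) => i.
    exact: (@coef_supp _ _ _ (fun i => gdom (c i)) (fun i => ginv (c i))).
  - by rewrite -[LHS]/(comb (y - z)) (morphB combD) yz subrr.
suff /seteqP[_ /(_ m)] : [set m | exists y, comb y = m] = setT by apply.
apply: gen => [|i].
  split.
  - by exists 0.
  - by move=> _ _ [y <-] [z <-]; exists (y - z); exact: morphB combD _ _.
  - by move=> _ a [y <-]; exists (mact y a).
exists (sum_one R (fun i => gdom (c i)) (fun i => ginv (c i)) i).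
rewrite (@combE _ [:: i]) //.
  rewrite big_seq1 coef_one; case: asboolP => //= _.
  by rewrite grng_inv eqxx mact_gone //; exact: (hx i).1.
move=> j; rewrite inE /= /sum_one_fun; case: asboolP => [->|_]; rewrite eqxx //.
Qed.

End BasisIso.

(** * The part of the sum of the right ideals of a set of objects at an object *)

Section ObjSum.
Variables (G : groupoid) (R : gradedRing G) (Delta : set (gobj G)).
Let S := ring_at_set R Delta.
Let dsum_gproj := @dsum_gproj G R Delta (fun e : Delta => ring_at R (val e)).

Lemma ring_at_set_rng e (x : at_obj S e) (d : Delta) :
  subgrp_val (subgrp_val x) d != 0 -> val d = e.
Proof.
move/eqP/gproj_neq0 => [g]; rewrite -dsum_gproj => ng.
rewrite -(@at_rng _ _ S _ x g).
  symmetry; apply: (@at_rng _ _ (regular_module R) _ (subgrp_val (subgrp_val x) d)).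
  rewrite -(@at_gproj _ _ (regular_module R)); apply: contraNneq ng => E.
  by rewrite dsum_gproj; apply/eqP/subgrp_inj.
by apply: contraNneq ng => ->.
Qed.

(** Only the summand of [d] has elements ending at [d]. *)
Lemma at_set_iso (d : Delta) : gr_mod_iso (at_obj S (val d)) (ring_at R (val d)).
Proof.
exists (fun x : at_obj S (val d) => subgrp_val (subgrp_val x) d : ring_at R (val d)).
split.
- apply: inj_surj_bij => [x y xy|z].
    apply: subgrp_inj; apply: subgrp_inj.
    apply: functional_extensionality_dep => d'.
    case: (eqVneq (val d') (val d)) => [/val_inj ->//|n].
    have off (w : at_obj S (val d)) : subgrp_val (subgrp_val w) d' = 0.
      by apply/eqP/negPn/negP => /ring_at_set_rng E; rewrite E eqxx in n.
    by rewrite !off.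
  pose w : dprod (fun d : Delta => ring_at R (val d)) :=
    fun d' => if d' == d then to_at (val d') (subgrp_val z) else 0.
  have sw : sg_set (dsum_subgroup (fun d : Delta => ring_at R (val d))) w.
    apply: (sub_finite_set (B := [set d])); last exact: finite_set1.
    by move=> d' /=; rewrite /w; case: (eqVneq d' d) => // _; rewrite eqxx.
  pose w1 : S := mk_subgrp sw.
  have sw1 : sg_set (gshift_subgroup S (gid (val d))) w1.
    move=> h nh; rewrite grng_id; apply: contrapT => rh; case/eqP: nh.
    apply: subgrp_inj; apply: functional_extensionality_dep => d'.
    rewrite dsum_gproj /= /w; case: eqP => [->|_]; last by rewrite gproj0.
    apply: subgrp_inj; rewrite (@at_gproj _ _ (regular_module R)) /=.
    by rewrite gproj_gone_mul; case: eqP.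
  exists (mk_subgrp sw1); apply: subgrp_inj => /=.
  by rewrite /w eqxx /= ring_at_gone.
- by [].
- by [].
- by move=> g x /at_homog /dsum_homog; apply.
Qed.

Lemma obj_simple_pivot : Delta `<=` nonzero_objects R ->
  obj_simple S <-> Delta `<=` pivot R.
Proof.
move=> nz; split=> [simp f Df|piv e [x /eqP nx]].
  pose d : Delta := exist _ f (mem_set Df).
  have iso : gr_mod_iso (at_obj S f) (ring_at R f) := at_set_iso d.
  apply/pivotP; apply: (gr_simple_iso iso); apply: simp.
  have [h [[h' hK h'K] hD _ _]] := iso.
  exists (h' (to_at f (gone R f))); apply/eqP => E.
  have /eqP := nz f Df; apply; rewrite -gone_idem.
  have := congr1 h E; rewrite h'K (morph0 hD) => /(congr1 (@subgrp_val _ _)).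
  by [].
have [d nd] : exists d : Delta, subgrp_val (subgrp_val x) d != 0.
  apply: contrapT => H; apply: nx; apply: subgrp_inj; apply: subgrp_inj.
  apply: functional_extensionality_dep => d; apply/eqP/negPn/negP => n.
  by apply: H; exists d.
have <- := ring_at_set_rng nd.
apply: (gr_simple_iso (gr_mod_iso_sym (at_set_iso d))).
by apply/pivotP/piv; exact: set_mem (valP d).
Qed.

End ObjSum.

(** * Graded products of gr-simple rings *)

Lemma ring_at_neq0 (G : groupoid) (R : gradedRing G) e : nonzero_gz (ring_at R e) <-> gone R e <> 0.
Proof.
split=> [[x /eqP nx] e0|ne]; last first.
  exists (to_at e (gone R e)); apply/eqP => /(congr1 (@subgrp_val _ _)) /=.
  by rewrite gone_idem; exact: ne.
by apply: nx; apply: subgrp_inj; rewrite -ring_at_gone e0; exact: mul0.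
Qed.

Section Embedding.
Variables (G : groupoid) (J : Type) (R : J -> gradedRing G).

(** The inclusion of a factor; the cast is only ever evaluated at a reflexive
    equality. *)
Definition gembed_fun j (a : R j) : dprod R := fun k =>
  if pselect (j = k) is left E then ecast k (R k) E a else 0.

Lemma gembed_fun_id j (a : R j) : gembed_fun a j = a.
Proof.
by rewrite /gembed_fun; case: pselect => // E; rewrite (Prop_irrelevance E erefl).
Qed.

Lemma gembed_fun_neq j k (a : R j) : j <> k -> gembed_fun a k = 0.
Proof. by rewrite /gembed_fun; case: pselect. Qed.

Lemma gembed_in j (a : R j) : sg_set (gprod_subgroup R) (gembed_fun a).
Proof.
apply: (sub_finite_set _ (gproj_finite a)) => g [k].
case: (pselect (j = k)) => [<-|n]; first by rewrite gembed_fun_id.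
by rewrite gembed_fun_neq // gproj0 eqxx.
Qed.

Definition gembed j (a : R j) : gprod R := mk_subgrp (gembed_in a).

Lemma gembed_id j (a : R j) : subgrp_val (gembed a) j = a.
Proof. exact: gembed_fun_id. Qed.

Lemma gembed_neq j k (a : R j) : j <> k -> subgrp_val (gembed a) k = 0.
Proof. exact: gembed_fun_neq. Qed.

Lemma gembed_eq j (a : R j) (x : gprod R) :
  subgrp_val x j = a -> (forall k, j <> k -> subgrp_val x k = 0) -> gembed a = x.
Proof.
move=> xj xk; apply: gprod_ext => k.
case: (pselect (j = k)) => [<-|n]; first by rewrite gembed_id.
by rewrite gembed_neq // xk.
Qed.

Lemma gembed0 j : gembed (0 : R j) = 0. Proof. exact: gembed_eq. Qed.

Lemma gembedB j (a b : R j) : gembed (a - b) = gembed a - gembed b.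
Proof.
apply: gembed_eq => [|k n]; rewrite subgrp_valB.
  by rewrite -[LHS]/(subgrp_val (gembed a) j - subgrp_val (gembed b) j) !gembed_id.
rewrite -[LHS]/(subgrp_val (gembed a) k - subgrp_val (gembed b) k).
by rewrite !gembed_neq // subrr.
Qed.

Lemma gembed_mulr j (a : R j) (x : gprod R) :
  gembed (rmul a (subgrp_val x j)) = rmul (gembed a) x.
Proof.
apply: gembed_eq => [|k n] /=; first by rewrite gembed_fun_id.
by rewrite gembed_fun_neq // mul0.
Qed.

Lemma gembed_mull j (a : R j) (x : gprod R) :
  gembed (rmul (subgrp_val x j) a) = rmul x (gembed a).
Proof.
apply: gembed_eq => [|k n] /=; first by rewrite gembed_fun_id.
by rewrite gembed_fun_neq // rmul0.
Qed.

Lemma gprod_homog g (x : gprod R) :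
  homog g x <-> forall j, homog g (subgrp_val x j).
Proof. by split. Qed.

Lemma gembed_homog g j (a : R j) : homog g a -> homog g (gembed a).
Proof.
move=> ha; apply/gprod_homog => k; case: (pselect (j = k)) => [<-|n].
  by rewrite gembed_id.
by rewrite gembed_neq //; exact: homog0.
Qed.

Lemma gembed_gproj g j (a : R j) : gproj g (gembed a) = gembed (gproj g a).
Proof.
apply/esym/gembed_eq => [|k n]; rewrite gprod_gproj ?gembed_id //.
by rewrite gembed_neq // gproj0.
Qed.

Lemma summable_expand (x : gprod R) : gr_summable R ->
  exists t : seq {classic J}, x = \sum_(j <- t) gembed (subgrp_val x j).
Proof.
move=> sm; have [t ut ht] := @finite_uniq {classic J} _ (sm x).
exists t; apply: gprod_ext => k.
have add : {morph (fun y : gprod R => subgrp_val y k) : y z / y + z} by [].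
rewrite (morph_sum add) (eq_bigr (fun j : {classic J} =>
  if j == (k : {classic J}) then subgrp_val x k else 0)); last first.
  move=> j _; case: eqP => [->|n]; [exact: gembed_id|exact: gembed_neq].
case kt: ((k : {classic J}) \in t).
  by rewrite (bigD1_seq (k : {classic J})) //= eqxx big1 ?addr0 // => j /negPf ->.
have -> : subgrp_val x k = 0 by apply/eqP/negPn/negP => /ht; rewrite kt.
by rewrite big1 // => j _; case: ifP.
Qed.

(** Each ideal of the product restricts to an ideal of every factor, where it
    contains a nonzero local unit, hence everything. *)
Lemma product_generates (f : J -> gobj G) : gr_summable R ->
  (forall j, gr_simple_ring (R j)) -> (forall j, gone (R j) (f j) <> 0) ->
  generates (gprod R) (range f).
Proof.
move=> sm simp n1 I gI If; have [I0 IB IM Ip] := gI.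
have full j (a : R j) : I (gembed a).
  pose K : set (R j) := [set a | I (gembed a)].
  have gK : gr_ideal K.
    split.
    - by rewrite /K /= gembed0.
    - by move=> x y Kx Ky; rewrite /K /= gembedB; exact: IB.
    - move=> x b Kx; rewrite /K /= -[b]gembed_id gembed_mulr gembed_mull.
      exact: IM.
    - by move=> g x Kx; rewrite /K /= -gembed_gproj; exact: Ip.
  have K1 : K (gone (R j) (f j)).
    rewrite /K /= -gone_idem.
    rewrite -[X in rmul X _]/(subgrp_val (gone (gprod R) (f j)) j) gembed_mull.
    by apply: (IM _ _ _).1; apply: If; exists j.
  by case: ((simp j).2 K gK) => E;
    [case: (n1 j); move: K1|rewrite -[I _]/(K a)]; rewrite E.
apply/seteqP; split => // x _; have [t ->] := summable_expand x sm.
by apply: (submodule_sum (ideal_submodule gI).1).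
Qed.

Section OneFactor.
Variables (j : J) (e : gobj G).
Hypothesis off : forall k, j <> k -> gone (R k) e = 0.

(** As [a = 1_e a], it vanishes in the factors where [1_e] does; this lets
    pivots and division rings pass between the product and one factor. *)
Lemma product_off g (a : gprod R) k :
  homog g a -> grng g = e -> j <> k -> subgrp_val a k = 0.
Proof.
move=> /gprod_homog/(_ k)/gone_mul <- -> /off ->; exact: mul0.
Qed.

Lemma product_pivot : pivot (R j) e -> pivot (gprod R) e.
Proof.
move=> [n1 pe]; split.
  by move/(congr1 (fun x : gprod R => subgrp_val x j)).
move=> g a ha rg na.
have [|b hb ab] := pe g (subgrp_val a j) (proj1 (gprod_homog g a) ha j) rg.
  move=> aj; apply: na; apply: gprod_ext => k.
  case: (pselect (j = k)) => [<-//|n]; exact: product_off ha rg n.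
exists (gembed b); first exact: gembed_homog.
rewrite -gembed_mull ab; apply: gembed_eq => //.
Qed.

Lemma product_division : division_at (gprod R) e -> division_at (R j) e.
Proof.
move=> [n1 de]; split.
  move=> e0; apply: n1; apply: gprod_ext => k.
  by case: (pselect (j = k)) => [<-//|n]; exact: off.
move=> a ha na; have [|b [hb ab ba]] := de (gembed a) (gembed_homog ha).
  by move/(congr1 (fun x : gprod R => subgrp_val x j)); rewrite gembed_id.
exists (subgrp_val b j); split; first exact: hb.
  by have := congr1 (fun x : gprod R => subgrp_val x j) ab; rewrite /= gembed_fun_id.
by have := congr1 (fun x : gprod R => subgrp_val x j) ba; rewrite /= gembed_fun_id.
Qed.

End OneFactor.

End Embedding.

Lemma division_iso (G : groupoid) (R S : gradedRing G) e :
  gr_ring_iso R S -> division_at R e -> division_at S e.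
Proof.
move=> [f [fb fD fM fH]] [n1 de]; have f1 := ring_iso_one e fb fD fM fH.
have [f' fK f'K] := fb; split.
  by rewrite -f1 => E; apply: n1; apply: (can_inj fK); rewrite E (morph0 fD).
move=> a ha na.
have [|b [hb ab ba]] := de (f' a) (inv_homog fD fH fK f'K ha).
  by move=> E; apply: na; rewrite -[a]f'K E (morph0 fD).
by exists (f b); split; [exact: fH|rewrite -f1 -ab fM f'K|rewrite -f1 -ba fM f'K].
Qed.

Lemma pivot_division (G : groupoid) (R : gradedRing G) e :
  pivot R e -> division_at R e.
Proof.
move=> [n1 pe]; split=> // a ha na.
have [b hb ab] := pe _ a ha (grng_id e) na.
rewrite ginv_id in hb.
have nb : b <> 0 by move=> b0; apply: n1; rewrite -ab b0 rmul0.
have [c hc bc] := pe _ b hb (grng_id e) nb.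
rewrite ginv_id in hc.
exists b; split=> //; suff -> : a = c by [].
by rewrite -(mul_gone_id ha) -bc rmulA ab (gone_mul_id hc).
Qed.

(** * Artinian gr-simple rings *)

Section Artinian.
Variables (G : groupoid) (R : gradedRing G) (f : gobj G).
Hypothesis sR : gr_simple_ring R.
Hypothesis aR : obj_artinian R.
Hypothesis dR : division_at R f.

(** Otherwise dependent choice produces a strictly descending chain of
    principal right ideals. *)
Lemma minimal_right_ideal : exists g (x : R), [/\ homog g x, grng g = f, x <> 0 &
  forall k v, homog k (rmul x v) -> rmul x v <> 0 -> exists c, rmul (rmul x v) c = x].
Proof.
pose good (x : R) := exists g, [/\ homog g x, grng g = f & x <> 0].
apply: contrapT => H.
have step (x : {x | good x}) : exists y : {x | good x},
    (exists v, sval y = rmul (sval x) v) /\ forall c, rmul (sval y) c <> sval x.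
  case: x => x [g [hx rg nx]] /=; apply: contrapT => Hx; apply: H.
  exists g, x; split => // k v hk nv; apply: contrapT => Hc; apply: Hx.
  have gk : good (rmul x v).
    exists k; split => //; apply: contrapT => rk; apply: nv.
    rewrite -(homog_gproj hk); apply: (@gproj_act_rng _ _ (regular_module R) g) => //.
    by rewrite rg.
  exists (exist _ _ gk); split => /= [|c E]; first by exists v.
  by apply: Hc; exists c.
have [F HF] := boolp.choice step.
have g1 : good (gone R f).
  by exists (gid f); split; [exact: gone_homog|rewrite grng_id|case: dR].
pose x n := sval (iter n F (exist _ _ g1)).
pose N n : set (ring_at R f) := [set z | exists c, subgrp_val z = rmul (x n) c].
have [|n z [c zc]|n0 /(_ n0.+1 (leqnSn _)) E] := @aR f N.
- move=> n; have [g [hx _ _]] := svalP (iter n F (exist _ _ g1)).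
  exact: principal_submodule hx.
- have [[v Ev] _] := HF (iter n F (exist _ _ g1)).
  by exists (rmul v c); rewrite rmulA -Ev.
have [_ ne] := HF (iter n0 F (exist _ _ g1)).
have [g [hx rg _]] := svalP (iter n0 F (exist _ _ g1)).
have fx : rmul (gone R f) (x n0) = x n0 by rewrite (gone_mulE _ hx) rg eqxx.
have : N n0 (to_at f (x n0)) by exists (gone R (gdom g)); rewrite (mul_gone hx).
by rewrite -E => -[c]; rewrite [LHS]fx => /esym; exact: ne.
Qed.

(** A minimal graded right ideal [xR] inside [1_f R] is mapped onto [1_f R] by
    a left multiplication, because the ideal generated by [x] reaches the
    division ring [R_f]; so [1_f R] is itself minimal. *)
Lemma artinian_pivot : pivot R f.
Proof.
have [g [x [hx rg nx min]]] := minimal_right_ideal; have [n1 df] := dR.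
split => // h a ha rh na.
pose I : set R := [set r | forall u v, gproj (gid f) (rmul (rmul u r) v) = 0].
have sI : submodule (M := regular_module R) I.
  split=> [u v|y z Iy Iz u v|y b Iy u v] /=.
  - by rewrite rmul0 mul0 gproj0.
  - by rewrite rmulBr rmulBl gproj_B Iy Iz subrr.
  - by rewrite (rmulA u) -rmulA; exact: Iy.
have gI : gr_ideal (core I).
  by apply: core_ideal => // y b Iy u v; rewrite (rmulA u); exact: Iy.
have [u [v nuv]] : exists u v, gproj (gid f) (rmul (rmul u x) v) <> 0.
  apply: contrapT => H.
  have cx : core I x.
    apply: core_homog hx _; first by case: sI.
    by move=> u v; apply: contrapT => n; apply: H; exists u, v.
  case: (sR.2 _ gI) => E; first by move: cx; rewrite E.
  have : core I (gone R f) by rewrite E.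
  move/(core_sub sI)/(_ (gone R f) (gone R f)); rewrite !gone_idem.
  by rewrite (homog_gproj (gone_homog R f)).
have [p np] : exists p, gproj (gid f) (rmul (gproj p u) (rmul x v)) <> 0.
  apply: contrapT => H; apply: nuv; have [t _ ->] := gproj_seq u.
  rewrite -rmulA rmul_bigl gproj_big big1 // => p _; apply: contrapT => n.
  by apply: H; exists p.
set w := gproj p u in np; have hw : homog p w := gproj_homog p u.
have rp : grng p = f.
  apply: contrapT => n; apply: np.
  by apply: (@gproj_act_rng _ _ (regular_module R) p) => //; rewrite grng_id => /esym.
have Ep : gproj (gid f) (rmul w (rmul x v)) = rmul w (gproj (ginv p) (rmul x v)).
  by rewrite -rp; exact: gproj_mull hw (gcompgV p).
have [v1 Ev1] := gproj_principal (ginv p) v hx.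
have [|d [_ td _]] := df _ _ np; first exact: gproj_homog.
rewrite Ep Ev1 in td.
have [h' Eh'] := @gcompP _ (ginv p) h ltac:(by rewrite gdom_inv rp).
have ae : a = rmul w (rmul x (rmul v1 (rmul d a))).
  by rewrite !rmulA -(rmulA w x) td -rh (gone_mul ha).
have [v2 Ev2] := gproj_principal h' (rmul v1 (rmul d a)) hx.
have aw : a = rmul w (rmul x v2).
  by rewrite -Ev2 -(gproj_mull _ hw (gcompKVl Eh')) -ae homog_gproj.
have [||c Ec] := min h' v2.
- by rewrite -Ev2; exact: gproj_homog.
- by move=> E; apply: na; rewrite aw E rmul0.
rewrite -rh; apply: (homog_right_inverse (c := rmul c (rmul v1 d))) ha _.
by rewrite aw rmulA -(rmulA w) Ec rh -td !rmulA.
Qed.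

End Artinian.

(** * Dual frames of local units *)

Section Frame.
Variables (G : groupoid) (R : gradedRing G) (Delta : set (gobj G)).
Hypothesis pD : pivotal R Delta.
Implicit Types (p q : G * (R * R)) (s : seq (G * (R * R))).

(** A member [(g, (x, y))] stands for a column [x] of degree [g] and the dual
    row [y] of degree the inverse of [g]. *)
Definition frame_member e p :=
  [/\ homog p.1 p.2.1, homog (ginv p.1) p.2.2, grng p.1 = e, Delta (gdom p.1)
    & rmul p.2.2 p.2.1 = gone R (gdom p.1)].

Definition dual_frame e s :=
  [/\ uniq s, forall p, p \in s -> frame_member e p
    & forall p q, p \in s -> q \in s -> p != q -> rmul p.2.2 q.2.1 = 0].

Definition frame_proj s : R := \sum_(p <- s) rmul p.2.1 p.2.2.

Lemma frame_proj_col e s q : dual_frame e s -> q \in s ->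
  rmul (frame_proj s) q.2.1 = q.2.1.
Proof.
move=> [us fs os] qs; rewrite rmul_bigl (bigD1_seq q) //=.
have [hx _ _ _ yx] := fs q qs; rewrite -rmulA yx (mul_gone hx).
rewrite big_seq_cond big1 ?addr0 // => p /andP[ps pq].
by rewrite -rmulA os // rmul0.
Qed.

Lemma frame_proj_row e s q : dual_frame e s -> q \in s ->
  rmul q.2.2 (frame_proj s) = q.2.2.
Proof.
move=> [us fs os] qs; rewrite rmul_bigr (bigD1_seq q) //=.
have [_ hy _ _ yx] := fs q qs; rewrite rmulA yx -[gdom _]grng_inv (gone_mul hy).
rewrite big_seq_cond big1 ?addr0 // => p /andP[ps pq].
by rewrite rmulA os ?mul0 // eq_sym.
Qed.

Lemma frame_proj_sub e s s' : dual_frame e s -> dual_frame e s' ->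
  {subset s <= s'} -> rmul (frame_proj s') (frame_proj s) = frame_proj s.
Proof.
move=> os os' ss; rewrite {2}/frame_proj rmul_bigr.
rewrite [LHS]big_seq [RHS]big_seq; apply: eq_bigr => p ps.
by rewrite rmulA (frame_proj_col os') // ss.
Qed.

Lemma frame_proj_homog e s : dual_frame e s -> homog (gid e) (frame_proj s).
Proof.
move=> [_ fs _]; rewrite /frame_proj big_seq.
elim/big_ind: _ => [|x y|p /fs[hx hy re _ _]]; [exact: homog0|exact: homogD|].
by rewrite -re; exact: homogMV.
Qed.

(** One Gram-Schmidt step: the part of [z] outside the frame is a new column,
    and a left inverse of it, made orthogonal to the frame, is its row. *)
Lemma dual_frame_extend e s g z : dual_frame e s -> homog g z ->
  grng g = e -> Delta (gdom g) ->
  exists s', [/\ dual_frame e s', {subset s <= s'} & rmul (frame_proj s') z = z].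
Proof.
move=> os hz rg Dg; have [us fs orth] := os.
have hP := frame_proj_homog os.
have PP := frame_proj_sub os os (fun p ps => ps).
set P := frame_proj s in hP PP; pose a := z - rmul P z.
have ha : homog g a.
  apply: homogB => //; apply: homogM hP hz _.
  by rewrite -rg gcomp1g.
have Pa : rmul P a = 0 by rewrite rmulBr rmulA PP subrr.
case: (pselect (a = 0)) => [a0|na].
  by exists s; split=> //; apply/esym/eqP; rewrite -subr_eq0; apply/eqP.
have [y' hy' ya'] := pivotal_left_inverse pD ha Dg na.
pose y := y' - rmul y' P; pose p0 : G * (R * R) := (g, (a, y)).
have hy : homog (ginv g) y.
  apply: homogB => //; apply: homogM hy' hP _.
  by rewrite -rg -gdom_inv gcompg1.
have ya : rmul y a = gone R (gdom g) by rewrite rmulBl -rmulA Pa rmul0 subr0.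
have yP : rmul y P = 0 by rewrite rmulBl -rmulA PP subrr.
have yx q : q \in s -> rmul y q.2.1 = 0.
  by move=> qs; rewrite -(frame_proj_col os qs) rmulA yP mul0.
have xa q : q \in s -> rmul q.2.2 a = 0.
  by move=> qs; rewrite -(frame_proj_row os qs) -rmulA Pa rmul0.
have np0 : p0 \notin s.
  by apply/negP => /xa /=; rewrite ya; exact: (pD.1 _ Dg).1.
have fp0 : frame_member e p0 by split.
exists (p0 :: s); split.
- split=> [|p|p q]; first by rewrite /= np0.
    by rewrite inE => /orP[/eqP ->|/fs].
  rewrite !inE => /orP[/eqP ->|ps] /orP[/eqP ->|qs]; first by rewrite eqxx.
  + by move=> _; exact: yx.
  + by move=> _; exact: xa.
  + exact: orth.
- by move=> p ps; rewrite inE ps orbT.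
- rewrite /frame_proj big_cons /= -/(frame_proj s) -/P rmulDl -rmulA.
  have -> : rmul y z = gone R (gdom g).
    by rewrite -ya -[z in LHS](subrK (rmul P z)) rmulDr rmulA yP mul0 addr0.
  by rewrite (mul_gone ha) subrK.
Qed.

Let coverable e : set R := [set z | forall s, dual_frame e s ->
  exists s', [/\ dual_frame e s', {subset s <= s'} & rmul (frame_proj s') z = z]].

Let coverable_submodule e : submodule (M := regular_module R) (coverable e).
Proof.
split.
- by move=> s os; exists s; split => //; exact: rmul0.
- move=> x y cx cy s os; have [s1 [o1 i1 e1]] := cx s os.
  have [s2 [o2 i2 e2]] := cy s1 o1; exists s2; split=> //.
    by move=> p /i1 /i2.
  by rewrite rmulBr e2 -e1 rmulA (frame_proj_sub o1 o2 i2).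
- move=> x a cx s os; have [s1 [o1 i1 e1]] := cx s os.
  by exists s1; split => //; rewrite [mact _ _]/(rmul x a) rmulA e1.
Qed.

(** Frames can be enlarged to cover any homogeneous element starting in [Delta],
    and covering is preserved by sums and right multiples. So the elements all
    of whose left multiples are coverable form an ideal containing the units of
    [Delta]; it contains [1_e], and a frame covering [1_e] projects onto it. *)
Lemma frame_exists e : exists2 s, dual_frame e s & frame_proj s = gone R e.
Proof.
have sC := coverable_submodule e; have [C0 CB CM] := sC.
pose I : set R := [set r | forall a, coverable e (rmul (gone R e) (rmul a r))].
have sI : submodule (M := regular_module R) I.
  split=> [a|x y Ix Iy a|x b Ix a] /=; first by rewrite !rmul0.
    by rewrite !rmulBr; exact: CB.
  by rewrite !rmulA -(rmulA _ a x); exact: CM.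
have CI : core I = setT.
  apply: pD.2; first by apply: core_ideal => // x b Ix a; rewrite (rmulA a).
  move=> f Df; apply: core_homog (gone_homog R f) _; first by case: sI.
  move=> a; apply: (submodule_gproj sC) => k.
  rewrite rmulA gproj_mul_gone gproj_gone_mul.
  case: eqP => [dk|//]; case: eqP => [rk|//].
  by move=> s os; apply: dual_frame_extend (gproj_homog k a) rk _ => //; rewrite dk.
have : core I (gone R e) by rewrite CI.
move/(core_sub sI)/(_ (gone R e)); rewrite !gone_idem => /(_ [::])[|s [os _ E]].
  by split.
by exists s => //; rewrite -E (mul_gone_id (frame_proj_homog os)).
Qed.

Section Chain.
Variables (e : gobj G) (N : nat -> set (ring_at R e)).
Hypothesis gN : forall n, gr_submodule (N n).
Hypothesis dN : forall n, N n.+1 `<=` N n.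

Let dNle m n : (m <= n)%N -> N n `<=` N m.
Proof.
move=> /subnK <-; elim: (n - m)%N => // k ih x; rewrite addSn => /dN; exact: ih.
Qed.

Let cut n s : set (ring_at R e) :=
  [set z | N n z /\ forall p, p \in s -> rmul p.2.2 (subgrp_val z) = 0].

Let stable s := exists n0, forall n, (n0 <= n)%N -> cut n0 s `<=` N n.

(** The rows of a frame filter the right ideal of an object with gr-simple
    quotients, and on each quotient the chain is eventually everything or
    eventually nothing. *)
Let stable_cons p s : frame_member e p ->
  (forall q, q \in s -> frame_member e q) -> stable (p :: s) -> stable s.
Proof.
move=> fp fs [n0 st]; have [_ hy re Dp _] := fp.
case: (pselect (forall n, exists2 z, cut n s z
    & rmul p.2.2 (subgrp_val z) <> 0)) => [H|H].
  exists n0 => n le z [Nz cz].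
  have [z' [Nz' cz'] nz'] := H n; have [[N0 NB NM] Np] := gN n.
  have [k nk] : exists k, rmul p.2.2 (subgrp_val (gproj k z')) <> 0.
    apply: contrapT => Hk; apply: nz'; have [t _ ->] := gproj_seq (subgrp_val z').
    rewrite rmul_bigr big1 // => k _; apply: contrapT => n'; apply: Hk.
    by exists k; rewrite at_gproj.
  have hk : homog k (subgrp_val (gproj k z')) by rewrite at_gproj; exact: gproj_homog.
  have rk : grng k = e.
    apply: contrapT => n'; apply: nk; apply: mul_undef hy hk _.
    by rewrite gdom_inv re => /esym.
  have [h Eh] := @gcompP _ (ginv p.1) k ltac:(by rewrite gdom_inv re rk).
  have [c _ Ec] := (pD.1 _ Dp).2 h _ (homogM hy hk Eh)
    (etrans (grng_comp Eh) (grng_inv _)) nk.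
  (* [w] is in [N n] and has the same row [p] as [z]. *)
  pose w := mact (gproj k z') (rmul c (rmul p.2.2 (subgrp_val z))).
  have Nw : N n w by apply: NM; exact: Np.
  have wE : subgrp_val w =
      rmul (subgrp_val (gproj k z')) (rmul c (rmul p.2.2 (subgrp_val z))) by [].
  rewrite -[z](subrK w); apply: submodule_D => //; apply: st => //; split.
    by have [[_ NB0 _] _] := gN n0; apply: NB0 => //; exact: (dNle le).
  have hyz : rmul (gone R (gdom p.1)) (rmul p.2.2 (subgrp_val z)) =
      rmul p.2.2 (subgrp_val z).
    by rewrite rmulA -[gdom _]grng_inv (gone_mul hy).
  move=> q; rewrite inE subgrp_valB rmulBr wE => /orP[/eqP ->|qs].
    by rewrite !rmulA -(rmulA _ p.2.2) Ec hyz subrr.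
  rewrite cz // rmulA at_gproj.
  have [_ hq rq _ _] := fs q qs.
  have [l El] := @gcompP _ (ginv q.1) k ltac:(by rewrite gdom_inv rq rk).
  by rewrite -(gproj_mull _ hq El) cz' // gproj0 mul0 subrr.
have [n1 H1] : exists n1, forall z, cut n1 s z -> rmul p.2.2 (subgrp_val z) = 0.
  apply: contrapT => H1; apply: H => n; apply: contrapT => Hn; apply: H1.
  by exists n => z cz; apply: contrapT => nz; apply: Hn; exists z.
exists (maxn n0 n1) => n le z [Nz cz]; apply: st.
  exact: leq_trans (leq_maxl _ _) le.
split; first exact: (dNle (leq_maxl n0 n1)).
move=> q; rewrite inE => /orP[/eqP ->|]; last exact: cz.
by apply: H1; split => //; exact: (dNle (leq_maxr n0 n1)).
Qed.

Lemma chain_stable : exists n0, forall n, (n0 <= n)%N -> N n = N n0.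
Proof.
have [s [_ fs _] Es] := frame_exists e.
suff [n0 H] : stable [::].
  by exists n0 => n le; apply/seteqP; split; [exact: dNle|move=> z Nz; exact: H].
have : stable s.
  exists 0 => n _ z [_ cz]; suff -> : z = 0 by case: (gN n) => -[].
  apply: subgrp_inj; rewrite -ring_at_gone -Es rmul_bigl big_seq big1 // => p ps.
  by rewrite -rmulA cz // rmul0.
elim: s fs {Es} => // p s ih fs st; apply: ih.
  by move=> q qs; apply: fs; rewrite inE qs orbT.
apply: stable_cons st; first by apply: fs; rewrite inE eqxx.
by move=> q qs; apply: fs; rewrite inE qs orbT.
Qed.

End Chain.

Lemma pivotal_artinian : obj_artinian R.
Proof. by move=> e N gN dN; exact: chain_stable. Qed.

End Frame.

(** * Matrix rings over graded division rings *)

Section Matrix.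
Variables (G : groupoid) (D : gradedRing G) (e : gobj G).
Hypothesis De : gsupp D `<=` corner e.
Variables (K : choiceType) (s : K -> G).
Hypothesis se : forall k, grng (s k) = e.
Hypothesis sfin : d_finite s.
Let MD := gmatrix De se sfin.

Lemma gmatrix_homog g (A : MD) :
  homog g A -> forall k l, ohomog (conj_deg s k l g) (subgrp_val A k l).
Proof. by move=> hA k l; exact: (hA (k, l)). Qed.

Lemma homog_gmatrix g (A : MD) :
  (forall k l, ohomog (conj_deg s k l g) (subgrp_val A k l)) -> homog g A.
Proof. by move=> H; exact (fun p : K * K => H p.1 p.2). Qed.

Lemma gmatrix_ext (A B : MD) :
  (forall k l, subgrp_val A k l = subgrp_val B k l) -> A = B.
Proof.
by move=> H; apply: subgrp_inj; apply: funext => k; apply: funext => l.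
Qed.

Lemma emx_in (k l : K) (d : D) :
  sg_set (gmx_subgroup D K) (fun i j => if (i == k) && (j == l) then d else 0).
Proof.
apply: (sub_finite_set (B := [set (k, l)])); last exact: finite_set1.
move=> [i j] /=; case: (eqVneq i k) => [->|_] /=; last by rewrite eqxx.
by case: (eqVneq j l) => [->|_]; rewrite ?eqxx.
Qed.

Definition emx (k l : K) (d : D) : MD := mk_subgrp (emx_in k l d).

Lemma emxE k l d i j :
  subgrp_val (emx k l d) i j = if (i == k) && (j == l) then d else 0.
Proof. by []. Qed.

Lemma mul_single_row (A B : MD) i j m : (forall n, n != m -> subgrp_val A i n = 0) ->
  subgrp_val (rmul A B) i j = rmul (subgrp_val A i m) (subgrp_val B m j).
Proof.
move=> H; rewrite -[LHS]/(gmx_mul_fun _ _ i j) /gmx_mul_fun.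
rewrite (@fsum_seq _ _ _ [:: m]) ?big_seq1 // => n; rewrite inE.
by case: (eqVneq n m) => // /H ->; rewrite mul0 eqxx.
Qed.

Lemma mul_single_col (A B : MD) i j m : (forall n, n != m -> subgrp_val B n j = 0) ->
  subgrp_val (rmul A B) i j = rmul (subgrp_val A i m) (subgrp_val B m j).
Proof.
move=> H; rewrite -[LHS]/(gmx_mul_fun _ _ i j) /gmx_mul_fun.
rewrite (@fsum_seq _ _ _ [:: m]) ?big_seq1 // => n; rewrite inE.
by case: (eqVneq n m) => // /H ->; rewrite rmul0 eqxx.
Qed.

Lemma emx_mul k l d (B : MD) i j :
  subgrp_val (rmul (emx k l d) B) i j =
  if i == k then rmul d (subgrp_val B l j) else 0.
Proof.
rewrite (@mul_single_row _ _ _ _ l) => [|n nl] /=.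
  by rewrite eqxx andbT; case: eqP => // _; rewrite mul0.
by rewrite (negPf nl) andbF.
Qed.

Lemma gmatrix_one o k l : subgrp_val (gone MD o) k l =
  if (k == l) && (gdom (s k) == o) then gone D e else 0.
Proof. by []. Qed.

Lemma gmatrix_one0 o : (forall k, gdom (s k) <> o) -> gone MD o = 0.
Proof.
move=> H; apply: gmatrix_ext => k l; rewrite gmatrix_one.
by case: eqP => //= _; case: eqP => // /H.
Qed.

Section UniqueRow.
Hypothesis divD : gr_division D.
Variables (f : gobj G) (k0 : K).
Hypothesis uk0 : [set k | gdom (s k) = f] = [set k0].

Let k0f : gdom (s k0) = f. Proof. by have : [set k0] k0 by []; rewrite -uk0. Qed.
Let fk0 k : gdom (s k) = f -> k = k0.
Proof. by move=> E; have : [set k | gdom (s k) = f] k by []; rewrite uk0. Qed.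

Let one_neq0 : gone D e <> 0.
Proof.
have [[x /eqP nx] _] := divD; have [g ng] := gproj_neq0 nx.
have [rg _] := De (gproj_gsupp ng) => e0; case/eqP: ng.
by rewrite -(gone_mul (gproj_homog g x)) rg e0 mul0.
Qed.

(** A nonzero homogeneous matrix ending at [f] is supported in the row [k0], and
    the inverse of any one of its entries, placed in the column [k0], is a right
    inverse. *)
Lemma gmatrix_pivot : pivot MD f.
Proof.
split.
  move/(congr1 (fun A : MD => subgrp_val A k0 k0)).
  by rewrite /= /gmx_one_fun k0f !eqxx.
move=> g A hA rg nA.
have row k l : subgrp_val A k l <> 0 -> k = k0.
  have := gmatrix_homog hA k l; case E: conj_deg => [h|] //= _ _.
  by apply: fk0; rewrite (conj_deg_rng E).
have [k [l nkl]] : exists k l, subgrp_val A k l <> 0.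
  apply: contrapT => H; apply: nA; apply: gmatrix_ext => k l.
  by apply: contrapT => n; apply: H; exists k, l.
have kk0 := row k l nkl; rewrite kk0 {k kk0} in nkl.
have := gmatrix_homog hA k0 l; case E: conj_deg => [h|] //= ha.
have nh : gproj h (subgrp_val A k0 l) != 0 by rewrite homog_gproj //; apply/eqP.
have [rh _] := De (gproj_gsupp nh).
have [b [_ ab _]] := divD.2 h _ ha nkl.
rewrite -rg; apply: (homog_right_inverse (c := emx l k0 b)) hA _.
apply: gmatrix_ext => i j; rewrite (@mul_single_col _ _ _ _ l) => [|n nl]; last first.
  by rewrite emxE (negPf nl).
rewrite gmatrix_one emxE eqxx /=; case: (eqVneq i k0) => [->|ni].
  rewrite k0f rg eqxx andbT eq_sym; case: eqP => _; last exact: rmul0.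
  by rewrite ab rh.
have -> : subgrp_val A i l = 0.
  by apply: contrapT => /row E'; rewrite E' eqxx in ni.
rewrite mul0; case: (eqVneq i j) => //= _; case: eqP => // ds.
by rewrite (fk0 (etrans ds rg)) eqxx in ni.
Qed.

(** The matrix unit at [(k, k)] factors through the one at [(k0, k0)], which is
    the local unit of [f]. *)
Lemma gmatrix_pivotal : pivotal MD [set f].
Proof.
split=> [_ ->|I gI If]; first exact: gmatrix_pivot.
have [I0 IB IM _] := gI; have sI := (ideal_submodule gI).1.
have Ikk k : I (emx k k (gone D e)).
  have -> : emx k k (gone D e) =
      rmul (emx k k0 (gone D e)) (rmul (gone MD f) (emx k0 k (gone D e))).
    apply: gmatrix_ext => i j; rewrite emx_mul.
    rewrite (@mul_single_row _ _ _ _ k0) => [|n nk]; last first.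
      by rewrite gmatrix_one eq_sym (negPf nk).
    rewrite gmatrix_one k0f !eqxx /= eqxx /=.
    by case: (i == k) => //=; case: (j == k); rewrite ?gone_idem ?rmul0.
  have [H _] := IM _ (emx k0 k (gone D e)) (If f erefl).
  by have [] := IM _ (emx k k0 (gone D e)) H.
apply: ideal_full => // o.
have [t ut ht] := finite_uniq (sfin o).
have -> : gone MD o = \sum_(k <- t | gdom (s k) == o) emx k k (gone D e).
  apply: gmatrix_ext => i j; rewrite gmatrix_one.
  have add : {morph (fun A : MD => subgrp_val A i j) : x y / x + y} by [].
  rewrite -big_filter (morph_sum add) /=.
  rewrite (eq_bigr (fun k => if k == i then (if i == j then gone D e else 0) else 0));
    last first.
    by move=> k _; rewrite eq_sym; case: eqP => //= ->; rewrite eq_sym.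
  have uf : uniq [seq k <- t | gdom (s k) == o] by rewrite filter_uniq.
  case: (eqVneq (gdom (s i)) o) => [di|ni]; rewrite ?andbT ?andbF.
    rewrite (bigD1_seq i) //= ?eqxx ?big1 ?addr0 // => [k /negPf ->//|].
    by rewrite mem_filter di eqxx; exact: ht.
  rewrite big_seq big1 // => k; rewrite mem_filter => /andP[/eqP dk _].
  by case: eqP => // ki; rewrite -ki dk eqxx in ni.
by rewrite -big_filter; apply: (submodule_sum sI) => k _; exact: Ikk.
Qed.

End UniqueRow.
End Matrix.

Section Factors.
Variables (G : groupoid) (R : gradedRing G).

(** A single pivot generating a factor makes the factor gr-simple, gr-prime,
    artinian and pfm at once; the last clause makes it a pivot of [R]. *)
Definition pivot_factors (J : Type) (Rj : J -> gradedRing G) (f : J -> gobj G) :=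
  [/\ gr_summable Rj, forall j, pivotal (Rj j) [set f j],
      gr_ring_iso R (gprod Rj)
    & forall j k, j <> k -> gone (Rj k) (f j) = 0].

Variables (J : Type) (Rj : J -> gradedRing G) (f : J -> gobj G).

Lemma factors_pivot j : pivot_factors Rj f -> pivot R (f j).
Proof.
move=> [_ piv iso off]; apply: (pivot_iso (gr_ring_iso_sym iso)).
by apply: (@product_pivot _ _ _ j); [exact: off|exact: (piv j).1].
Qed.

Lemma factors_simple_object j : pivot_factors Rj f ->
  gr_simple_mod (ring_at R (f j)) /\ nonzero_gz (ring_at (Rj j) (f j)).
Proof.
move=> pf; split; first by apply/pivotP; exact: factors_pivot.
by apply/ring_at_neq0; case: pf => _ piv _ _; exact: ((piv j).1 _ erefl).1.
Qed.

Lemma simple_factors_pivotal :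
  gr_summable Rj -> (forall j, gr_simple_ring (Rj j)) -> gr_ring_iso R (gprod Rj) ->
  (forall j, gr_simple_mod (ring_at R (f j)) /\ nonzero_gz (ring_at (Rj j) (f j))) ->
  pivotal R (range f).
Proof.
move=> sm simp iso H; split; first by move=> _ [j _ <-]; apply/pivotP; exact: (H j).1.
apply: (generates_iso (gr_ring_iso_sym iso)); apply: product_generates => // j.
by apply/ring_at_neq0; exact: (H j).2.
Qed.

End Factors.

Lemma homog_zero_off (G : groupoid) (R : gradedRing G) e :
  gone R e = 0 <-> @homog G R (gid e) = [set 0].
Proof.
split=> [e0|H]; last by have := gone_homog R e; rewrite H.
apply/seteqP; split => [a ha|a ->]; last exact: homog0.
by rewrite -(gone_mul_id ha) e0 mul0.
Qed.

(** * The corner ring at an object *)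

Section CornerRing.
Variables (G : groupoid) (R : gradedRing G) (f : gobj G).

Definition corner_set : set R :=
  [set x | rmul (gone R f) x = x /\ rmul x (gone R f) = x].

Lemma corner_set0 : corner_set 0.
Proof. by split; rewrite ?rmul0 ?mul0. Qed.

Lemma corner_setB x y : corner_set x -> corner_set y -> corner_set (x - y).
Proof. by move=> [x1 x2] [y1 y2]; split; rewrite ?rmulBr ?rmulBl ?x1 ?x2 ?y1 ?y2. Qed.

Definition corner_subgroup := Subgroup corner_set0 corner_setB.

Lemma corner_deg x g : corner_set x -> gproj g x != 0 -> grng g = f /\ gdom g = f.
Proof.
move=> [x1 x2] ng; split.
  move: ng; rewrite -x1 gproj_gone_mul.
  by case: (eqVneq (grng g) f) => // _; rewrite eqxx.
move: ng; rewrite -x2 gproj_mul_gone.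
by case: (eqVneq (gdom g) f) => // _; rewrite eqxx.
Qed.

Lemma homog_corner g (x : R) :
  homog g x -> grng g = f -> gdom g = f -> corner_set x.
Proof.
by move=> hx rg dg; split; rewrite ?(gone_mulE _ hx) ?(mul_goneE _ hx) ?rg ?dg eqxx.
Qed.

Let phi (i : unit) (x : subgrp corner_subgroup) : R := subgrp_val x.
Let rho (i : unit) (g : G) := if (grng g == f) && (gdom g == f) then Some g else None.
Let phiB i x y : phi i (x - y) = phi i x - phi i y.
Proof. by []. Qed.
Let phi_inj x y : (forall i, phi i x = phi i y) -> x = y.
Proof. by move=> /(_ tt) /subgrp_inj. Qed.
Let rho_inj (i : unit) g g' h : rho i g = Some h -> rho i g' = Some h -> g = g'.
Proof. by rewrite /rho; case: ifP => // _ [->]; case: ifP => // _ [->]. Qed.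
Let rho_surj i x h : gproj h (phi i x) != 0 -> exists g, rho i g = Some h.
Proof.
by move=> /(corner_deg (subgrpP x))[rh dh]; exists h; rewrite /rho rh dh eqxx.
Qed.
Let pr_ex g x : exists y, forall i, phi i y = oproj (rho i g) (phi i x).
Proof.
rewrite /rho; case: ifP => [/andP[/eqP rg /eqP dg]|_]; last by exists 0.
by exists (mk_subgrp (S := corner_subgroup)
  (homog_corner (gproj_homog g (subgrp_val x)) rg dg)).
Qed.
Let pr_fin x : finite_set [set g | exists i, oproj (rho i g) (phi i x) != 0].
Proof.
apply: (sub_finite_set _ (gproj_finite (subgrp_val x))) => g [i].
by rewrite /rho; case: ifP => //= _; rewrite eqxx.
Qed.

Definition corner_gz : gradedZmod G :=
  build_gz phiB phi_inj rho_inj rho_surj pr_ex pr_fin.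

Lemma corner_homog g (x : corner_gz) : homog g x <-> homog g (subgrp_val x).
Proof.
split=> [/(_ tt)|hx i]; rewrite /phi /rho.
  by case: ifP => //= _ ->; exact: homog0.
case: ifP => //= n; apply: contrapT => nx.
have ng : gproj g (subgrp_val x) != 0 by rewrite homog_gproj //; apply/eqP.
by have [rg dg] := corner_deg (subgrpP x) ng; rewrite rg dg eqxx in n.
Qed.

Lemma corner_mul_closed (x y : corner_gz) :
  corner_set (rmul (subgrp_val x) (subgrp_val y)).
Proof.
by have [x1 _] := subgrpP x; have [_ y2] := subgrpP y; split;
  [rewrite rmulA x1|rewrite -rmulA y2].
Qed.

Definition corner_mul (x y : corner_gz) : corner_gz :=
  mk_subgrp (S := corner_subgroup) (corner_mul_closed x y).

Lemma corner_one_closed e : corner_set (if e == f then gone R f else 0).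
Proof.
by case: eqP => _; [split; exact: gone_idem|exact: corner_set0].
Qed.

Definition corner_one e : corner_gz :=
  mk_subgrp (S := corner_subgroup) (corner_one_closed e).

Lemma corner_mulA : associative corner_mul.
Proof. by move=> x y z; apply: subgrp_inj; exact: rmulA. Qed.
Lemma corner_mulDl : left_distributive corner_mul +%R.
Proof. by move=> x y z; apply: subgrp_inj; exact: rmulDl. Qed.
Lemma corner_mulDr : right_distributive corner_mul +%R.
Proof. by move=> x y z; apply: subgrp_inj; exact: rmulDr. Qed.
Lemma corner_homog_mul g h (x y : corner_gz) :
  homog g x -> homog h y -> ohomog (gcomp g h) (corner_mul x y).
Proof.
move=> /corner_homog hx /corner_homog hy; have := homog_mul hx hy.
case: gcomp => [k|] /= H; first exact/corner_homog.
exact: subgrp_inj.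
Qed.
Lemma corner_one_homog e : homog (gid e) (corner_one e).
Proof.
by apply/corner_homog => /=; case: eqP => [->|_]; [exact: gone_homog|exact: homog0].
Qed.
Lemma corner_one_mul g (x : corner_gz) :
  homog g x -> corner_mul (corner_one (grng g)) x = x.
Proof.
move=> /corner_homog hx; apply: subgrp_inj => /=; have [x1 _] := subgrpP x.
case: eqP => [_|/eqP/negPf n]; first exact: x1.
by rewrite -[RHS]x1 (gone_mulE _ hx) n mul0.
Qed.
Lemma corner_mul_one g (x : corner_gz) :
  homog g x -> corner_mul x (corner_one (gdom g)) = x.
Proof.
move=> /corner_homog hx; apply: subgrp_inj => /=; have [_ x2] := subgrpP x.
case: eqP => [_|/eqP/negPf n]; first exact: x2.
by rewrite -[RHS]x2 (mul_goneE _ hx) n rmul0.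
Qed.

Definition corner_ring : gradedRing G :=
  GradedRing corner_mulA corner_mulDl corner_mulDr corner_homog_mul
    corner_one_homog corner_one_mul corner_mul_one.

Lemma corner_ring_homog g (x : corner_ring) : homog g x <-> homog g (subgrp_val x).
Proof. exact: corner_homog. Qed.

Lemma corner_supp : gsupp corner_ring `<=` corner f.
Proof.
move=> g ng; apply: contrapT => nc; apply: ng; apply/seteqP; split => [x hx|x ->].
  apply: subgrp_inj; apply: contrapT => nx; apply: nc.
  have ng : gproj g (subgrp_val x) != 0.
    by rewrite homog_gproj; [apply/eqP|apply/corner_ring_homog].
  exact: corner_deg (subgrpP x) ng.
exact: homog0.
Qed.

(** Elements of the corner have a right inverse because they end at a pivot and
    a left inverse because they start there. *)
Lemma corner_division Delta :
  pivotal R Delta -> Delta f -> gr_division corner_ring.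
Proof.
move=> pD Df; have [n1 pf] := pD.1 f Df; split.
  exists (corner_one f); apply/eqP => /(congr1 (@subgrp_val _ _)) /=.
  by rewrite eqxx.
move=> g a ha na; have ha' := proj1 (corner_ring_homog g a) ha.
have na' : subgrp_val a <> 0 by move=> E; apply: na; exact: subgrp_inj.
have [rg dg] : grng g = f /\ gdom g = f.
  by apply: (corner_deg (subgrpP a)); rewrite homog_gproj //; apply/eqP.
have [b hb ab] := pf g _ ha' rg na'.
have [|b' hb' ba] := pivotal_left_inverse pD ha' _ na'; first by rewrite dg.
have bb : b' = b.
  rewrite -[b'](mul_gone hb') gdom_inv rg -ab rmulA ba.
  by rewrite -[gdom g]grng_inv (gone_mul hb).
have cb : corner_set b.
  by apply: (homog_corner hb); rewrite ?grng_inv ?gdom_inv.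
exists (mk_subgrp (S := corner_subgroup) cb); split.
- exact/corner_ring_homog.
- by apply: subgrp_inj; rewrite /= rg eqxx.
- by apply: subgrp_inj; rewrite /= dg eqxx -bb ba dg.
Qed.

End CornerRing.

(** * Unlinked pivot objects *)

Section Unlinked.
Variables (G : groupoid) (R : gradedRing G) (Delta : set (gobj G)).
Hypothesis pD : pivotal R Delta.

Definition linked (f f' : gobj G) :=
  exists g (a : R), [/\ homog g a, a <> 0, grng g = f & gdom g = f'].

Lemma linked_sym f f' : pivot R f -> linked f f' -> linked f' f.
Proof.
move=> [n1 pf] [g [a [ha na rg dg]]]; have [b hb ab] := pf g a ha rg na.
exists (ginv g), b; split; rewrite ?grng_inv ?gdom_inv //.
by move=> b0; apply: n1; rewrite -ab b0 rmul0.
Qed.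

(** Take a maximal subset without distinct linked members. A pivot left out is
    linked to a member [t]: there is a nonzero [a = a 1_t] ending at it, and a
    right inverse of [a] shows that its unit is in the ideal generated by
    [1_t]. *)
Lemma unlinked_pivotal : exists T : set (gobj G), pivotal R T /\
  forall f f', T f -> T f' -> linked f f' -> f = f'.
Proof.
pose P (T : set (gobj G)) :=
  T `<=` Delta /\ forall f f', T f -> T f' -> linked f f' -> f = f'.
have [F FP tot|T [[TD uT] mT]] := @Zorn_bigcup _ P.
  split=> [f [A /FP[AD _]]|f f' [A FA Af] [B FB Bf']]; first exact: AD.
  have [_ uA] := FP A FA; have [_ uB] := FP B FB.
  by case: (tot A B FA FB) => sub;
    [apply: uB => //; exact: sub|apply: uA => //; exact: sub].
exists T; split=> //; split=> [f /TD|I gI IT]; first exact: pD.1.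
apply: pD.2 => // f Df; case: (pselect (T f)) => [|nTf]; first exact: IT.
suff [t [Tt [g [a [ha na rg dg]]]]] : exists t, T t /\ linked f t.
  apply: (pivot_ideal (pD.1 f Df) gI _ ha rg na).
  case: gI => _ _ IM _; rewrite -(mul_gone ha) dg.
  by have [] := IM _ a (IT t Tt).
apply: contrapT => H; apply: (mT (T `|` [set f])).
  by split=> [x|sub]; [left|apply: nTf; apply: sub; right].
split=> [x [/TD//|->//]|x y [Tx|->] [Ty|->] //]; first exact: uT.
  move=> /(linked_sym (pD.1 x (TD x Tx))) l; case: H; by exists x.
by move=> l; case: H; exists y.
Qed.

End Unlinked.

(** * The decomposition into matrix rings *)

Definition matrix_decomposition (G : groupoid) (R : gradedRing G) :=
  exists (J : Type) (K : J -> choiceType) (e f : J -> gobj G)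
    (D : J -> gradedRing G)
    (De : forall j, gsupp (D j) `<=` corner (e j))
    (s : forall j, K j -> G)
    (se : forall j k, grng (s j k) = e j)
    (sfin : forall j, d_finite (s j)),
    let M j := gmatrix (De j) (se j) (sfin j) in
    [/\ forall j, [set: K j] !=set0,
        forall j, gr_division (D j),
        gr_summable M,
        gr_ring_iso R (gprod M)
        & forall j,
          (exists k0, [set k | gdom (s j k) = f j] = [set k0]) /\
          [set j' | [set k | gdom (s j' k) = f j] !=set0] = [set j]].

Lemma matrix_decomposition_factors (G : groupoid) (R : gradedRing G) :
  matrix_decomposition R -> exists (J : Type) (Rj : J -> gradedRing G) (f : J -> gobj G),
    pivot_factors R Rj f.
Proof.
move=> [J [K [e [f [D [De [s [se [sfin [_ divD sm iso uf]]]]]]]]]].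
exists J, (fun j => gmatrix (De j) (se j) (sfin j)), f; split=> // [j|j k n].
  by have [[k0 E] _] := uf j; exact: gmatrix_pivotal E.
apply: gmatrix_one0 => l El; have [_ E] := uf j.
have : [set j' | [set k | gdom (s j' k) = f j] !=set0] k by exists l.
by rewrite E => /esym.
Qed.

Lemma finite_val_seq (X : choiceType) (A : set X) (L : seq X) :
  finite_set [set k : A | val k \in L].
Proof.
apply: (@finite_preimage A X [set` L] val); last exact: finite_seq.
by move=> x y _ _; exact: val_inj.
Qed.

Section Wedderburn.
Variables (G : groupoid) (R : gradedRing G) (T : set (gobj G)).
Hypothesis pT : pivotal R T.
Hypothesis uT : forall f f', T f -> T f' -> linked R f f' -> f = f'.

Let frx : exists fr : gobj G -> seq (G * (R * R)),
  forall e, dual_frame T e (fr e) /\ frame_proj (fr e) = gone R e.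
Proof.
have H (e : gobj G) : exists s, dual_frame T e s /\ frame_proj s = gone R e.
  by have [s os Es] := frame_exists pT e; exists s.
by have [fr frP] := boolp.choice H; exists fr.
Qed.

Let fr := projT1 (cid frx).
Let frP e : dual_frame T e (fr e). Proof. by have [] := projT2 (cid frx) e. Qed.
Let frE e : frame_proj (fr e) = gone R e.
Proof. by have [] := projT2 (cid frx) e. Qed.

(** One global basis: rows and columns of frames of different objects do not
    compose, so orthonormality persists in the union. *)
Let B : set (G * (R * R)) := [set p | p \in fr (grng p.1)].

Let frB e p : p \in fr e -> B p /\ grng p.1 = e.
Proof. by move=> pe; have [_ /(_ p pe)[_ _ re _ _] _] := frP e; rewrite /B /= re. Qed.

Let memB p : B p -> frame_member T (grng p.1) p.
Proof. by move=> Bp; have [_ H _] := frP (grng p.1); exact: H. Qed.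

Let orthB p q : B p -> B q -> rmul p.2.2 q.2.1 =
  if p == q then gone R (gdom p.1) else 0.
Proof.
move=> Bp Bq; have [_ hy _ _ yx] := memB Bp; have [hx _ _ _ _] := memB Bq.
case: eqP => [<- //|/eqP n]; case: (eqVneq (grng p.1) (grng q.1)) => [E|/eqP nE].
  by have [_ _ H] := frP (grng p.1); apply: H => //; rewrite E.
by apply: (mul_undef hy hx); rewrite gdom_inv.
Qed.

(** This makes the matrix of an element block diagonal along [T]. *)
Let unlinked_zero r t t' : T t -> T t' -> t <> t' ->
  rmul (gone R t) (rmul r (gone R t')) = 0.
Proof.
move=> Tt Tt' n; apply: gproj_ext => k.
rewrite gproj_gone_mul gproj_mul_gone gproj0.
case: eqP => // rk; case: eqP => // dk; apply: contrapT => nz; apply: n.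
by apply: uT => //; exists k, (gproj k r); split => //; exact: gproj_homog.
Qed.

Let entry (p q : G * (R * R)) (r : R) : R := rmul p.2.2 (rmul r q.2.1).

Let row_gone p : B p -> rmul (gone R (gdom p.1)) p.2.2 = p.2.2.
Proof. by move=> /memB[_ hy _ _ _]; rewrite -[gdom _]grng_inv (gone_mul hy). Qed.

Let col_gone p : B p -> rmul p.2.1 (gone R (gdom p.1)) = p.2.1.
Proof. by move=> /memB[hx _ _ _ _]; rewrite (mul_gone hx). Qed.

Let entry_corner p q r : B p -> B q -> gdom p.1 = gdom q.1 ->
  corner_set (gdom p.1) (entry p q r).
Proof.
move=> Bp Bq E; split; rewrite /entry; first by rewrite rmulA row_gone.
by rewrite E -!rmulA col_gone.
Qed.

Let entry_off p q r : B p -> B q -> gdom p.1 <> gdom q.1 -> entry p q r = 0.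
Proof.
move=> Bp Bq n; have [_ _ _ Tp _] := memB Bp; have [_ _ _ Tq _] := memB Bq.
rewrite (_ : entry p q r = rmul (gone R (gdom p.1))
  (rmul (entry p q r) (gone R (gdom q.1)))); first exact: unlinked_zero.
by rewrite /entry -!rmulA col_gone // [RHS]rmulA row_gone.
Qed.

(** * Finite expansions along the frames *)

Let sum_fr (F : G * (R * R) -> R) e L : uniq L -> {subset fr e <= L} ->
  (forall p, p \in L -> p \notin fr e -> F p = 0) ->
  \sum_(p <- L) F p = \sum_(p <- fr e) F p.
Proof.
move=> uL sub F0; pose F' p := if p \in fr e then F p else 0.
have nF' p : F' p != 0 -> p \in fr e by rewrite /F'; case: ifP => //; rewrite eqxx.
transitivity (\sum_(p <- L) F' p).
  rewrite big_seq [RHS]big_seq; apply: eq_bigr => p pL; rewrite /F'.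
  by case: ifP => // /negbT /(F0 p pL).
transitivity (\sum_(p <- fr e) F' p).
  rewrite -(@fsum_seq _ _ F' L) // => [|p /nF' /sub //].
  by apply: fsum_seq => //; case: (frP e).
by rewrite big_seq [RHS]big_seq; apply: eq_bigr => p pe; rewrite /F' pe.
Qed.

(** The expansion holds for every large enough finite part of [B]: this form is
    stable under sums, and lets the expansion be compared with other finite
    families. *)
Let expand_left w : exists L0 : seq (G * (R * R)), (forall p, p \in L0 -> B p) /\
  forall L, uniq L -> (forall p, p \in L -> B p) -> {subset L0 <= L} ->
    w = \sum_(p <- L) rmul p.2.1 (rmul p.2.2 w).
Proof.
have [s _ ->] := gproj_seq w; elim: s => [|g s [L1 [B1 ih]]].
  exists [::]; split => // L _ _ _; rewrite big_nil big1 // => p _.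
  by rewrite !rmul0.
exists (fr (grng g) ++ L1); split => [p|L uL BL sub].
  by rewrite mem_cat => /orP[/frB[]|/B1].
have subl : {subset fr (grng g) <= L} by move=> p pe; apply: sub; rewrite mem_cat pe.
have subr : {subset L1 <= L} by move=> p pe; apply: sub; rewrite mem_cat pe orbT.
rewrite big_cons; under [RHS]eq_bigr => p _ do rewrite !rmulDr.
rewrite big_split /= -ih //; congr (_ + _); have hg := gproj_homog g w.
rewrite (@sum_fr _ (grng g)) //.
  under eq_bigr => p _ do rewrite rmulA.
  by rewrite -rmul_bigl -/(frame_proj _) frE (gone_mul hg).
move=> p /BL Bp np; have [_ hy _ _ _] := memB Bp.
rewrite (mul_undef hy hg) ?rmul0 // gdom_inv => E.
by move: Bp np; rewrite /B /= E => ->.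
Qed.

Let expand_right w : exists L0 : seq (G * (R * R)), (forall p, p \in L0 -> B p) /\
  forall L, uniq L -> (forall p, p \in L -> B p) -> {subset L0 <= L} ->
    w = \sum_(p <- L) rmul (rmul w p.2.1) p.2.2.
Proof.
have [s _ ->] := gproj_seq w; elim: s => [|g s [L1 [B1 ih]]].
  exists [::]; split => // L _ _ _; rewrite big_nil big1 // => p _.
  by rewrite !mul0.
exists (fr (gdom g) ++ L1); split => [p|L uL BL sub].
  by rewrite mem_cat => /orP[/frB[]|/B1].
have subl : {subset fr (gdom g) <= L} by move=> p pe; apply: sub; rewrite mem_cat pe.
have subr : {subset L1 <= L} by move=> p pe; apply: sub; rewrite mem_cat pe orbT.
rewrite big_cons; under [RHS]eq_bigr => p _ do rewrite !rmulDl.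
rewrite big_split /= -ih //; congr (_ + _); have hg := gproj_homog g w.
rewrite (@sum_fr _ (gdom g)) //.
  under eq_bigr => p _ do rewrite -rmulA.
  by rewrite -rmul_bigr -/(frame_proj _) frE (mul_gone hg).
move=> p /BL Bp np; have [hx _ _ _ _] := memB Bp.
rewrite (mul_undef hg hx) ?mul0 // => E.
by move: Bp np; rewrite /B /= -E => ->.
Qed.

Let entries_finite r : exists L : seq (G * (R * R)),
  forall p q, B p -> B q -> entry p q r != 0 -> p \in L /\ q \in L.
Proof.
have [L1 [B1 E1]] := expand_left r; have [L2 [B2 E2]] := expand_right r.
exists (undup L1 ++ undup L2) => p q Bp Bq npq; split; rewrite mem_cat; apply/orP.
  left; apply: contraNT npq => np; rewrite /entry rmulA.
  rewrite {1}(E1 (undup L1)) ?undup_uniq //; first last.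
  - by move=> x; rewrite mem_undup.
  - by move=> x; rewrite mem_undup; exact: B1.
  rewrite rmul_bigr big_seq big1 ?mul0 // => x xL.
  have Bx : B x by apply: B1; rewrite mem_undup in xL.
  rewrite rmulA orthB //; case: eqP => [px|_]; last exact: mul0.
  by rewrite px xL in np.
right; apply: contraNT npq => nq; rewrite /entry.
rewrite {1}(E2 (undup L2)) ?undup_uniq //; first last.
- by move=> x; rewrite mem_undup.
- by move=> x; rewrite mem_undup; exact: B2.
rewrite rmul_bigl big_seq big1 ?rmul0 // => x xL.
have Bx : B x by apply: B2; rewrite mem_undup in xL.
rewrite -rmulA orthB //; case: eqP => [xq|_]; last exact: rmul0.
by rewrite -xq xL in nq.
Qed.

(** * The matrix rings *)

Let K (t : gobj G) : set (G * (R * R)) := [set p | B p /\ gdom p.1 = t].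
Let KP t (k : K t) : B (val k) /\ gdom (val k).1 = t := set_mem (valP k).

(** The members of the frames with [d = t] index the matrices over the corner
    ring of [t]; inverse degrees, as a matrix of degree [g] has its [(k, l)] entry
    in degree [s_k g s_l^-1]. *)
Let sg t (k : K t) : G := ginv (val k).1.

Let sg_rng t (k : K t) : grng (sg k) = t.
Proof. by rewrite grng_inv; case: (KP k). Qed.

Let sg_fin t : d_finite (@sg t).
Proof.
move=> o; apply: (sub_finite_set _ (finite_val_seq (K t) (fr o))) => k /=.
rewrite gdom_inv => <-.
by case: (KP k).
Qed.

Let D t := corner_ring R t.
Let M t := gmatrix (@corner_supp G R t) (@sg_rng t) (@sg_fin t).

Let entry_in t (k l : K t) r : corner_set t (entry (val k) (val l) r).
Proof.
have [Bk dk] := KP k; have [Bl dl] := KP l.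
by rewrite -{1}dk; apply: entry_corner; rewrite ?dk.
Qed.

Let mx_fun t r (k l : K t) : D t := mk_subgrp (S := corner_subgroup R t) (entry_in k l r).

Let mx_in t r : sg_set (gmx_subgroup (D t) (K t)) (@mx_fun t r).
Proof.
have [L HL] := entries_finite r.
have fL := finite_val_seq (K t) L.
apply: (sub_finite_set _ (finite_setX fL fL)) => -[k l] /= n.
apply: (HL _ _ (KP k).1 (KP l).1); apply: contraNneq n => E.
by apply/eqP/subgrp_inj.
Qed.

Let mx t r : M t := mk_subgrp (@mx_in t r).

Let mxE t r k l : subgrp_val (subgrp_val (mx t r) k l) = entry (val k) (val l) r.
Proof. by []. Qed.

Let mx_ext t (A A' : M t) :
  (forall k l, subgrp_val (subgrp_val A k l) = subgrp_val (subgrp_val A' k l)) ->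
  A = A'.
Proof. by move=> H; apply: gmatrix_ext => k l; apply: subgrp_inj; exact: H. Qed.

Let entryD p q : {morph entry p q : r r' / r + r'}.
Proof. by move=> r r'; rewrite /entry rmulDl rmulDr. Qed.

Let mxD t : {morph mx t : r r' / r + r'}.
Proof. by move=> r r'; apply: mx_ext => k l; rewrite mxE entryD. Qed.

Let mx_homog t g r : homog g r -> homog g (mx t r).
Proof.
move=> hr; apply: homog_gmatrix => k l.
have [_ hy _ _ _] := memB (KP k).1; have [hx _ _ _ _] := memB (KP l).1.
suff H : ohomog (conj_deg (@sg t) k l g) (entry (val k) (val l) r).
  case: conj_deg H => [h|] H; first exact/corner_ring_homog.
  exact: subgrp_inj.
rewrite /conj_deg /entry ginvK; have := homog_mul hr hx.
case: (gcomp g _) => [m|] /= H; first exact: homog_mul hy H.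
by rewrite H rmul0.
Qed.

(** The product of [r] and [r'] is expanded by inserting [x_p y_p] over a finite
    part of [B]. Members of other blocks contribute zero, so the sum is the
    matrix product over [K t]. *)
Let mxM t : {morph mx t : r r' / rmul r r'}.
Proof.
move=> r r'; apply: mx_ext => k l; rewrite mxE.
have [[Bk dk] [Bl dl]] := (KP k, KP l).
pose A := mx t r; pose A' := mx t r'.
have [s us hs] : exists2 s : seq (K t), uniq s &
    forall i m, subgrp_val A i m != 0 -> m \in s.
  have [s hs] := gmx_seq A; exists (undup s); first exact: undup_uniq.
  by move=> i m n; rewrite mem_undup; have [] := hs i m n.
rewrite -[subgrp_val (rmul A A') k l]/(gmx_mul_fun (subgrp_val A) (subgrp_val A') k l).
have [L [BL EL]] := expand_left (rmul r' (val l).2.1).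
pose L' := undup (L ++ map val s).
have BL' p : p \in L' -> B p.
  rewrite mem_undup mem_cat => /orP[/BL //|/mapP[m _ ->]]; exact: (KP m).1.
rewrite (gmx_mul_funE _ _ _ us hs).
have addv : {morph (fun x : D t => subgrp_val x) : x y / x + y} by [].
rewrite (morph_sum addv) /entry -(rmulA r).
rewrite {1}(EL L') ?undup_uniq //; last by move=> p pL; rewrite mem_undup mem_cat pL.
rewrite !rmul_bigr.
pose F p := rmul (entry (val k) p r) (entry p (val l) r').
rewrite (eq_bigr F); last first.
  by move=> p _; rewrite /F /entry !rmulA.
have sE : \sum_(m <- s) subgrp_val (rmul (subgrp_val A k m) (subgrp_val A' m l)) =
    \sum_(p <- map val s) F p by rewrite big_map.
rewrite sE.
pose F' p := if p \in map val s then F p else 0.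
have nF p : p \in L' -> F p != 0 -> p \in map val s.
  move=> /BL' Bp; case: (eqVneq (gdom p.1) t) => [dp|np]; last first.
    rewrite /F entry_off ?mul0 ?eqxx // dk => E; by rewrite -E eqxx in np.
  move=> nF; have Kp : p \in K t by apply: mem_set.
  apply/mapP; exists (exist _ p Kp) => //; apply: (hs k).
  apply: contraNneq nF => /(congr1 (@subgrp_val _ _)) /= E0.
  by rewrite /F E0 mul0.
have nF' p : F' p != 0 -> p \in map val s by rewrite /F'; case: ifP => //; rewrite eqxx.
have us' : uniq (map val s) by rewrite map_inj_uniq //; exact: val_inj.
transitivity (\sum_(p <- L') F' p).
  rewrite big_seq [RHS]big_seq; apply: eq_bigr => p pL; rewrite /F'.
  by case: ifP => // /negbT; apply: contraNeq; exact: nF.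
transitivity (\sum_(p <- map val s) F' p).
  rewrite -(@fsum_seq _ _ F' L') ?undup_uniq //; first exact: fsum_seq.
  by move=> p /nF' ps; rewrite mem_undup mem_cat ps orbT.
by rewrite big_seq [RHS]big_seq; apply: eq_bigr => p ps; rewrite /F' ps.
Qed.

(** * The isomorphism with the product *)

Let Mj (j : T) := M (val j).
Let Tj (j : T) : T (val j) := set_mem (valP j).

Let big_fun r : dprod Mj := fun j => mx (val j) r.

Let big_in r : sg_set (gprod_subgroup Mj) (big_fun r).
Proof.
apply: (sub_finite_set _ (gproj_finite r)) => g [j] /=; rewrite /big_fun.
rewrite (gproj_hom (f := mx (val j))); [|exact: mxD|by move=> *; exact: mx_homog].
by apply: contraNneq => ->; apply/eqP; exact: morph0 (@mxD _).
Qed.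

Let big r : gprod Mj := mk_subgrp (@big_in r).

Let bigE r j : subgrp_val (big r) j = mx (val j) r. Proof. by []. Qed.

Let bigD : {morph big : r r' / r + r'}.
Proof. by move=> r r'; apply: gprod_ext => j; rewrite bigE mxD. Qed.

Let big_inj r : big r = 0 -> r = 0.
Proof.
move=> E; have e0 p q : B p -> B q -> entry p q r = 0.
  move=> Bp Bq; case: (eqVneq (gdom p.1) (gdom q.1)) => [d|/eqP]; last exact: entry_off.
  have [_ _ _ Tp _] := memB Bp.
  pose j : T := exist (fun f => f \in T) (gdom p.1) (mem_set Tp).
  have Kp : p \in K (val j) by apply: mem_set.
  have Kq : q \in K (val j) by apply: mem_set.
  have := congr1 (fun A : gprod Mj => subgrp_val (subgrp_val (subgrp_val A j)
    (exist _ p Kp) (exist _ q Kq))) E.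
  by [].
have [L1 [B1 E1]] := expand_right r.
have y0 p : B p -> rmul p.2.2 r = 0.
  move=> Bp; rewrite (E1 (undup L1)) ?undup_uniq //; first last.
  - by move=> x; rewrite mem_undup.
  - by move=> x; rewrite mem_undup; exact: B1.
  rewrite rmul_bigr big_seq big1 // => q; rewrite mem_undup => /B1 Bq.
  by rewrite rmulA -[rmul p.2.2 _]/(entry p q r) e0 // mul0.
have [L [BL EL]] := expand_left r.
rewrite (EL (undup L)) ?undup_uniq //; first last.
- by move=> x; rewrite mem_undup.
- by move=> x; rewrite mem_undup; exact: BL.
by rewrite big_seq big1 // => p; rewrite mem_undup => /BL /y0 ->; rewrite rmul0.
Qed.

Let Mj_summable : gr_summable Mj.
Proof.
move=> A; have [u uu hu] := finite_uniq (subgrpP A).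
pose L := flatten [seq [seq gdom p.1 | p <- fr (grng g)] | g <- u].
apply: (sub_finite_set _ (finite_val_seq T L)) => j /= /eqP nj.
have [g ng] := @gproj_neq0 _ (Mj j) _ nj.
have gu : g \in u by apply: hu; exists j.
apply/flattenP; exists [seq gdom p.1 | p <- fr (grng g)]; first exact: map_f.
have [k [l nkl]] : exists k l, subgrp_val (gproj g (subgrp_val A j)) k l <> 0.
  apply: contrapT => H; case/eqP: ng; apply: gmatrix_ext => k l.
  by apply: contrapT => n; apply: H; exists k, l.
have := gmatrix_homog (gproj_homog g (subgrp_val A j)) k l.
case E: conj_deg => [h|] //= _; apply/mapP; exists (val k).
  by rewrite -(conj_deg_rng E) gdom_inv; case: (KP k).
by case: (KP k).
Qed.

(** A matrix is a finite sum of matrices with a single entry, so that this gives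
    surjectivity. *)
Let big_emx (j : T) (k l : K (val j)) (d : D (val j)) :
  big (rmul (val k).2.1 (rmul (subgrp_val d) (val l).2.2)) =
  gembed (emx (@corner_supp G R (val j)) (@sg_rng (val j)) (@sg_fin (val j))
    k l d : Mj j).
Proof.
have [[Bk dk] [Bl dl]] := (KP k, KP l); have [d1 d2] := subgrpP d.
have ent p q : B p -> B q ->
    entry p q (rmul (val k).2.1 (rmul (subgrp_val d) (val l).2.2)) =
    if (p == val k) && (q == val l) then subgrp_val d else 0.
  move=> Bp Bq; rewrite /entry -!rmulA (orthB Bl Bq) rmulA (orthB Bp Bk).
  rewrite [q == _]eq_sym; case: eqP => [->|_]; last exact: mul0.
  by case: eqP => _; rewrite ?rmul0 // dk dl d2 d1.
apply/esym/gembed_eq => [|i n]; rewrite bigE; apply: mx_ext => m q; rewrite mxE.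
  rewrite ent; [|exact: (KP m).1|exact: (KP q).1].
  by rewrite emxE -!val_eqE; case: ifP.
rewrite ent; [|exact: (KP m).1|exact: (KP q).1].
case: eqP => //= E; case: n; apply: val_inj.
have [_ dm] := KP m; rewrite -[LHS]dk -[RHS]dm.
exact: (esym (congr1 (fun p => gdom p.1) E)).
Qed.

Let big_surj (A : gprod Mj) : exists r, big r = A.
Proof.
pose im : set (gprod Mj) := [set A | exists r, big r = A].
have im0 : im 0 by exists 0; exact: morph0 bigD.
have imD x y : im x -> im y -> im (x + y).
  by move=> [a <-] [b <-]; exists (a + b); exact: bigD.
have im_sum (I : Type) (s : seq I) (F : I -> gprod Mj) :
    (forall i, im (F i)) -> im (\sum_(i <- s) F i).
  by move=> H; elim: s => [|i s ih]; rewrite ?big_nil ?big_cons //; exact: imD.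
have [t ->] := summable_expand A Mj_summable.
apply: (im_sum) => j; set C := subgrp_val A j.
have [u uu hu] := finite_uniq (subgrpP C).
have -> : C = \sum_(p <- u) emx (@corner_supp G R (val j)) (@sg_rng (val j))
    (@sg_fin (val j)) p.1 p.2 (subgrp_val C p.1 p.2).
  apply: gmatrix_ext => k l.
  have add : {morph (fun A : M (val j) => subgrp_val A k l) : x y / x + y} by [].
  rewrite (morph_sum add).
  rewrite (eq_bigr (fun p => if p == (k, l) then subgrp_val C k l else 0)); last first.
    move=> [i m] _; rewrite emxE xpair_eqE [k == i]eq_sym [l == m]eq_sym.
    by case: eqP => [->|] //=; case: eqP => [->|].
  case klu: ((k, l) \in u).
    by rewrite (bigD1_seq (k, l)) //= eqxx big1 ?addr0 // => p /negPf ->.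
  rewrite big_seq big1 => [|p pu]; last by case: eqP => // pk; rewrite -pk pu in klu.
  by apply/eqP/negPn/negP => /(hu (k, l)); rewrite klu.
have addg : {morph (@gembed _ _ Mj j) : x y / x + y}.
  move=> x y; have N z : gembed (- z : Mj j) = - gembed z.
    by rewrite -sub0r gembedB gembed0 sub0r.
  by rewrite -[y]opprK gembedB N !opprK.
rewrite (morph_sum addg); apply: im_sum => p.
by rewrite -big_emx; eexists.
Qed.

Let big_iso : gr_ring_iso R (gprod Mj).
Proof.
exists big; split.
- apply: inj_surj_bij => [r r' E|]; last exact: big_surj.
  apply/eqP; rewrite -subr_eq0; apply/eqP/big_inj.
  by rewrite (morphB bigD) E subrr.
- exact: bigD.
- by move=> r r'; apply: gprod_ext => j; rewrite bigE mxM.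
- by move=> g r hr; apply/gprod_homog => j; exact: mx_homog.
Qed.

(** The column of any member is right invertible, so its row is a two-sided
    inverse, which cannot be orthogonal to a second nonzero column. *)
Let frame_pivot t p q : T t -> p \in fr t -> q \in fr t -> p = q.
Proof.
move=> Tt pt qt; apply: contrapT => npq.
have [Bp rp] := frB pt; have [Bq rq] := frB qt.
have [hx hy _ Dp yx] := memB Bp; have [hx' _ _ Dq yx'] := memB Bq.
have nx : p.2.1 <> 0.
  by move=> E; move: yx; rewrite E rmul0 => /esym; exact: (pT.1 _ Dp).1.
have [z hz xz] := (pT.1 t Tt).2 _ _ hx rp nx.
have yz : z = p.2.2.
  rewrite -[RHS](mul_gone hy) gdom_inv rp -xz rmulA yx.
  by rewrite -[gdom _]grng_inv (gone_mul hz).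
have : q.2.1 = 0.
  rewrite -(gone_mul hx') rq -xz yz -rmulA orthB //.
  by case: eqP => [/npq//|_]; exact: rmul0.
by move=> E; move: yx'; rewrite E rmul0 => /esym; exact: (pT.1 _ Dq).1.
Qed.

Let frame_dom t p : T t -> p \in fr t -> gdom p.1 = t.
Proof.
move=> Tt pt; have [Bp rp] := frB pt; have [hx _ _ Dp yx] := memB Bp.
apply/esym/uT => //; exists p.1, p.2.1; split => // E.
by move: yx; rewrite E rmul0 => /esym; exact: (pT.1 _ Dp).1.
Qed.

Let frame_nonempty t : T t -> exists p, p \in fr t.
Proof.
move=> Tt; apply: contrapT => H; apply: (pT.1 t Tt).1.
rewrite -frE /frame_proj big_seq big1 // => p pt; by case: H; exists p.
Qed.

(** The isomorphism sends [r] to the matrices of its entries [y_k r x_l]. A frame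
    of a pivot in [T] has a single member, which starts at that pivot because
    distinct members of [T] are not linked; this singles out one row in one
    factor. *)
Lemma wedderburn : matrix_decomposition R.
Proof.
exists T, (fun j => K (val j)), (fun j => val j), (fun j => val j), (fun j => D (val j)).
exists (fun j => @corner_supp G R (val j)), (fun j => @sg (val j)).
exists (fun j => @sg_rng (val j)), (fun j => @sg_fin (val j)).
have kj (j : T) : exists k : K (val j), gdom (sg k) = val j.
  have [p pj] := frame_nonempty (Tj j); have [Bp rp] := frB pj.
  have Kp : p \in K (val j).
    by apply: mem_set; split => //; exact: frame_dom (Tj j) pj.
  by exists (exist _ p Kp); rewrite gdom_inv.
have sg_fr (j : T) i (k : K i) : gdom (sg k) = val j -> val k \in fr (val j).
  by rewrite gdom_inv => <-; case: (KP k).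
split.
- by move=> j; have [k _] := kj j; exists k.
- by move=> j; exact: corner_division pT (Tj j).
- exact: Mj_summable.
- exact: big_iso.
move=> j; have [k0 E0] := kj j; split.
  exists k0; apply/seteqP; split => [k /= E|k ->//].
  by apply: val_inj; apply: (frame_pivot (Tj j)); exact: sg_fr.
apply/seteqP; split => [i [k /= E]|i ->]; last by exists k0.
apply: val_inj; rewrite -(frame_dom (Tj j) (sg_fr j _ k E)).
by case: (KP k).
Qed.

End Wedderburn.

Lemma pivotal_matrix_decomposition (G : groupoid) (R : gradedRing G) Delta :
  pivotal R Delta -> matrix_decomposition R.
Proof. by move=> /unlinked_pivotal[T [pT uT]]; exact: wedderburn pT uT. Qed.

(** * The equivalence *)

Theorem theorem7p5 (G : groupoid) (R : gradedRing G) :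
  [<->
    (* (1) *)
    pfm_ring R;
    (* (2) *)
    exists (J : Type) (K : J -> choiceType) (e f : J -> gobj G)
      (D : J -> gradedRing G)
      (De : forall j, gsupp (D j) `<=` corner (e j))
      (s : forall j, K j -> G)
      (se : forall j k, grng (s j k) = e j)
      (sfin : forall j, d_finite (s j)),
      let M j := gmatrix (De j) (se j) (sfin j) in
      [/\ forall j, [set: K j] !=set0,
          forall j, gr_division (D j),
          gr_summable M,
          gr_ring_iso R (gprod M)
        & forall j,
            (exists k0, [set k | gdom (s j k) = f j] = [set k0]) /\
            [set j' | [set k | gdom (s j' k) = f j] !=set0] = [set j]];
    (* (3) *)
    exists (J : Type) (Rj : J -> gradedRing G) (f : J -> gobj G),
      [/\ gr_summable Rj,
          forall j, gr_prime (Rj j) /\ pfm_ring (Rj j),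
          gr_ring_iso R (gprod Rj)
        & forall j, gr_simple_mod (ring_at R (f j)) /\
                    nonzero_gz (ring_at (Rj j) (f j))];
    (* (4) *)
    exists (J : Type) (Rj : J -> gradedRing G) (f : J -> gobj G),
      [/\ gr_summable Rj,
          forall j, gr_simple_ring (Rj j),
          gr_ring_iso R (gprod Rj)
        & forall j, gr_simple_mod (ring_at R (f j)) /\
                    nonzero_gz (ring_at (Rj j) (f j))];
    (* (5) *)
    exists Delta : set (gobj G),
      [/\ Delta `<=` nonzero_objects R,
          obj_simple (ring_at_set R Delta)
        & exists (I : Type) (e : I -> gobj G) (s : I -> G),
            (forall i, Delta (e i)) /\
            gr_mod_iso (regular_module R)
              (dsum (fun i => gshift (ring_at R (e i)) (s i)))];
    (* (6) *)
    exists (J : Type) (Rj : J -> gradedRing G) (f : J -> gobj G),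
      [/\ gr_summable Rj,
          forall j, gr_simple_ring (Rj j) /\ obj_artinian (Rj j),
          gr_ring_iso R (gprod Rj)
        & forall j, division_at R (f j) /\
            forall j', j' <> j ->
              @homog G (Rj j') (gid (f j)) = [set 0]]].
Proof.
have simple_pivotal (J : Type) (Rj : J -> gradedRing G) (f : J -> gobj G) :=
  @simple_factors_pivotal _ R J Rj f.
tfae.
- by move=> /pfm_pivotal /pivotal_matrix_decomposition.
- move=> /matrix_decomposition_factors[J [Rj [f pf]]]; exists J, Rj, f.
  have [sm piv iso _] := pf; split=> // j; last exact: factors_simple_object.
  split; last exact: pivotal_pfm (piv j).
  exact: simple_prime (pivotal_simple (piv j)).
- move=> [J [Rj [f [sm H iso sf]]]]; exists J, Rj, f; split=> // j.
  have [pr pfm] := H j; apply: (pivotal_prime_simple (pfm_pivotal pfm) pr).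
  exists (gone (Rj j) (f j)); apply/eqP/ring_at_neq0; exact: (sf j).2.
- move=> [J [Rj [f [sm simp iso sf]]]].
  have pR := simple_pivotal J Rj f sm simp iso sf.
  have nz : range f `<=` nonzero_objects R by move=> e /pR.1[] /eqP.
  exists (range f); split=> //; first exact/(obj_simple_pivot nz)/pR.1.
  have [I [c [x [bx Dc]]]] := pivotal_basis pR (regular_module R).
  exists I, (fun i => gdom (c i)), (fun i => ginv (c i)); split=> //.
  exact: basis_iso bx.
- move=> [Delta [nz simp [I [e [s [De isoL]]]]]].
  have pR : pivotal R Delta.
    split; first exact/(obj_simple_pivot nz).
    move=> K gK HK; apply: (shift_sum_generates isoL) => // _ [i _ <-].
    exact/HK/De.
  have [J [Rj [f pf]]] :=
    matrix_decomposition_factors (pivotal_matrix_decomposition pR).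
  have [sm piv iso off] := pf; exists J, Rj, f; split=> // j.
    by split; [exact: pivotal_simple (piv j)|exact: pivotal_artinian (piv j)].
  split; first exact: pivot_division (factors_pivot j pf).
  by move=> k n; apply/homog_zero_off/off/nesym.
- move=> [J [Rj [f [sm H iso dv]]]].
  have off j k : j <> k -> gone (Rj k) (f j) = 0.
    by move=> n; apply/homog_zero_off; apply: (dv j).2; exact/nesym.
  apply: (@pivotal_pfm _ _ (range f)); apply: (simple_pivotal J Rj f) => // j.
    by case: (H j).
  have [simp art] := H j.
  have dj : division_at (Rj j) (f j).
    apply: (product_division (off j)); exact: division_iso iso (dv j).1.
  have pj := artinian_pivot simp art dj; split; last first.
    by apply/ring_at_neq0; case: dj.
  apply/pivotP; apply: (pivot_iso (gr_ring_iso_sym iso)).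
  by apply: (product_pivot (j := j)) => //; exact: off.
Qed.
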